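(* Let $(\mathcal A,\mathbf r_{\mathcal A})$ be a coquasitriangular bialgebra over $k$ with a homomorphism $\Psi:(\mathcal A,\mathbf r_{\mathcal A})\to(k_q[G],\mathbf r)$ of coquasitriangular bialgebras, and let $\mathbf r'\in\{\mathbf r,\bar{\mathbf r}_{21}\}$. The algebra $\mathcal A$ is a domain if and only if the covariantized algebra $\mathcal A_{\mathbf r'}$ is a domain.
   Context: **Quantised enveloping algebra.** Let $\mathfrak g$ be a finite-dimensional complex semisimple Lie algebra of rank $r$ with Cartan subalgebra $\mathfrak h$, simple roots $\alpha_1,\dots,\alpha_r$, Weyl group $W$, root lattice $Q$, weight lattice $P$, $Q^+=\sum_i\mathbb N_0\alpha_i$, dominant integral weights $P^+$. Let $(\cdot,\cdot)$ be the $W$-invariant symmetric bilinear form on $\mathfrak h^*$ with $(\alpha,\alpha)=2$ for all short roots. Let $k=\mathbb C(q^{1/N})$ with $N$ such that $(\lambda,\mu)\in\frac1N\mathbb Z$ for all $\lambda,\mu\in P$, and $q_i=q^{(\alpha_i,\alpha_i)/2}$. $U=\check U_q(\mathfrak g)$ is the $k$-algebra generated by $x_i,y_i$ ($1\le i\le r$), $\tau(\lambda)$ ($\lambda\in P$) with relations $\tau(0)=1$, $\tau(\lambda)\tau(\mu)=\tau(\lambda+\mu)$, $\tau(\lambda)x_j=q^{(\lambda,\alpha_j)}x_j\tau(\lambda)$, $\tau(\lambda)y_j=q^{-(\lambda,\alpha_j)}y_j\tau(\lambda)$, $x_iy_j-y_jx_i=\delta_{ij}(t_i-t_i^{-1})/(q_i-q_i^{-1})$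 where $t_i=\tau(\alpha_i)$, and the quantum Serre relations for the $x_i$ and for the $y_i$. It is a Hopf algebra with $\Delta\tau(\lambda)=\tau(\lambda)\otimes\tau(\lambda)$, $\Delta x_i=x_i\otimes1+t_i\otimes x_i$, $\Delta y_i=y_i\otimes t_i^{-1}+1\otimes y_i$, $\sigma(\tau(\lambda))=\tau(-\lambda)$, $\sigma(x_i)=-t_i^{-1}x_i$, $\sigma(y_i)=-y_it_i$ ($\sigma$ always denotes the antipode, $\varepsilon$ the counit; Sweedler notation $\Delta(c)=c_{(1)}\otimes c_{(2)}$). $U^\pm$ are the subalgebras generated by the $x_i$, respectively the $y_i$; $U^\pm_\alpha=\{u\in U^\pm:\tau(\lambda)u\tau(-\lambda)=q^{(\lambda,\alpha)}u\ \forall\lambda\}$; $U_q(\mathfrak b^\pm)$ is generated by $U^\pm$ and all $\tau(\lambda)$. **Quantised functions.** A $U$-module is of type one if it has a basis of weight vectors with weights in $P$ ($v$ has weight $\mathrm{wt}(v)=\lambda$ if $\tau(\mu)v=q^{(\mu,\lambda)}v$ for all $\mu\in P$). $\mathcal C$ is the category of finite-dimensional type one $U$-modules, with simple objects the highest weight modules $V(\lambda)$, $\lambda\in P^+$. For $V\in\mathcal C$, $v\in V$, $f\in V^*$ put $c_{f,v}(u)=f(uv)$, $C^V=\mathrm{span}\{c_{f,v}\}$. With $G$ the connected simply connected affine algebraic group with Lie algebra $\mathfrak g$, $k_q[G]=\bigoplus_{\lambda\in P^+}C^{V(\lambda)}$ is the Hopf subalgebra of the Hopf dual $U^\circ$ spanned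 by all $c_{f,v}$. **Universal $r$-form.** A universal $r$-form on a bialgebra $A$ is a convolution invertible linear map $\mathbf r:A\otimes A\to k$ with $\mathbf r(a_{(1)},b_{(1)})a_{(2)}b_{(2)}=b_{(1)}a_{(1)}\mathbf r(a_{(2)},b_{(2)})$, $\mathbf r(ab,c)=\mathbf r(a,c_{(1)})\mathbf r(b,c_{(2)})$, $\mathbf r(a,bc)=\mathbf r(a_{(1)},c)\mathbf r(a_{(2)},b)$; then $(A,\mathbf r)$ is called coquasitriangular. Let $(\cdot,\cdot):U_q(\mathfrak b^-)\times U_q(\mathfrak b^+)\to k$ be the bilinear pairing with $(y,xx')=(\Delta(y),x'\otimes x)$, $(yy',x)=(y\otimes y',\Delta(x))$, $(\tau(\mu),\tau(\nu))=q^{-(\mu,\nu)}$, $(y_i,x_j)=-\delta_{ij}(q_i-q_i^{-1})^{-1}$, $(\tau(\mu),x_i)=0=(y_i,\tau(\mu))$. For $\alpha\in Q^+$ let $\Theta_\alpha=\sum_s u_s\otimes v_s\in U^+_\alpha\otimes U^-_{-\alpha}$, $(u_s)$ a basis of $U^+_\alpha$, $(v_s)$ the dual basis of $U^-_{-\alpha}$. The braiding of $\mathcal C$ is $\hat R_{V,W}=P_{12}\circ(\sum_\alpha\Theta_\alpha)\circ f_{V,W}:V\otimes W\to W\otimes V$ with $f_{V,W}(v\otimes w)=q^{-(\mathrm{wt}(v),\mathrm{wt}(w))}v\otimes w$, $P_{12}$ the flip. $\mathbf r(c_{f,v},c_{g,w})=(g\otimes f)(\hat R_{V,W}(v\otimes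 w))$ is a universal $r$-form on $k_q[G]$, with convolution inverse $\bar{\mathbf r}(a,b)=\mathbf r(\sigma(a),b)$; $\bar{\mathbf r}_{21}(a,b)=\bar{\mathbf r}(b,a)$ is again a universal $r$-form. **Framework.** A homomorphism $\Psi$ of coquasitriangular bialgebras is a bialgebra homomorphism with $\mathbf r_{\mathcal A}=\mathbf r\circ(\Psi\otimes\Psi)$. Convention: elements of $\mathcal A$ occurring in arguments of $\mathbf r'$ have $\Psi$ applied to them first, and $\sigma(a)$ means $\sigma(\Psi(a))$. The covariantized algebra $\mathcal A_{\mathbf r'}$ is the vector space $\mathcal A$ with unit $1$ and product $a_{\mathbf r'}b=\mathbf r'(a_{(1)},b_{(2)})\,\mathbf r'(a_{(3)},\sigma(b_{(1)}))\,a_{(2)}b_{(3)}$. A domain is an algebra without zero divisors. *)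

(* Defs.v *)
From HB Require Import structures.
From Stdlib Require Import Relation_Operators.
From mathcomp Require Import all_boot all_order all_algebra.
From mathcomp Require Import generic_quotient fraction.
From mathcomp Require Import boolp classical_sets fsbigop reals.
From mathcomp Require Import complex.

Set Implicit Arguments.
Unset Strict Implicit.
Unset Printing Implicit Defensive.

Import Order.TTheory GRing.Theory Num.Theory.

Local Open Scope quotient_scope.
Local Open Scope ring_scope.

(** * Tensors

    An element of V ⊗ W is represented by a finite list of pairs, standing for
    a sum of pure tensors; two lists represent the same tensor iff every
    bilinear map out of V × W takes the same total value on them. All the
    "Sweedler sums" below are evaluations of (multi)linear expressions on such
    lists, hence do not depend on the representative. *)

Section Tensors.
Variable K : fieldType.

Definition bilinear_map (V W Z : lmodType K) (f : V -> W -> Z) : Prop :=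
  (forall w, linear (f^~ w)) /\ (forall v, linear (f v)).

Definition bilinear_form (V W : lmodType K) (f : V -> W -> K) : Prop :=
  (forall w, scalar (f^~ w)) /\ (forall v, scalar (f v)).

Definition trilinear_map (V W X Z : lmodType K) (f : V -> W -> X -> Z) : Prop :=
  [/\ forall w x, linear (fun v => f v w x),
      forall v x, linear (fun w => f v w x) &
      forall v w, linear (f v w)].

Definition tensor_eq (V W : lmodType K) (s t : seq (V * W)) : Prop :=
  forall (Z : lmodType K) (f : V -> W -> Z), bilinear_map f ->
    \sum_(p <- s) f p.1 p.2 = \sum_(p <- t) f p.1 p.2.

Definition tensor_eq3 (V W X : lmodType K) (s t : seq (V * W * X)) : Prop :=
  forall (Z : lmodType K) (f : V -> W -> X -> Z), trilinear_map f ->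
    \sum_(p <- s) f p.1.1 p.1.2 p.2 = \sum_(p <- t) f p.1.1 p.1.2 p.2.

End Tensors.

(** * Bialgebras, Hopf algebras, universal r-forms *)

Section Bialgebras.
Variable K : fieldType.

Record bialgebra (A : algType K) := Bialgebra {
  cop : A -> seq (A * A);
  counit : A -> K;
  cop_linear : forall c a b,
    tensor_eq (cop (c *: a + b)) ([seq (c *: p.1, p.2) | p <- cop a] ++ cop b);
  cop_coassoc : forall a,
    tensor_eq3 [seq (q.1, q.2, p.2) | p <- cop a, q <- cop p.1]
               [seq (p.1, q.1, q.2) | p <- cop a, q <- cop p.2];
  cop_counitl : forall a, \sum_(p <- cop a) counit p.1 *: p.2 = a;
  cop_counitr : forall a, \sum_(p <- cop a) counit p.2 *: p.1 = a;
  cop1 : tensor_eq (cop 1) [:: (1, 1)];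
  copM : forall a b,
    tensor_eq (cop (a * b))
              [seq (p.1 * q.1, p.2 * q.2) | p <- cop a, q <- cop b];
  counit_scalar : scalar counit;
  counit1 : counit 1 = 1;
  counitM : forall a b, counit (a * b) = counit a * counit b
}.

Record hopf_algebra (A : algType K) := HopfAlgebra {
  hopf_bialgebra :> bialgebra A;
  antipode : A -> A;
  antipode_linear : linear antipode;
  antipodel : forall a,
    \sum_(p <- cop hopf_bialgebra a) antipode p.1 * p.2
      = counit hopf_bialgebra a *: 1;
  antipoder : forall a,
    \sum_(p <- cop hopf_bialgebra a) p.1 * antipode p.2
      = counit hopf_bialgebra a *: 1
}.

(* a_(1) ⊗ a_(2) ⊗ a_(3) *)
Definition cop3 (A : algType K) (BA : bialgebra A) (a : A) : seq (A * A * A) :=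
  [seq (q.1, q.2, p.2) | p <- cop BA a, q <- cop BA p.1].

Definition bialgebra_hom (A B : algType K) (BA : bialgebra A)
    (BB : bialgebra B) (f : A -> B) : Prop :=
  [/\ linear f,
      f 1 = 1 /\ (forall a b, f (a * b) = f a * f b),
      forall a, tensor_eq (cop BB (f a)) [seq (f p.1, f p.2) | p <- cop BA a] &
      forall a, counit BB (f a) = counit BA a].

Definition convolution_inverse (A : algType K) (BA : bialgebra A)
    (r r' : A -> A -> K) : Prop :=
  forall a b,
    \sum_(p <- cop BA a) \sum_(q <- cop BA b) r p.1 q.1 * r' p.2 q.2
      = counit BA a * counit BA b /\
    \sum_(p <- cop BA a) \sum_(q <- cop BA b) r' p.1 q.1 * r p.2 q.2
      = counit BA a * counit BA b.

Record universal_rform (A : algType K) (BA : bialgebra A)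
    (r : A -> A -> K) : Prop := UniversalRForm {
  rform_bilinear : bilinear_form r;
  rform_invertible :
    exists2 r', bilinear_form r' & convolution_inverse BA r r';
  rform_braided : forall a b,
    \sum_(p <- cop BA a) \sum_(q <- cop BA b) r p.1 q.1 *: (p.2 * q.2) =
    \sum_(p <- cop BA a) \sum_(q <- cop BA b) r p.2 q.2 *: (q.1 * p.1);
  rformMl : forall a b c,
    r (a * b) c = \sum_(p <- cop BA c) r a p.1 * r b p.2;
  rformMr : forall a b c,
    r a (b * c) = \sum_(p <- cop BA a) r p.1 c * r p.2 b
}.

Definition coquasitriangular_hom (A B : algType K)
    (BA : bialgebra A) (rA : A -> A -> K)
    (BB : bialgebra B) (rB : B -> B -> K) (f : A -> B) : Prop :=
  bialgebra_hom BA BB f /\ (forall a b, rA a b = rB (f a) (f b)).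

Definition rbar (B : algType K) (HB : hopf_algebra B) (r : B -> B -> K) :
  B -> B -> K := fun a b => r (antipode HB a) b.

Definition rbar21 (B : algType K) (HB : hopf_algebra B) (r : B -> B -> K) :
  B -> B -> K := fun a b => rbar HB r b a.

(* The product of the covariantized algebra, on the vector space A. *)
Definition cov_mul (A B : algType K) (BA : bialgebra A) (HB : hopf_algebra B)
    (Psi : A -> B) (r' : B -> B -> K) (a b : A) : A :=
  \sum_(p <- cop3 BA a) \sum_(q <- cop3 BA b)
    (r' (Psi p.1.1) (Psi q.1.2) * r' (Psi p.2) (antipode HB (Psi q.1.1)))
      *: (p.1.2 * q.2).

Definition no_zero_divisors (A : algType K) (mul : A -> A -> A) : Prop :=
  forall a b, mul a b = 0 -> a = 0 \/ b = 0.

End Bialgebras.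

Section Subalgebras.
Variables (K : fieldType) (A : algType K).

Inductive generated_subalgebra (S : A -> Prop) : A -> Prop :=
| gen_in a : S a -> generated_subalgebra S a
| gen_one : generated_subalgebra S 1
| gen_scale c a : generated_subalgebra S a -> generated_subalgebra S (c *: a)
| gen_add a b : generated_subalgebra S a -> generated_subalgebra S b ->
    generated_subalgebra S (a + b)
| gen_mul a b : generated_subalgebra S a -> generated_subalgebra S b ->
    generated_subalgebra S (a * b).

Definition basis_of_pred (S : A -> Prop) (s : seq A) : Prop :=
  (forall i : 'I_(size s), S s`_i) /\
  (forall a, S a ->
    exists! c : {ffun 'I_(size s) -> K}, a = \sum_i c i *: s`_i).

End Subalgebras.

(** * Semisimple Lie algebras, roots and weights *)

Section LieAlgebras.
Variables (C : numFieldType) (g : vectType C) (br : g -> g -> g).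

Definition is_lie_bracket : Prop :=
  [/\ bilinear_map br, forall x, br x x = 0 &
      forall x y z, br x (br y z) + br y (br z x) + br z (br x y) = 0].

Definition brv (U V : {vspace g}) : {vspace g} :=
  <<[seq br x y | x <- vbasis U, y <- vbasis V]>>%VS.

Definition is_ideal (I : {vspace g}) : Prop :=
  forall x y, y \in I -> br x y \in I.

Definition is_solvable (I : {vspace g}) : Prop :=
  exists n, iter n (fun J => brv J J) I = 0%VS.

Definition is_semisimple : Prop :=
  forall I, is_ideal I -> is_solvable I -> I = 0%VS.

(* nilpotent and equal to its own normalizer *)
Definition is_cartan (h : {vspace g}) : Prop :=
  (exists n, iter n (brv h) h = 0%VS) /\
  (forall x, x \in h <-> (forall y, y \in h -> br x y \in h)).

Variable h : {vspace g}.

Local Notation cdual := 'Hom(subvs_of h, C^o).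

Definition root_space (b : cdual) (x : g) : Prop :=
  forall t : subvs_of h, br (vsval t) x = b t *: x.

Definition is_root (b : cdual) : Prop :=
  b <> 0 /\ exists2 x, x <> 0 & root_space b x.

Definition is_coroot (b : cdual) (t : subvs_of h) : Prop :=
  b t = 2%:R /\
  exists e f, [/\ root_space b e, root_space (- b) f & vsval t = br e f].

Definition is_weight (l : cdual) : Prop :=
  forall b t, is_root b -> is_coroot b t -> exists n : int, l t = n%:~R.

Inductive weyl_group : (cdual -> cdual) -> Prop :=
| weyl_id : weyl_group id
| weyl_refl b t w : is_root b -> is_coroot b t -> weyl_group w ->
    weyl_group (fun l => w l - (w l) t *: b).

Definition simple_roots (r : nat) (alpha : 'I_r -> cdual) : Prop :=
  [/\ basis_of fullv [seq alpha i | i <- enum 'I_r],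
      forall i, is_root (alpha i) &
      forall b, is_root b -> exists n : 'I_r -> nat,
        b = \sum_i alpha i *+ n i \/ b = - \sum_i alpha i *+ n i].

Variable form : cdual -> cdual -> C.

(* Two roots are in the same irreducible component of the root system iff they
   are joined by a chain of successively non-orthogonal roots. *)
Definition same_component : cdual -> cdual -> Prop :=
  clos_refl_trans cdual
    (fun b c => [/\ is_root b, is_root c & form b c <> 0]).

Definition is_short_root (b : cdual) : Prop :=
  is_root b /\
  (forall c, is_root c -> same_component b c -> form b b <= form c c).

(* The positivity clause says that [form b b] is a squared length; it is what
   gives a meaning to "short". In a simply laced component all roots are
   short. *)
Definition normalized_form : Prop :=
  [/\ bilinear_form form, forall l m, form l m = form m l,
      forall w l m, weyl_group w -> form (w l) (w m) = form l m,
      forall b, is_root b -> 0 < form b b &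
      forall b, is_short_root b -> form b b = 2%:R].

End LieAlgebras.

(* h^* *)
Notation cdual h := 'Hom(subvs_of h, _^o).

(* C(q^(1/N)); the indeterminate of the polynomial ring is q^(1/N). *)
Notation qfield R := {fraction {poly R[i]}}.

Record cartan_datum (R : realType) := CartanDatum {
  lie : vectType R[i];
  lie_br : lie -> lie -> lie;
  lie_brP : is_lie_bracket lie_br;
  lie_semisimple : is_semisimple lie_br;
  cartan : {vspace lie};
  cartanP : is_cartan lie_br cartan;
  rank : nat;
  alpha : 'I_rank -> cdual cartan;
  alphaP : simple_roots lie_br alpha;
  form : cdual cartan -> cdual cartan -> R[i];
  formP : normalized_form lie_br form;
  denom : nat; (* the N of q^(1/N) *)
  denom_gt0 : (0 < denom)%N;
  denomP : forall l m, is_weight lie_br l -> is_weight lie_br m ->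
    exists n : int, form l m = n%:~R / denom%:R
}.

(** * The quantised enveloping algebra *)

Section QuantisedEnvelopingAlgebra.
Variables (R : realType) (D : cartan_datum R).

Local Notation qfield := (qfield R).
Local Notation hdual := (cdual (cartan D)).

Definition wtP (l : hdual) : Prop := is_weight (@lie_br _ D) l.

(* q^z for z in (1/N)Z (junk for other z) *)
Definition qpow (z : R[i]) : qfield :=
  tofrac ('X : {poly R[i]}) ^
    xget 0 [set n : int | z = n%:~R / (denom D)%:R]%classic.

Definition qi (i : 'I_(rank D)) : qfield :=
  qpow (form (alpha i) (alpha i) / 2%:R).

Definition qint (c : qfield) (n : nat) : qfield :=
  (c ^+ n - c ^- n) / (c - c^-1).

Definition qbinom (c : qfield) (n s : nat) : qfield :=
  (\prod_(1 <= m < n.+1) qint c m) /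
  ((\prod_(1 <= m < s.+1) qint c m) * (\prod_(1 <= m < (n - s).+1) qint c m)).

Definition weight := {l : hdual | `[< wtP l >]}.

(* Noncommutative polynomial expressions in the generators; the algebra is
   their quotient by the least congruence [ueq] containing the axioms of unital
   associative algebras and the defining relations. *)
Inductive uterm :=
| Ucst of qfield
| Ux of 'I_(rank D)
| Uy of 'I_(rank D)
| Utau of weight
| Uadd of uterm & uterm
| Umul of uterm & uterm.

Definition uscale (c : qfield) (t : uterm) := Umul (Ucst c) t.
Definition usub (s t : uterm) := Uadd s (uscale (- 1) t).
Definition upow (t : uterm) (n : nat) := iter n (Umul t) (Ucst 1).
Definition usum (s : seq uterm) := foldr Uadd (Ucst 0) s.

(* tau(l) for l in P (junk value 0 for other l) *)
Definition utau (l : hdual) : uterm :=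
  if insub l is Some w then Utau w else Ucst 0.

Definition userre (z : 'I_(rank D) -> uterm) (i j : 'I_(rank D)) (n : nat) :=
  usum [seq uscale ((- 1) ^+ s * qbinom (qi i) n s)
              (Umul (Umul (upow (z i) (n - s)) (z j)) (upow (z i) s))
       | s <- iota 0 n.+1].

Inductive ueq : uterm -> uterm -> Prop :=
| ueq_refl t : ueq t t
| ueq_sym s t : ueq s t -> ueq t s
| ueq_trans s t u : ueq s t -> ueq t u -> ueq s u
| ueq_add s s' t t' : ueq s s' -> ueq t t' -> ueq (Uadd s t) (Uadd s' t')
| ueq_mul s s' t t' : ueq s s' -> ueq t t' -> ueq (Umul s t) (Umul s' t')
| ueq_addA s t u : ueq (Uadd s (Uadd t u)) (Uadd (Uadd s t) u)
| ueq_addC s t : ueq (Uadd s t) (Uadd t s)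
| ueq_add0 t : ueq (Uadd (Ucst 0) t) t
| ueq_mulA s t u : ueq (Umul s (Umul t u)) (Umul (Umul s t) u)
| ueq_mul1 t : ueq (Umul (Ucst 1) t) t
| ueq_mul0 t : ueq (Umul (Ucst 0) t) (Ucst 0)
| ueq_mulDl s t u : ueq (Umul (Uadd s t) u) (Uadd (Umul s u) (Umul t u))
| ueq_mulDr s t u : ueq (Umul s (Uadd t u)) (Uadd (Umul s t) (Umul s u))
| ueq_cstD c d : ueq (Ucst (c + d)) (Uadd (Ucst c) (Ucst d))
| ueq_cstM c d : ueq (Ucst (c * d)) (Umul (Ucst c) (Ucst d))
| ueq_cstC c t : ueq (Umul (Ucst c) t) (Umul t (Ucst c))
| ueq_tau0 : ueq (utau 0) (Ucst 1)
| ueq_tauD l m : wtP l -> wtP m -> ueq (Umul (utau l) (utau m)) (utau (l + m))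
| ueq_taux l j : wtP l ->
    ueq (Umul (utau l) (Ux j))
        (uscale (qpow (form l (alpha j))) (Umul (Ux j) (utau l)))
| ueq_tauy l j : wtP l ->
    ueq (Umul (utau l) (Uy j))
        (uscale (qpow (- form l (alpha j))) (Umul (Uy j) (utau l)))
| ueq_xy i j :
    ueq (usub (Umul (Ux i) (Uy j)) (Umul (Uy j) (Ux i)))
        (uscale ((i == j)%:R / (qi i - (qi i)^-1))
                (usub (utau (alpha i)) (utau (- alpha i))))
| ueq_serrex i j (n : nat) : i != j ->
    n%:R = 1 - 2%:R * form (alpha i) (alpha j) / form (alpha i) (alpha i) ->
    ueq (userre Ux i j n) (Ucst 0)
| ueq_serrey i j (n : nat) : i != j ->
    n%:R = 1 - 2%:R * form (alpha i) (alpha j) / form (alpha i) (alpha i) ->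
    ueq (userre Uy i j n) (Ucst 0).

HB.instance Definition _ := gen_eqMixin uterm.
HB.instance Definition _ := gen_choiceMixin uterm.

Definition ueqb (s t : uterm) : bool := `[< ueq s t >].

Lemma ueqb_refl : reflexive ueqb.
Proof. by move=> t; apply/asboolP; exact: ueq_refl. Qed.

Lemma ueqb_sym : symmetric ueqb.
Proof. by move=> s t; apply/asboolP/asboolP; exact: ueq_sym. Qed.

Lemma ueqb_trans : transitive ueqb.
Proof.
move=> s t u /asboolP ts /asboolP su; apply/asboolP; exact: ueq_trans ts su.
Qed.

Canonical ueqb_equiv := EquivRel ueqb ueqb_refl ueqb_sym ueqb_trans.

Definition Uq := {eq_quot ueqb}.
HB.instance Definition _ : EqQuotient _ ueqb Uq := EqQuotient.on Uq.
HB.instance Definition _ := Choice.on Uq.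

Definition upi (t : uterm) : Uq := \pi_Uq t.

Lemma upiP s t : upi s = upi t <-> ueq s t.
Proof.
rewrite /upi; split=> [/eqP|st].
  by rewrite eqmodE => /asboolP.
by apply/eqP; rewrite eqmodE; apply/asboolP.
Qed.

Lemma upi_repr (a : Uq) : upi (repr a) = a.
Proof. exact: reprK. Qed.

Lemma repr_upi t : ueq (repr (upi t)) t.
Proof. by apply/upiP; rewrite upi_repr. Qed.

Definition Uq_add (a b : Uq) : Uq := upi (Uadd (repr a) (repr b)).
Definition Uq_mul (a b : Uq) : Uq := upi (Umul (repr a) (repr b)).
Definition Uq_opp (a : Uq) : Uq := upi (uscale (- 1) (repr a)).
Definition Uq_scale (c : qfield) (a : Uq) : Uq := upi (uscale c (repr a)).

Lemma upiD s t : upi (Uadd s t) = Uq_add (upi s) (upi t).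
Proof. by apply/upiP/ueq_sym/ueq_add; exact: repr_upi. Qed.

Lemma upiM s t : upi (Umul s t) = Uq_mul (upi s) (upi t).
Proof. by apply/upiP/ueq_sym/ueq_mul; exact: repr_upi. Qed.

Lemma upiZ c t : upi (uscale c t) = Uq_scale c (upi t).
Proof.
apply/upiP/ueq_sym/ueq_mul; [exact: ueq_refl|exact: repr_upi].
Qed.

Lemma upi_surj (P : Uq -> Prop) : (forall t, P (upi t)) -> forall a, P a.
Proof. by move=> Pt a; rewrite -(upi_repr a). Qed.

Lemma Uq_addA : associative Uq_add.
Proof.
elim/upi_surj=> s; elim/upi_surj=> t; elim/upi_surj=> u.
by rewrite -!upiD; apply/upiP/ueq_addA.
Qed.

Lemma Uq_addC : commutative Uq_add.
Proof.
elim/upi_surj=> s; elim/upi_surj=> t.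
by rewrite -!upiD; apply/upiP/ueq_addC.
Qed.

Lemma Uq_add0 : left_id (upi (Ucst 0)) Uq_add.
Proof. by elim/upi_surj=> t; rewrite -upiD; apply/upiP/ueq_add0. Qed.

Lemma Uq_addN : left_inverse (upi (Ucst 0)) Uq_opp Uq_add.
Proof.
elim/upi_surj=> t.
have -> : Uq_opp (upi t) = upi (uscale (- 1) t) by rewrite upiZ.
rewrite -upiD; apply/upiP.
have h1 : ueq (Uadd (uscale (- 1) t) t)
              (Umul (Uadd (Ucst (- 1)) (Ucst 1)) t).
  apply: ueq_trans (ueq_sym (ueq_mulDl _ _ _)).
  by apply: ueq_add; [exact: ueq_refl|exact/ueq_sym/ueq_mul1].
apply: ueq_trans h1 _.
apply: ueq_trans (ueq_mul (ueq_sym (ueq_cstD _ _)) (ueq_refl _)) _.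
by rewrite addNr; exact: ueq_mul0.
Qed.

Lemma Uq_mulA : associative Uq_mul.
Proof.
elim/upi_surj=> s; elim/upi_surj=> t; elim/upi_surj=> u.
by rewrite -!upiM; apply/upiP/ueq_mulA.
Qed.

Lemma Uq_mul1l : left_id (upi (Ucst 1)) Uq_mul.
Proof. by elim/upi_surj=> t; rewrite -upiM; apply/upiP/ueq_mul1. Qed.

Lemma Uq_mul1r : right_id (upi (Ucst 1)) Uq_mul.
Proof.
elim/upi_surj=> t; rewrite -upiM; apply/upiP.
exact: ueq_trans (ueq_sym (ueq_cstC _ _)) (ueq_mul1 _).
Qed.

Lemma Uq_mulDl : left_distributive Uq_mul Uq_add.
Proof.
elim/upi_surj=> s; elim/upi_surj=> t; elim/upi_surj=> u.
by rewrite -!(upiM, upiD); apply/upiP/ueq_mulDl.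
Qed.

Lemma Uq_mulDr : right_distributive Uq_mul Uq_add.
Proof.
elim/upi_surj=> s; elim/upi_surj=> t; elim/upi_surj=> u.
by rewrite -!(upiM, upiD); apply/upiP/ueq_mulDr.
Qed.

(* The counit, on expressions; used only to see that 1 <> 0. *)
Fixpoint uaug (t : uterm) : qfield :=
  match t with
  | Ucst c => c
  | Ux _ | Uy _ => 0
  | Utau _ => 1
  | Uadd s t => uaug s + uaug t
  | Umul s t => uaug s * uaug t
  end.

Lemma wtP0 : wtP 0.
Proof. by move=> b t _ _; exists 0; rewrite lfunE. Qed.

Lemma wtPD l m : wtP l -> wtP m -> wtP (l + m).
Proof.
move=> Pl Pm b t rb ct; have [x lx] := Pl b t rb ct; have [y my] := Pm b t rb ct.
by exists (x + y); rewrite lfunE /= lx my intrD.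
Qed.

Lemma wtPN l : wtP l -> wtP (- l).
Proof.
move=> Pl b t rb ct; have [x lx] := Pl b t rb ct.
by exists (- x); rewrite opp_lfunE lx mulrNz.
Qed.

Lemma uaug_tau l : wtP l -> uaug (utau l) = 1.
Proof. by move=> Pl; rewrite /utau insubT //; exact/asboolP. Qed.

Lemma uaug_tauN l : uaug (utau (- l)) = uaug (utau l).
Proof.
have [Pl|nPl] := pselect (wtP l).
  by rewrite !uaug_tau //; exact: wtPN.
have nPNl : ~ wtP (- l) by move=> /wtPN; rewrite opprK.
by rewrite /utau !insubF //; apply/asboolPn.
Qed.

Lemma uaug_serre (z : 'I_(rank D) -> uterm) i j n :
  (forall i, uaug (z i) = 0) -> uaug (userre z i j n) = 0.
Proof.
move=> z0; rewrite /userre; elim: (iota _ _) => //= s ss ->.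
by rewrite z0 mulr0 mul0r mulr0 addr0.
Qed.

Lemma uaug_ueq s t : ueq s t -> uaug s = uaug t.
Proof.
elim=> {s t} //=; try by move=> *; congruence.
- by move=> s t u; rewrite addrA.
- by move=> s t; rewrite addrC.
- by move=> t; rewrite add0r.
- by move=> s t u; rewrite mulrA.
- by move=> t; rewrite mul1r.
- by move=> t; rewrite mul0r.
- by move=> s t u; rewrite mulrDl.
- by move=> s t u; rewrite mulrDr.
- by move=> c t; rewrite mulrC.
- by rewrite uaug_tau //; exact: wtP0.
- by move=> l m Pl Pm; rewrite !uaug_tau ?mulr1 //; exact: wtPD.
- by move=> *; rewrite mul0r !mulr0.
- by move=> *; rewrite mul0r !mulr0.
- by move=> i j; rewrite uaug_tauN !mul0r mulr0 addr0 mulN1r subrr mulr0.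
- by move=> i j n _ _; rewrite -[LHS]/(uaug (userre Ux i j n)) uaug_serre.
- by move=> i j n _ _; rewrite -[LHS]/(uaug (userre Uy i j n)) uaug_serre.
Qed.

Lemma Uq_1neq0 : upi (Ucst 1) != upi (Ucst 0).
Proof.
by apply/eqP => /upiP /uaug_ueq /= /eqP; rewrite oner_eq0.
Qed.

HB.instance Definition _ := GRing.isNzRing.Build Uq
  Uq_addA Uq_addC Uq_add0 Uq_addN Uq_mulA Uq_mul1l Uq_mul1r
  Uq_mulDl Uq_mulDr Uq_1neq0.

Lemma Uq_scaleA c d a : Uq_scale c (Uq_scale d a) = Uq_scale (c * d) a.
Proof.
elim/upi_surj: a => t; rewrite -!upiZ; apply/upiP.
apply: ueq_trans (ueq_mulA _ _ _) _.
exact: ueq_mul (ueq_sym (ueq_cstM _ _)) (ueq_refl _).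
Qed.

Lemma Uq_scale1 : left_id 1 Uq_scale.
Proof. by elim/upi_surj=> t; rewrite -upiZ; apply/upiP/ueq_mul1. Qed.

Lemma Uq_scaleDr : right_distributive Uq_scale +%R.
Proof.
move=> c; elim/upi_surj=> s; elim/upi_surj=> t.
by rewrite -[upi s + upi t]upiD -!upiZ -[RHS]upiD; apply/upiP/ueq_mulDr.
Qed.

Lemma Uq_scaleDl a : {morph Uq_scale^~ a : c d / c + d}.
Proof.
move=> c d; elim/upi_surj: a => t; rewrite -!upiZ -[RHS]upiD; apply/upiP.
apply: ueq_trans (ueq_mul (ueq_cstD _ _) (ueq_refl _)) _; exact: ueq_mulDl.
Qed.

HB.instance Definition _ := GRing.Zmodule_isLmodule.Build qfield Uq
  Uq_scaleA Uq_scale1 Uq_scaleDr Uq_scaleDl.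

Lemma Uq_scaleAl (c : qfield) (a b : Uq) : c *: (a * b) = (c *: a) * b.
Proof.
elim/upi_surj: a => s; elim/upi_surj: b => t.
rewrite -[upi s * upi t]upiM -[c *: upi (Umul _ _)]upiZ -[c *: upi s]upiZ.
by rewrite -[RHS]upiM; apply/upiP/ueq_mulA.
Qed.

HB.instance Definition _ := GRing.Lmodule_isLalgebra.Build qfield Uq Uq_scaleAl.

Lemma Uq_scaleAr (c : qfield) (a b : Uq) : c *: (a * b) = a * (c *: b).
Proof.
elim/upi_surj: a => s; elim/upi_surj: b => t.
rewrite -[upi s * upi t]upiM -[c *: upi (Umul _ _)]upiZ -[c *: upi t]upiZ.
rewrite -[RHS]upiM; apply/upiP.
apply: ueq_trans (ueq_mulA _ _ _) _.
apply: ueq_trans (ueq_mul (ueq_cstC _ _) (ueq_refl _)) _.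
exact/ueq_sym/ueq_mulA.
Qed.

HB.instance Definition _ := GRing.Lalgebra_isAlgebra.Build qfield Uq Uq_scaleAr.

Definition x_ (i : 'I_(rank D)) : Uq := upi (Ux i).
Definition y_ (i : 'I_(rank D)) : Uq := upi (Uy i).
Definition tau (l : hdual) : Uq := upi (utau l).

Record Uq_hopf (H : hopf_algebra Uq) : Prop := UqHopf {
  cop_tau : forall l, wtP l ->
    tensor_eq (cop H (tau l)) [:: (tau l, tau l)];
  cop_x : forall i,
    tensor_eq (cop H (x_ i)) [:: (x_ i, 1); (tau (alpha i), x_ i)];
  cop_y : forall i,
    tensor_eq (cop H (y_ i)) [:: (y_ i, tau (- alpha i)); (1, y_ i)];
  antipode_tau : forall l, wtP l -> antipode H (tau l) = tau (- l);
  antipode_x : forall i, antipode H (x_ i) = - (tau (- alpha i) * x_ i);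
  antipode_y : forall i, antipode H (y_ i) = - (y_ i * tau (alpha i))
}.

Definition Uplus : Uq -> Prop :=
  generated_subalgebra (fun u => exists i, u = x_ i).
Definition Uminus : Uq -> Prop :=
  generated_subalgebra (fun u => exists i, u = y_ i).

Definition bplus : Uq -> Prop :=
  generated_subalgebra (fun u => Uplus u \/ exists2 l, wtP l & u = tau l).
Definition bminus : Uq -> Prop :=
  generated_subalgebra (fun u => Uminus u \/ exists2 l, wtP l & u = tau l).

Definition ad_weight (a : hdual) (u : Uq) : Prop :=
  forall l, wtP l -> tau l * u * tau (- l) = qpow (form l a) *: u.

Definition Uplus_ (a : hdual) (u : Uq) : Prop := Uplus u /\ ad_weight a u.
Definition Uminus_ (a : hdual) (u : Uq) : Prop := Uminus u /\ ad_weight a u.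

(** * The pairing of the Borel subalgebras and the quasi R-matrix *)

(* [pr] is a bilinear form on Uq × Uq so as to be a total function; only its
   restriction to U_q(b^-) × U_q(b^+) is constrained, or used. *)
Record borel_pairing (H : hopf_algebra Uq) (pr : Uq -> Uq -> qfield) : Prop :=
  BorelPairing {
  pr_bilinear : bilinear_form pr;
  pr_Mr : forall y x x', bminus y -> bplus x -> bplus x' ->
    pr y (x * x') = \sum_(p <- cop H y) pr p.1 x' * pr p.2 x;
  pr_Ml : forall y y' x, bminus y -> bminus y' -> bplus x ->
    pr (y * y') x = \sum_(p <- cop H x) pr y p.1 * pr y' p.2;
  pr_tau : forall l m, wtP l -> wtP m ->
    pr (tau l) (tau m) = qpow (- form l m);
  pr_yx : forall i j,
    pr (y_ i) (x_ j) = - (i == j)%:R * (qi i - (qi i)^-1)^-1;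
  pr_taux : forall l i, wtP l -> pr (tau l) (x_ i) = 0;
  pr_ytau : forall l i, wtP l -> pr (y_ i) (tau l) = 0
}.

(* the elements of Q^+, by their coordinates on the simple roots *)
Definition rootN (m : {ffun 'I_(rank D) -> nat}) : hdual :=
  \sum_i alpha i *+ m i.

(* [Theta m] lists the pairs (u_s, v_s), where (u_s) is a basis of U^+_a and
   (v_s) is the dual basis of U^-_(-a), for a = rootN m. *)
Definition quasi_R_matrix (pr : Uq -> Uq -> qfield)
    (Theta : {ffun 'I_(rank D) -> nat} -> seq (Uq * Uq)) : Prop :=
  forall m,
    [/\ basis_of_pred (Uplus_ (rootN m)) (unzip1 (Theta m)),
        basis_of_pred (Uminus_ (- rootN m)) (unzip2 (Theta m)) &
        forall s t : 'I_(size (Theta m)),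
          pr (nth (0, 0) (Theta m) s).2 (nth (0, 0) (Theta m) t).1
            = (s == t)%:R].

(** * Type one modules, quantised functions and the universal r-form *)

Record Uq_module := UqModule {
  mod_space :> vectType qfield;
  act : Uq -> mod_space -> mod_space;
  act_bilinear : bilinear_map act;
  act1 : forall v, act 1 v = v;
  actM : forall u u' v, act (u * u') v = act u (act u' v)
}.

Definition has_weight (V : Uq_module) (v : V) (l : hdual) : Prop :=
  wtP l /\ forall m, wtP m -> act (tau m) v = qpow (form m l) *: v.

(* finite-dimensionality is part of [Uq_module] *)
Definition type_one (V : Uq_module) : Prop :=
  exists2 b : seq V, basis_of fullv b &
    forall v, v \in b -> exists l, has_weight v l.

Definition mod_dual (V : Uq_module) := 'Hom(mod_space V, qfield^o).

Definition matrix_coef (V : Uq_module) (f : mod_dual V) (v : V) : Uq -> qfield :=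
  fun u => f (act u v).

Definition is_matrix_coef (c : Uq -> qfield) : Prop :=
  exists V : Uq_module, type_one V /\
    exists (f : mod_dual V) (v : V), c = matrix_coef f v.

(* k_q[G], as a set of linear functionals on U *)
Definition quantised_function (c : Uq -> qfield) : Prop :=
  exists (n : nat) (z : 'I_n -> qfield) (d : 'I_n -> Uq -> qfield),
    (forall i, is_matrix_coef (d i)) /\
    (forall u, c u = \sum_i z i * d i u).

(* The Hopf algebra B is k_q[G]: [ev] identifies it with the Hopf subalgebra of
   the Hopf dual of U spanned by the matrix coefficients. *)
Record is_kqG (H : hopf_algebra Uq) (B : algType qfield) (HB : hopf_algebra B)
    (ev : B -> Uq -> qfield) : Prop := IsKqG {
  ev_inj : injective ev;
  ev_image : forall c, (exists b, ev b = c) <-> quantised_function c;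
  ev_scalar : forall u, scalar (ev^~ u);
  ev1 : forall u, ev 1 u = counit H u;
  evM : forall a b u, ev (a * b) u = \sum_(p <- cop H u) ev a p.1 * ev b p.2;
  ev_cop : forall a u u',
    ev a (u * u') = \sum_(p <- cop HB a) ev p.1 u * ev p.2 u';
  ev_counit : forall a, counit HB a = ev a 1;
  ev_antipode : forall a u, ev (antipode HB a) u = ev a (antipode H u)
}.

(* (g ⊗ f)(R^_{V,W}(v ⊗ w)) for v, w of weights l, m; the sum over Q^+ has
   finite support since V and W are finite-dimensional. *)
Definition braiding_coef (Theta : {ffun 'I_(rank D) -> nat} -> seq (Uq * Uq))
    (V W : Uq_module) (f : mod_dual V) (g : mod_dual W) (v : V) (w : W)
    (l m : hdual) : qfield :=
  qpow (- form l m) *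
  \sum_(n \in [set: {ffun 'I_(rank D) -> nat}]%classic)
    \sum_(p <- Theta n) g (act p.2 w) * f (act p.1 v).

(* r is determined by its values on coefficients at weight vectors, as these
   span k_q[G]. *)
Definition is_braiding_form
    (Theta : {ffun 'I_(rank D) -> nat} -> seq (Uq * Uq))
    (B : algType qfield) (ev : B -> Uq -> qfield) (r : B -> B -> qfield) : Prop :=
  forall (V W : Uq_module) (f : mod_dual V) (g : mod_dual W) (v : V) (w : W)
      (l m : hdual) (a b : B),
    type_one V -> type_one W -> has_weight v l -> has_weight w m ->
    ev a = matrix_coef f v -> ev b = matrix_coef g w ->
    r a b = braiding_coef Theta f g v w l m.

End QuantisedEnvelopingAlgebra.

Arguments Uq {R} D.

(* Main.v *)
From HB Require Import structures.
Require Import Defs.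
From mathcomp Require Import all_boot all_order all_algebra.
From mathcomp Require Import fraction boolp reals complex.
From mathcomp Require Import classical_sets functions cardinality fsbigop.
From mathcomp Require Import zify ring.

(** Through [Psi] the enveloping algebra acts on [A] from the right, by
    [a <| u = ev (Psi a1) u a2], and from the left, by [u |> a = a1 ev (Psi a2) u]
    (Sweedler indices), and [A] is the sum of its weight spaces for either action.
    With [P a b = r'(a1, b1) a2 b2], the covariantized product of [a] and [b] is
    the sum of the [r'(a2, S b1) P a1 b2].

    The form [r] is a torus factor times the sum over all degrees of the canonical
    elements of [U^+] and [U^-], so that its first argument meets [U^+] and its
    second one [U^-]; for [rbar21] the two halves are exchanged. This has two
    consequences.
    - If [b] is extremal, that is, a right weight vector killed by the generators
      of the half that second arguments meet, then only the torus factor survives: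
      [P a b] and the covariantized product are both of the form [T a * b], with
      [T] an invertible operator that comes from the torus ([twisted_mul_extremal],
      [cov_mul_extremal]).
    - If [a] and [b] have left weights, then, up to vectors of greater left weight
      (smaller for [rbar21]), their covariantized product is [P a (b <| t)] with [t]
      in the torus ([cov_mul_leading]).

    The product of [A] and [P] are both compatible with the right action, [P]
    because it can also be written [b1 a1 r'(a2, b2)] ([twisted_mulC]). Zero
    divisors [a], [b] of such a product can be made extremal
    ([zero_divisor_extremal]): by taking leading components they become weight
    vectors; then, for a generator [z] and the largest [m], [n] such that [z^m],
    [z^n] do not kill [a], [b], applying [z^(m+n)] to the product leaves a single
    term of the Leibniz formula, with a nonzero q-binomial coefficient. As [A] is
    locally nilpotent for each half, this stops at an extremal pair.

    Hence zero divisors of [A] give extremal ones, which up to the torus are zero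
    divisors of the covariantized algebra. Conversely, zero divisors of the
    covariantized algebra give zero divisors of [P] by taking components of least
    (greatest for [rbar21]) left weight, then extremal zero divisors of [P], which
    up to the torus are zero divisors of [A].

    All this rests on an order on weights for which nonzero sums of simple roots are
    positive, and on the finiteness of the sums over degrees. Both need that no
    nonzero sum of simple roots is orthogonal to all weights. This is read off from
    [r 1 1 = 1]: otherwise infinitely many terms of the sum that defines [r 1 1]
    would be equal to [1], and its value would be [0] ([rootN_Rad]). *)

Set Implicit Arguments.
Unset Strict Implicit.
Unset Printing Implicit Defensive.

Import Order.TTheory GRing.Theory Num.Theory.
Local Open Scope ring_scope.

(** * Cones, orders and finiteness *)

Lemma choice_in (T : eqType) (S : Type) (y0 : S) (s : seq T) (P : T -> S -> Prop) :
  (forall x, x \in s -> exists y, P x y) ->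
  exists f : T -> S, forall x, x \in s -> P x (f x).
Proof.
move=> sP; have [x|f fP] := @choice T S (fun x y => x \in s -> P x y); last by exists f.
have [/sP[y Py]|nxs] := boolP (x \in s); first by exists y.
by exists y0.
Qed.

(** Follow the minima of the successive tails. *)
Lemma monotone_subsequence (g : nat -> nat) :
  exists phi : nat -> nat,
    {homo phi : i j / (i < j)%N} /\ {homo g \o phi : i j / (i <= j)%N}.
Proof.
have tail_min n : exists m, (n <= m)%N /\ forall k, (n <= k)%N -> (g m <= g k)%N.
  have ex : exists v, `[< exists2 m, (n <= m)%N & g m = v >].
    by exists (g n); apply/asboolP; exists n.
  case: (ex_minnP ex) => v /asboolP [m nm gm] vmin; exists m; split=> // k nk.
  by rewrite gm; apply: vmin; apply/asboolP; exists k.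
have [c cP] := choice tail_min.
pose phi := fix phi k := if k is k'.+1 then c (phi k').+1 else c 0.
have phiS k : (phi k < phi k.+1)%N by case: (cP (phi k).+1).
exists phi; split; first exact: homo_ltn ltn_trans phiS.
apply: homo_leq => [k|y x z|k] /=; [exact: leqnn|exact: leq_trans|].
case: k => [|k] /=.
  by case: (cP 0%N) => _; apply.
have [h1 h2] := cP (phi k).+1; apply: h2.
by have [h3 _] := cP (c (phi k).+1).+1; lia.
Qed.

(** Refine an infinite sequence one coordinate at a time, until every coordinate
    is nondecreasing along it. *)
Lemma dickson (J : finType) (S : set {ffun J -> nat}) :
  infinite_set S ->
  exists m n, [/\ S m, S n, m <> n & forall i, (m i <= n i)%N].
Proof.
move=> /infiniteP; case/card_leP => f0.
have in_setT (k : nat) : k \in [set: nat]%classic by rewrite inE.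
pose f k := \val (f0 (SigSub (in_setT k))).
have fS k : S (f k) by exact/set_mem/valP.
have finj : injective f.
  move=> i j /val_inj /inj e.
  by apply: (congr1 (fun u => \val u) (e _ _)); exact/mem_set.
suff [phi [phi_lt phi_le]] : exists phi : nat -> nat,
    {homo phi : i j / (i < j)%N} /\
    forall i, i \in enum J -> {homo (fun k => f (phi k) i) : k l / (k <= l)%N}.
  exists (f (phi 0%N)), (f (phi 1%N)); split=> //.
    by move/finj=> e; have := phi_lt 0%N 1%N isT; rewrite e ltnn.
  move=> i; apply: (phi_le i _ 0%N 1%N) => //.
  by rewrite mem_enum.
elim: (enum J) => [|i s [phi [phi_lt phi_le]]]; first by exists id; split.
have [psi [psi_lt psi_le]] := monotone_subsequence (fun k => f (phi k) i).
exists (phi \o psi); split=> [k l kl|j]; first exact/phi_lt/psi_lt.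
rewrite inE => /predU1P [->|js] k l kl; first exact: psi_le.
apply: (phi_le j js); case: (ltngtP k l) kl => // [kl _|-> _//].
exact/ltnW/psi_lt.
Qed.

Section TotalCone.
Variables (G : zmodType) (N C : G -> Prop).

Definition add_closed (M : G -> Prop) := forall x y, M x -> M y -> M (x + y).

(** In a maximal cone [M] such that [M] and [- M] meet in [N] only, suppose that
    neither [x] nor [- x] lies in [M]. Neither of them can be adjoined, so that
    positive multiples of both lie in [M], and then [x] lies in [N]. *)
Lemma total_cone :
  (forall x n, N (x *+ n.+1) -> N x) -> N 0 ->
  (forall x, N x -> C x) -> add_closed C ->
  (forall x, C x -> C (- x) -> N x) ->
  exists M : G -> Prop,
    [/\ forall x, C x -> M x, add_closed M,
        forall x, M x -> M (- x) -> N x & forall x, M x \/ M (- x)].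
Proof.
move=> Niso N0 NC CD Cpr.
pose ok (M : set G) := [/\ (C `<=` M)%classic, add_closed M &
  forall x, M x -> M (- x) -> N x].
(* The empty chain has empty union, hence the detour through [M `|` C]. *)
pose P (M : set G) := ok (M `|` C)%classic.
have [F FP totF|M [PM maxM]] := @Zorn_bigcup G P.
  have sub (x y : G) : (\bigcup_(X in F) X `|` C)%classic x ->
      (\bigcup_(X in F) X `|` C)%classic y ->
      (C x /\ C y) \/ exists2 X, F X & (X `|` C)%classic x /\ (X `|` C)%classic y.
    move=> [[X FX Xx]|Cx] [[Y FY Yy]|Cy]; [| | |by left].
    - right; case: (totF X Y FX FY) => h; [exists Y|exists X] => //; split; left=> //; exact: h.
    - by right; exists X => //; split; [left|right].
    - by right; exists Y => //; split; [right|left].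
  split=> [x Cx|x y hx hy|x hx hy]; first by right.
  - have [[Cx Cy]|[X FX [Xx Xy]]] := sub _ _ hx hy; first by right; exact: CD.
    have [_ XD _] := FP X FX.
    by case: (XD _ _ Xx Xy) => [h|h]; [left; exists X|right].
  - have [[Cx Cy]|[X FX [Xx Xy]]] := sub _ _ hx hy; first exact: Cpr.
    by have [_ _ +] := FP X FX; apply.
have [CM MD Mpr] := PM.
set T := (M `|` C)%classic in CM MD Mpr.
exists T; split=> // x.
have T0 : T 0 by apply/CM/NC.
have Tn y n : T y -> T (y *+ n).
  by move=> Ty; elim: n => [|n IH]; rewrite ?mulr0n // mulrS; exact: MD.
(* [y] cannot be adjoined to the maximal cone [T] *)
have key y : ~ T y -> exists k, T (- y *+ k.+1).
  move=> nTy; apply: contrapT => nk.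
  pose T' : set G := [set z | exists n, exists2 t, T t & z = t + y *+ n]%classic.
  have TT' z : T z -> T' z by exists 0%N, z => //; rewrite addr0.
  have T'y : T' y by exists 1%N, 0 => //; rewrite add0r.
  apply: (maxM T').
    split; first by move=> z Mz; apply: TT'; left.
    by move=> h; apply: nTy; left; exact: h.
  have -> : P T' = ok T'.
    by rewrite /P; congr ok; rewrite setUidl // => z Cz; apply/TT'/CM.
  split.
  - by move=> z Cz; apply/TT'/CM.
  - move=> _ _ [n [t Tt ->]] [m [u Tu ->]]; exists (n + m)%N, (t + u); first exact: MD.
    by rewrite mulrnDr addrACA.
  - move=> z [n [t Tt zE]] [m [u Tu zE']].
    have e : t + u + y *+ (n + m) = 0.
      by rewrite mulrnDr addrACA -zE -zE' subrr.
    case nm : (n + m)%N e => [|k] e.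
      have [n0 m0] : n = 0%N /\ m = 0%N by split; lia.
      by move: zE zE'; rewrite n0 m0 !addr0 => -> tu; apply: Mpr; rewrite ?tu.
    case: nk; exists k; rewrite mulNrn; have -> : - (y *+ k.+1) = t + u.
      by apply/esym/eqP; rewrite -addr_eq0 e.
    exact: MD.
apply: contrapT => nx.
have [nx1 nx2] : ~ T x /\ ~ T (- x) by split=> h; apply: nx; [left|right].
have [k Tk] := key _ nx1; have [l Tl] := key _ nx2; rewrite opprK in Tl.
apply: nx1; apply/CM/NC; apply: (Niso _ (k.+1 * l.+1).-1); rewrite prednK ?muln_gt0 //.
apply: Mpr; first by rewrite mulnC mulrnA; exact: Tn.
by rewrite -mulNrn mulrnA; exact: Tn.
Qed.

End TotalCone.

(** * Roots are integral weights *)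

(** Eigenvectors for distinct eigenvalues are independent: the product of the
    [T - lam i], [i < n], kills those before the [n]-th one, but not that one. *)
Lemma eigenvector_vanishes (C : fieldType) (V : vectType C) (T : {linear V -> V})
    (lam : nat -> C) (v : nat -> V) :
  injective lam -> (forall k, T (v k) = lam k *: v k) ->
  exists k, v k = 0.
Proof.
move=> lam_inj Tv; apply: contrapT => nv.
have {}nv k : v k != 0 by apply/eqP => vk; apply: nv; exists k.
pose q := fix q n w := if n is n'.+1 then q n' (T w - lam n' *: w) else w.
have qlin n : linear (q n).
  elim: n => //= n IH z u w; rewrite -IH; congr (q n _).
  rewrite (linearP T) scalerBr scalerDr opprD !scalerA [lam n * z]mulrC.
  by rewrite addrACA.
have qZ n z k : q n (z *: v k) = (z * \prod_(i < n) (lam k - lam i)) *: v k.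
  elim: n z => [|n IH] z /=; first by rewrite big_ord0 mulr1.
  have -> : T (z *: v k) - lam n *: (z *: v k) = (z * (lam k - lam n)) *: v k.
    by rewrite linearZZ Tv !scalerA -scalerBl mulrBr [lam n * z]mulrC.
  by rewrite IH big_ord_recr /= -mulrA [_ * \prod_(_ < _) _]mulrC.
have fr n : free [seq v k | k <- rev (iota 0 n)].
  elim: n => [|n IH]; first exact: nil_free.
  rewrite -addn1 iotaD add0n rev_cat /= free_cons IH andbT.
  apply/negP => /(coord_span (X := in_tuple _)) /= /(congr1 (q n)) e.
  have := qZ n 1 n; rewrite scale1r mul1r {}e.
  have q0 : forall (I : Type) (s : seq I) (F : I -> V),
      (forall i, q n (F i) = 0) -> q n (\sum_(i <- s) F i) = 0.
    move=> I s F F0; elim: s => [|i s IHs].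
      by rewrite big_nil -(scale0r (v n)) qZ mul0r scale0r.
    by rewrite big_cons -[F i]scale1r qlin F0 IHs scaler0 addr0.
  rewrite q0 => [/esym/eqP|i].
    rewrite scaler_eq0 (negPf (nv n)) orbF prodf_seq_eq0 => /hasP[i _] /=.
    rewrite subr_eq0 => /eqP/lam_inj ni; have := ltn_ord i.
    by rewrite -ni ltnn.
  have ilt : (i < n)%N.
    by apply: leq_trans (ltn_ord i) _; rewrite size_map size_rev size_iota.
  rewrite (nth_map 0%N) ?size_rev ?size_iota // nth_rev ?size_iota //.
  rewrite nth_iota ?add0n; last by lia.
  have jlt : (n - i.+1 < n)%N by lia.
  by rewrite qZ (bigD1 (Ordinal jlt)) //= subrr mul0r mulr0 scale0r.
have /eqP e := fr (\dim {:V}).+1.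
have : (\dim <<[seq v k | k <- rev (iota 0 (\dim {:V}).+1)]>> <= \dim {:V})%N.
  exact/dimvS/subvf.
by rewrite e size_map size_rev size_iota ltnn.
Qed.

Section RootIntegrality.
Variables (C : numFieldType) (g : vectType C) (br : g -> g -> g).
Variable h : {vspace g}.
Hypothesis lieP : is_lie_bracket br.

Let brl w : linear (br^~ w). Proof. by case: lieP => -[H _] _ _; exact: H. Qed.
Let brr v : linear (br v). Proof. by case: lieP => -[_ H] _ _; exact: H. Qed.

Let brDl u v w : br (u + v) w = br u w + br v w.
Proof. by have := brl w 1 u v; rewrite !scale1r. Qed.
Let brDr u v w : br w (u + v) = br w u + br w v.
Proof. by have := brr w 1 u v; rewrite !scale1r. Qed.
Let br0l w : br 0 w = 0.
Proof. by apply: (@addIr _ (br 0 w)); rewrite -brDl !add0r. Qed.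
Let br0r w : br w 0 = 0.
Proof. by apply: (@addIr _ (br w 0)); rewrite -brDr !add0r. Qed.
Let brZl a u w : br (a *: u) w = a *: br u w.
Proof. by have := brl w a u 0; rewrite br0l !addr0. Qed.
Let brZr a u w : br w (a *: u) = a *: br w u.
Proof. by have := brr w a u 0; rewrite br0r !addr0. Qed.

Lemma lie_bracketC x y : br x y = - br y x.
Proof.
have [_ br0 _] := lieP.
apply/eqP; rewrite -addr_eq0; have := br0 (x + y).
by rewrite brDl !brDr !br0 add0r addr0 => ->.
Qed.

Lemma lie_bracket_deriv x y z : br x (br y z) = br (br x y) z + br y (br x z).
Proof.
have [_ _ jac] := lieP; have /eqP := jac x y z.
rewrite (lie_bracketC z (br x y)) (lie_bracketC z x) -[- br x z]scaleN1r brZr scaleN1r.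
by rewrite -addrA addr_eq0 opprD !opprK addrC => /eqP.
Qed.

(** The adjoint representation restricted to the sl2 spanned by a coroot and
    root vectors: from an eigenvector of the coroot one climbs to a vector
    killed by the raising operator and then descends until the lowering
    operator kills; the length of the descent is the eigenvalue. *)
Lemma root_coroot_int (b c : cdual h) t : is_coroot br b t -> is_root br c ->
  exists n : int, c t = n%:~R.
Proof.
move=> [bt [e [f [be bf tE]]]] [_ [x /eqP x0 cx]].
have adP (y : g) : linear (br y) := brr y.
pose T : {linear g -> g} := HB.pack (br (vsval t)) (GRing.isLinear.Build C g g *:%R _ (adP (vsval t))).
have stops (y u : g) (mu a : C) : u != 0 -> T u = mu *: u -> a != 0 ->
    (forall w nu, T w = nu *: w -> T (br y w) = (nu + a) *: br y w) ->
    exists k, [/\ iter k (br y) u != 0, br y (iter k (br y) u) = 0 &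
      forall l, T (iter l (br y) u) = (mu + a *+ l) *: iter l (br y) u].
  move=> u0 Tu a0 step.
  have Tit l : T (iter l (br y) u) = (mu + a *+ l) *: iter l (br y) u.
    elim: l => [|l IH]; first by rewrite mulr0n addr0.
    by rewrite iterS (step _ _ IH) mulrSr addrA.
  have inj_lam : injective (fun l => mu + a *+ l).
    move=> i j /addrI /eqP; rewrite -!(mulr_natr a) (inj_eq (mulfI a0)) eqr_nat.
    by move/eqP.
  have [l vl] := eigenvector_vanishes inj_lam Tit.
  have ex : exists l, iter l (br y) u == 0 by exists l; apply/eqP.
  case: (ex_minnP ex) => -[|k] /eqP ky kmin; first by case/eqP: u0.
  by exists k; split=> //; apply/negP => /kmin; rewrite ltnn.
have Te w nu : T w = nu *: w -> T (br e w) = (nu + 2%:R) *: br e w.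
  move=> Tw; have {}Tw : br (vsval t) w = nu *: w := Tw.
  by rewrite /= lie_bracket_deriv be bt Tw brZr brZl scalerDl addrC.
have Tf w nu : T w = nu *: w -> T (br f w) = (nu - 2%:R) *: br f w.
  move=> Tw; have {}Tw : br (vsval t) w = nu *: w := Tw.
  rewrite /= lie_bracket_deriv bf opp_lfunE bt Tw brZr brZl.
  by rewrite scalerDl addrC.
have two : (2%:R : C) != 0 by rewrite pnatr_eq0.
have [k [v0 ev Tv]] := stops e x (c t) _ x0 (cx t) two Te.
set v := iter k (br e) x in v0 ev; have {}Tv : T v = (c t + 2%:R *+ k) *: v := Tv k.
set lam := c t + _ in Tv.
have ntwo : (- 2%:R : C) != 0 by rewrite oppr_eq0.
have [n [w0 fw Tw]] := stops f v lam (- 2%:R) v0 Tv ntwo Tf.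
have efw l : br e (iter l.+1 (br f) v) = (l.+1%:R * (lam - l%:R)) *: iter l (br f) v.
  elim: l => [|l IH].
    by rewrite /= lie_bracket_deriv -tE ev br0r addr0 mul1r subr0; exact: Tv.
  rewrite iterS lie_bracket_deriv -tE IH brZr -iterS.
  have -> : br (vsval t) (iter l.+1 (br f) v) = (lam + (- 2%:R) *+ l.+1) *: iter l.+1 (br f) v by exact: Tw.
  rewrite -scalerDl; congr (_ *: _).
  rewrite -mulr_natr -[l.+2]addn1 -[l.+1]addn1 !natrD; ring.
have lamE : lam = n%:R.
  have := efw n; rewrite iterS fw br0r => /esym/eqP.
  by rewrite scaler_eq0 (negPf w0) orbF mulf_eq0 pnatr_eq0 /= subr_eq0 => /eqP.
exists (n%:Z - (2 * k)%:Z); rewrite intrD mulrNz -!pmulrn -lamE /lam.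
by rewrite natrM mulr_natr addrK.
Qed.
End RootIntegrality.

(** * Weights and powers of the quantum parameter *)

Section Weights.
Variables (R : realType) (D : cartan_datum R).
Local Notation K := (qfield R).
Local Notation hdual := (cdual (cartan D)).
Local Notation wtP := (@Defs.wtP R D).
Local Notation qpow := (@Defs.qpow R D).
Local Notation form := (@Defs.form R D).
Local Notation alpha := (@Defs.alpha R D).
Local Notation rootN := (@Defs.rootN R D).

Lemma wtP_alpha i : wtP (alpha i).
Proof.
move=> b t _ ct; apply: (root_coroot_int (@lie_brP R D) ct).
by have [_ + _] := alphaP D; apply.
Qed.

Lemma wtP_rootN m : wtP (rootN m).
Proof.
rewrite /Defs.rootN; elim/big_rec: _ => [|i l _ Pl]; first exact: wtP0.
apply: wtPD => //; elim: (m i) => [|k IH]; first by rewrite mulr0n; exact: wtP0.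
by rewrite mulrS; apply: wtPD => //; exact: wtP_alpha.
Qed.

Lemma rootN0 : rootN [ffun=> 0%N] = 0.
Proof. by rewrite /Defs.rootN big1 // => i _; rewrite ffunE mulr0n. Qed.

Lemma rootND (m n : {ffun 'I_(rank D) -> nat}) : rootN [ffun i => (m i + n i)%N] = rootN m + rootN n.
Proof.
rewrite /Defs.rootN -big_split /=; apply: eq_bigr => i _.
by rewrite ffunE mulrnDr.
Qed.

Lemma rootNMn (m : {ffun 'I_(rank D) -> nat}) k : rootN [ffun i => (m i * k)%N] = rootN m *+ k.
Proof.
rewrite /Defs.rootN -sumrMnl; apply: eq_bigr => i _.
by rewrite ffunE mulrnA.
Qed.

Definition rootN1 i : {ffun 'I_(rank D) -> nat} := [ffun j => (j == i : nat)].

Lemma rootN1E i : rootN (rootN1 i) = alpha i.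
Proof.
rewrite /Defs.rootN (bigD1 i) //= ffunE eqxx mulr1n big1 ?addr0 // => j ji.
by rewrite ffunE (negPf ji).
Qed.

(** ** Integral exponents *)

Definition exponent (z : R[i]) := exists n : int, z = n%:~R / (denom D)%:R.

Let dN0 : ((denom D)%:R : R[i]) != 0.
Proof. by rewrite pnatr_eq0 -lt0n denom_gt0. Qed.

Let X : K := tofrac 'X.
Let X0 : X != 0. Proof. by rewrite tofrac_eq0 polyX_eq0. Qed.

Lemma qpowE n : qpow (n%:~R / (denom D)%:R) = X ^ n.
Proof.
rewrite /Defs.qpow; congr (_ ^ _); case: xgetP => [m _|] /=.
  by move/(divIf dN0)/intr_inj.
by move=> /(_ n) /(_ erefl).
Qed.

Lemma qpowD y z : exponent y -> exponent z -> qpow (y + z) = qpow y * qpow z.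
Proof.
move=> [m ->] [n ->]; rewrite -mulrDl -intrD !qpowE expfzDr //.
Qed.

Lemma qpow0 : qpow 0 = 1.
Proof. by rewrite -(mul0r (denom D)%:R^-1) -[0]/(0%:~R) qpowE expr0z. Qed.

Lemma qpow_neq0 y : exponent y -> qpow y != 0.
Proof. by move=> [m ->]; rewrite qpowE expfz_neq0. Qed.

Lemma qpow_eq1 y : exponent y -> qpow y = 1 -> y = 0.
Proof.
have Xn (n : nat) : X ^+ n = 1 -> n = 0%N.
  move/eqP; rewrite -tofracXn -tofrac1 tofrac_eq => /eqP /(congr1 (size : {poly _} -> nat)).
  by rewrite size_polyXn size_poly1 => -[].
move=> [m ->]; rewrite qpowE => Xm; suff -> : m = 0 by rewrite mul0r.
case: m Xm => [n /Xn -> //|n]; rewrite NegzE -exprnN => /(congr1 GRing.inv).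
by rewrite invrK invr1 => /Xn.
Qed.

(** ** Characters of the torus *)

Lemma wformDl l m n : form (l + m) n = form l n + form m n.
Proof.
have [[fl _] _ _ _ _] := formP D; have := fl n 1 l m.
by rewrite scale1r mul1r.
Qed.

Lemma wformC l m : form l m = form m l.
Proof. by have [_ + _ _ _] := formP D; apply. Qed.

Lemma wformDr l m n : form n (l + m) = form n l + form n m.
Proof. by rewrite wformC wformDl wformC (wformC m). Qed.

Lemma wform0r n : form n 0 = 0.
Proof. by apply: (@addIr _ (form n 0)); rewrite -wformDr !add0r. Qed.

Lemma wformNr n l : form n (- l) = - form n l.
Proof. by apply/eqP; rewrite -addr_eq0 -wformDr addNr wform0r. Qed.

Lemma wformMn n l k : form n (l *+ k) = form n l *+ k.
Proof. by elim: k => [|k IH]; rewrite ?mulr0n ?wform0r // !mulrS wformDr IH. Qed.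

Lemma form_exponent l m : wtP l -> wtP m -> exponent (form l m).
Proof. exact: denomP. Qed.

(** The scalar by which [tau l] acts on vectors of weight [m]. *)
Definition chi (l m : hdual) : K := qpow (form l m).

Lemma chiC l m : chi l m = chi m l.
Proof. by rewrite /chi wformC. Qed.

Lemma chi0r l : chi l 0 = 1.
Proof. by rewrite /chi wform0r qpow0. Qed.

Lemma chiDr l m n : wtP l -> wtP m -> wtP n -> chi l (m + n) = chi l m * chi l n.
Proof. by move=> *; rewrite /chi wformDr qpowD //; exact: form_exponent. Qed.

Lemma chiDl l m n : wtP l -> wtP m -> wtP n -> chi (l + m) n = chi l n * chi m n.
Proof. by move=> *; rewrite chiC chiDr // !(chiC n). Qed.

Lemma chi_neq0 l m : wtP l -> wtP m -> chi l m != 0.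
Proof. by move=> *; apply/qpow_neq0/form_exponent. Qed.

Lemma chiNr l m : wtP l -> wtP m -> chi l (- m) = (chi l m)^-1.
Proof.
move=> Pl Pm; apply: (mulfI (chi_neq0 Pl Pm)).
by rewrite -chiDr ?subrr ?chi0r ?divff ?chi_neq0 //; exact: wtPN.
Qed.

Lemma chiNl l m : wtP l -> wtP m -> chi (- l) m = (chi l m)^-1.
Proof. by move=> *; rewrite chiC chiNr // chiC. Qed.

(** Weights matter only through the characters of the torus that they define,
    that is, modulo this subgroup. *)
Definition Rad (l : hdual) := forall m, wtP m -> form m l = 0.

Lemma Rad0 : Rad 0. Proof. by move=> m _; rewrite wform0r. Qed.

Lemma RadD l m : Rad l -> Rad m -> Rad (l + m).
Proof. by move=> hl hm n Pn; rewrite wformDr hl // hm // addr0. Qed.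

Lemma RadN l : Rad l -> Rad (- l).
Proof. by move=> hl n Pn; rewrite wformNr hl // oppr0. Qed.

Lemma Rad_chi l m : wtP l -> wtP m ->
  Rad (l - m) <-> forall n, wtP n -> chi n l = chi n m.
Proof.
move=> Pl Pm; split=> [h n Pn|h n Pn].
  by rewrite /chi; congr qpow; apply/eqP; rewrite -subr_eq0 -wformNr -wformDr h.
have PlNm : wtP (l - m) by apply: wtPD => //; exact: wtPN.
apply: qpow_eq1; first exact: form_exponent.
rewrite -[qpow _]/(chi n (l - m)) chiDr ?chiNr ?h ?divff ?chi_neq0 //; exact: wtPN.
Qed.

Lemma Rad_iso l k : Rad (l *+ k.+1) -> Rad l.
Proof.
move=> h n Pn; have := h n Pn; rewrite wformMn => /eqP.
by rewrite mulrn_eq0 => /eqP.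
Qed.

(** ** Laurent polynomials with positive value at 1 *)

(** The q-binomial coefficients below are of this kind, and are nonzero for this
    reason. *)
Definition lpos (x : K) := exists2 p : {poly R[i]}, 0 < p.[1] &
  exists d : nat, x * X ^+ d = tofrac p.

Lemma lpos_neq0 x : lpos x -> x != 0.
Proof.
move=> [p p1 [d e]]; apply/eqP => x0; move: e; rewrite x0 mul0r => /esym/eqP.
by rewrite tofrac_eq0 => /eqP p0; rewrite p0 horner0 ltxx in p1.
Qed.

Lemma lpos1 : lpos 1.
Proof. by exists 1; rewrite ?hornerC ?ltr01 //; exists 0%N; rewrite mul1r tofrac1. Qed.

Lemma lposD x y : lpos x -> lpos y -> lpos (x + y).
Proof.
move=> [p p1 [d e]] [p' p1' [d' e']].
exists (p * 'X^d' + p' * 'X^d).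
  by rewrite !hornerE !expr1n !mulr1 addr_gt0.
exists (d + d')%N; rewrite tofracD !tofracM !tofracXn -e -e' exprD; ring.
Qed.

Lemma lpos_qpow y x : exponent y -> lpos x -> lpos (qpow y * x).
Proof.
move=> [[m|m] ->] [p p1 [d e]]; rewrite qpowE.
  exists (p * 'X^m); first by rewrite !hornerE expr1n mulr1.
  by exists d; rewrite tofracM tofracXn -e -[X ^ m]/(X ^+ m); ring.
exists p => //; exists (d + m.+1)%N; rewrite exprD NegzE -exprnN -e.
rewrite (_ : _ * _ = x * X ^+ d * ((X ^+ m.+1)^-1 * X ^+ m.+1)); last by ring.
by rewrite mulVf ?mulr1; [|exact: expf_neq0].
Qed.

End Weights.

(** * Multilinear Sweedler calculus *)

Section Linearity.
Variable K : fieldType.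

(** Naming the property keeps it folded, so that the shape of the expression can
    guide proofs of linearity. *)
Definition islin (V W : lmodType K) (f : V -> W) : Prop := linear f.

Lemma islinD (V W : lmodType K) (f : V -> W) u v : islin f -> f (u + v) = f u + f v.
Proof. by move=> fl; have := fl 1 u v; rewrite !scale1r. Qed.

Lemma islin0 (V W : lmodType K) (f : V -> W) : islin f -> f 0 = 0.
Proof. by move=> fl; apply: (@addIr _ (f 0)); rewrite -(islinD _ _ fl) !add0r. Qed.

Lemma islinZ (V W : lmodType K) (f : V -> W) c u : islin f -> f (c *: u) = c *: f u.
Proof. by move=> fl; have := fl c u 0; rewrite (islin0 fl) !addr0. Qed.

Lemma islinN (V W : lmodType K) (f : V -> W) u : islin f -> f (- u) = - f u.
Proof. by move=> fl; rewrite -scaleN1r (islinZ _ _ fl) scaleN1r. Qed.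

Lemma islin_suml (V W : lmodType K) (f : V -> W) I (s : seq I) (F : I -> V) :
  islin f -> f (\sum_(i <- s) F i) = \sum_(i <- s) f (F i).
Proof.
move=> fl; elim: s => [|i s IH]; first by rewrite !big_nil (islin0 fl).
by rewrite !big_cons (islinD _ _ fl) IH.
Qed.

Lemma islinI (V W : lmodType K) (f : V -> W) : islin f -> linear f.
Proof. by []. Qed.

Lemma islin_id (V : lmodType K) : islin (fun v : V => v).
Proof. by []. Qed.

Lemma islin_comp (V W X : lmodType K) (f : W -> X) (g : V -> W) :
  islin f -> islin g -> islin (fun v => f (g v)).
Proof. by move=> fl gl c u v; rewrite gl fl. Qed.

Lemma islin_sum (V W : lmodType K) I (s : seq I) (F : I -> V -> W) :
  (forall i, islin (F i)) -> islin (fun v => \sum_(i <- s) F i v).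
Proof.
move=> Fl c u v; rewrite scaler_sumr -big_split /=.
by apply: eq_bigr => i _; rewrite Fl.
Qed.

Lemma islin_scalel (V W : lmodType K) (f : V -> K^o) (w : W) :
  islin f -> islin (fun v => (f v : K) *: w).
Proof. by move=> fl c u v; rewrite fl scalerDl scalerA. Qed.

Lemma islin_scaler (V W : lmodType K) (f : V -> W) (c : K) :
  islin f -> islin (fun v => c *: f v).
Proof. by move=> fl d u v; rewrite fl scalerDr !scalerA mulrC. Qed.

Lemma islin_kmull (V : lmodType K) (f : V -> K^o) (c : K) :
  islin f -> islin (fun v => (f v : K) * c : K^o).
Proof. exact: islin_scalel. Qed.

Lemma islin_kmulr (V : lmodType K) (f : V -> K^o) (c : K) :
  islin f -> islin (fun v => c * (f v : K) : K^o).
Proof. exact: islin_scaler. Qed.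

Lemma islin_mull (V : lmodType K) (A : algType K) (f : V -> A) (a : A) :
  islin f -> islin (fun v => f v * a).
Proof. by move=> fl c u v; rewrite fl mulrDl scalerAl. Qed.

Lemma islin_mulr (V : lmodType K) (A : algType K) (f : V -> A) (a : A) :
  islin f -> islin (fun v => a * f v).
Proof. by move=> fl c u v; rewrite fl mulrDr scalerAr. Qed.

End Linearity.

Lemma big_allpairs_seq (Z : nmodType) (S T U : Type) (F : U -> Z) (f : S -> T -> U) s (t : S -> seq T) :
  \sum_(p <- [seq f x y | x <- s, y <- t x]) F p = \sum_(x <- s) \sum_(y <- t x) F (f x y).
Proof. by rewrite big_flatten big_map; apply: eq_bigr => x _; rewrite big_map. Qed.

Section Bialgebra.
Variables (K : fieldType) (A : algType K) (BA : bialgebra A).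
Local Notation cop := (cop BA).
Local Notation eps := (counit BA).

Lemma eps_lin : islin (eps : A -> K^o).
Proof. exact: (counit_scalar BA). Qed.

Lemma epsZ c a : eps (c *: a) = c * eps a.
Proof. exact: (islinZ _ _ eps_lin). Qed.

Lemma sweedler_lin (Z : lmodType K) (f : A -> A -> Z) : bilinear_map f ->
  islin (fun a => \sum_(p <- cop a) f p.1 p.2).
Proof.
move=> fb c u v; rewrite (cop_linear BA c u v fb) big_cat big_map /=.
rewrite scaler_sumr; congr (_ + _); apply: eq_bigr => p _.
by have [fl _] := fb; exact: (islinZ _ _ (fl p.2)).
Qed.

Lemma sweedler_assoc (Z : lmodType K) (f : A -> A -> A -> Z) a : trilinear_map f ->
  \sum_(p <- cop a) \sum_(q <- cop p.1) f q.1 q.2 p.2 =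
  \sum_(p <- cop a) \sum_(q <- cop p.2) f p.1 q.1 q.2.
Proof. by move/(cop_coassoc BA a); rewrite !big_allpairs_seq. Qed.

Lemma sweedler_mul (Z : lmodType K) (f : A -> A -> Z) a b : bilinear_map f ->
  \sum_(p <- cop (a * b)) f p.1 p.2 =
  \sum_(p <- cop a) \sum_(q <- cop b) f (p.1 * q.1) (p.2 * q.2).
Proof. by move/(copM BA a b); rewrite !big_allpairs_seq. Qed.

Lemma sweedler_one (Z : lmodType K) (f : A -> A -> Z) : bilinear_map f ->
  \sum_(p <- cop 1) f p.1 p.2 = f 1 1.
Proof. by move/(cop1 BA); rewrite big_seq1. Qed.

Lemma sweedler_epsl (Z : lmodType K) (f : A -> Z) a : islin f ->
  \sum_(p <- cop a) eps p.1 *: f p.2 = f a.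
Proof.
move=> fl; rewrite -[in RHS](cop_counitl BA a) (islin_suml _ _ fl).
by apply: eq_bigr => p _; rewrite (islinZ _ _ fl).
Qed.

Lemma sweedler_epsr (Z : lmodType K) (f : A -> Z) a : islin f ->
  \sum_(p <- cop a) eps p.2 *: f p.1 = f a.
Proof.
move=> fl; rewrite -[in RHS](cop_counitr BA a) (islin_suml _ _ fl).
by apply: eq_bigr => p _; rewrite (islinZ _ _ fl).
Qed.

End Bialgebra.

(** Proves that an explicit Sweedler expression is linear in one variable, by
    recursion on its shape; [h] proves linearity of the atoms. *)
Ltac lin_with h :=
  try (apply: islinI);
  lazymatch goal with
  | |- islin (fun x => x) => exact: islin_id
  | |- islin (fun x => bigop.body _ _ _) => apply: islin_sum => ?; lin_with h
  | |- islin (fun x => GRing.scale (@?f x) _) =>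
      lazymatch f with
      | (fun _ => ?c) => apply: islin_scaler
      | _ => apply: islin_scalel
      end; lin_with h
  | |- @islin _ _ ?W (fun x => GRing.mul (@?f x) _) =>
      lazymatch W with
      | context [GRing.regular] =>
          lazymatch f with
          | (fun _ => ?c) => apply: islin_kmulr
          | _ => apply: islin_kmull
          end
      | _ =>
          lazymatch f with
          | (fun _ => ?c) => apply: islin_mulr
          | _ => apply: islin_mull
          end
      end; lin_with h
  | |- islin (GRing.scale ?c) => apply: islin_scaler; exact: islin_id
  | |- islin (GRing.mul ?c) => first [exact: (islin_mulr _ (@islin_id _ _))|exact: (islin_kmulr _ (@islin_id _ _))]
  | |- _ => h; lin_with h
  end.

Section Antipode.
Variables (K : fieldType) (A : algType K) (HA : hopf_algebra A).
Local Notation cop := (cop HA).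
Local Notation eps := (counit HA).
Local Notation S := (antipode HA).

Lemma antipode_lin : islin S. Proof. exact: (antipode_linear HA). Qed.

Lemma antipode1 : S 1 = 1.
Proof.
have := antipodel HA 1; rewrite counit1 scale1r.
rewrite (@sweedler_one _ _ HA _ (fun a b => S a * b)) ?mulr1 // /bilinear_map.
by split=> [w|v]; [apply: islin_mull; exact: antipode_lin | apply: islin_mulr].
Qed.

(** Evaluate the sum of the [S (a1 b1) a2 b2 S b3 S a3] from the left and from the
    right. *)
Lemma antipodeM a b : S (a * b) = S b * S a.
Proof.
pose h := islin_comp antipode_lin.
have conv (x y z : A) : \sum_(p <- cop x) \sum_(q <- cop y)
    S (p.1 * q.1) * (p.2 * q.2) * z = (eps x * eps y) *: z.
  rewrite -counitM -[z in RHS]mul1r scalerAl -antipodel.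
  rewrite (@sweedler_mul _ _ HA _ (fun u v => S u * v)); last first.
    by split=> [w|v]; [apply: islin_mull; exact: antipode_lin | apply: islin_mulr].
  by rewrite mulr_suml; apply: eq_bigr => p _; rewrite mulr_suml.
have -> : S b * S a = \sum_(p <- cop a) \sum_(q <- cop b)
    (eps p.1 * eps q.1) *: (S q.2 * S p.2).
  rewrite -(@sweedler_epsl _ _ HA _ (fun u => S b * S u)); last first.
    by apply: islin_mulr; exact: antipode_lin.
  apply: eq_bigr => p _.
  rewrite -(@sweedler_epsl _ _ HA _ (fun u => S u * S p.2)); last first.
    by apply: islin_mull; exact: antipode_lin.
  by rewrite scaler_sumr; apply: eq_bigr => q _; rewrite scalerA.
transitivity (\sum_(p <- cop a) \sum_(q <- cop b) \sum_(p' <- cop p.1)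
    \sum_(q' <- cop q.1) S (p'.1 * q'.1) * (p'.2 * q'.2) * (S q.2 * S p.2)); last first.
  by apply: eq_bigr => p _; apply: eq_bigr => q _; rewrite conv.
have innerb (p : A * A) p' : \sum_(q <- cop b) \sum_(q' <- cop q.1)
    S (p'.1 * q'.1) * (p'.2 * q'.2) * (S q.2 * S p.2) =
    S (p'.1 * b) * (p'.2 * S p.2).
  rewrite (@sweedler_assoc _ _ HA _
    (fun u v w => S (p'.1 * u) * (p'.2 * v) * (S w * S p.2))); last first.
    by split=> *; lin_with ltac:(first [exact: antipode_lin | apply: h]).
  rewrite -[RHS](@sweedler_epsr _ _ HA _ (fun u => S (p'.1 * u) * (p'.2 * S p.2))); last first.
    by lin_with ltac:(first [exact: antipode_lin | apply: h]).
  apply: eq_bigr => q _.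
  transitivity (S (p'.1 * q.1) * p'.2 * (\sum_(q' <- cop q.2) q'.1 * S q'.2) * S p.2).
    by rewrite mulr_sumr mulr_suml; apply: eq_bigr => q' _; rewrite !mulrA.
  by rewrite antipoder -scalerAr -scalerAl mulr1 mulrA.
transitivity (\sum_(p <- cop a) \sum_(p' <- cop p.1) S (p'.1 * b) * (p'.2 * S p.2)); last first.
  apply: eq_bigr => p _; rewrite exchange_big; apply: eq_bigr => p' _ /=.
  by rewrite innerb.
rewrite (@sweedler_assoc _ _ HA _ (fun u v w => S (u * b) * (v * S w))); last first.
  by split=> *; lin_with ltac:(first [exact: antipode_lin | apply: h]).
rewrite -[LHS](@sweedler_epsr _ _ HA _ (fun u => S (u * b))); last first.
  by lin_with ltac:(first [exact: antipode_lin | apply: h]).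
apply: eq_bigr => p _; rewrite -mulr_sumr antipoder.
by rewrite -scalerAr mulr1.
Qed.

End Antipode.

(** * Convolution and universal r-forms *)

Section BraidedInverse.
Variables (K : fieldType) (A : algType K) (BA : bialgebra A).
Local Notation cop := (cop BA).
Local Notation eps := (counit BA).

Lemma bil1 (V W Z : lmodType K) (f : V -> W -> Z) : bilinear_map f ->
  forall w, islin (fun v => f v w).
Proof. by case. Qed.

Lemma bil2 (V W Z : lmodType K) (f : V -> W -> Z) : bilinear_map f ->
  forall v, islin (f v).
Proof. by case. Qed.

Lemma bil1c (V W Z U : lmodType K) (f : V -> W -> Z) (g : U -> V) : bilinear_map f ->
  islin g -> forall w, islin (fun v => f (g v) w).
Proof. by move=> fb gl w; apply: (islin_comp (f := f^~ w)) gl; exact: bil1. Qed.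

Lemma bil2c (V W Z U : lmodType K) (f : V -> W -> Z) (g : U -> W) : bilinear_map f ->
  islin g -> forall v, islin (fun u => f v (g u)).
Proof. by move=> fb gl v; apply: (islin_comp (f := f v)) gl; exact: bil2. Qed.

Lemma sweedler_assoc2 (Z : lmodType K) (f : A -> A -> A -> A -> A -> A -> Z) a b :
  (forall u v w, trilinear_map (f u v w)) ->
  (forall x y z, trilinear_map (fun u v w => f u v w x y z)) ->
  \sum_(p <- cop a) \sum_(q <- cop b) \sum_(p' <- cop p.1) \sum_(q' <- cop q.1)
     f p'.1 p'.2 p.2 q'.1 q'.2 q.2 =
  \sum_(p <- cop a) \sum_(q <- cop b) \sum_(p' <- cop p.2) \sum_(q' <- cop q.2)
     f p.1 p'.1 p'.2 q.1 q'.1 q'.2.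
Proof.
move=> f1 f2.
transitivity (\sum_(p <- cop a) \sum_(p' <- cop p.1) \sum_(q <- cop b) \sum_(q' <- cop q.2)
     f p'.1 p'.2 p.2 q.1 q'.1 q'.2).
  apply: eq_bigr => p _; rewrite exchange_big; apply: eq_bigr => p' _ /=.
  exact: (sweedler_assoc BA b (f1 p'.1 p'.2 p.2)).
rewrite (@sweedler_assoc _ _ BA _ (fun u v w => \sum_(q <- cop b) \sum_(q' <- cop q.2)
     f u v w q.1 q'.1 q'.2)); last first.
  split=> u v; apply: islin_sum => q; apply: islin_sum => q'.
  - by have [h _ _] := f2 q.1 q'.1 q'.2; exact: h.
  - by have [_ h _] := f2 q.1 q'.1 q'.2; exact: h.
  - by have [_ _ h] := f2 q.1 q'.1 q'.2; exact: h.
by apply: eq_bigr => p _; rewrite exchange_big.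
Qed.

(** The convolution algebra of forms acts on bilinear maps from both sides; the two
    actions commute, and turn the intertwining property of a form into an
    equation between [convl] and [convr]. *)
Definition convl (Z : lmodType K) (s : A -> A -> K) (F : A -> A -> Z) a b :=
  \sum_(p <- cop a) \sum_(q <- cop b) s p.1 q.1 *: F p.2 q.2.
Definition convr (Z : lmodType K) (s : A -> A -> K) (F : A -> A -> Z) a b :=
  \sum_(p <- cop a) \sum_(q <- cop b) s p.2 q.2 *: F p.1 q.1.

Section Ops.
Variables (Z : lmodType K) (s t : A -> A -> K) (F : A -> A -> Z).
Hypotheses (sb : bilinear_map (s : A -> A -> K^o)) (tb : bilinear_map (t : A -> A -> K^o)).
Hypothesis (Fb : bilinear_map F).

Lemma convl_convl :
  (forall a b, \sum_(p <- cop a) \sum_(q <- cop b) t p.1 q.1 * s p.2 q.2 = eps a * eps b) ->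
  forall a b, convl t (convl s F) a b = F a b.
Proof.
move=> ts a b; rewrite /convl.
transitivity (\sum_(p <- cop a) \sum_(q <- cop b) \sum_(p' <- cop p.2) \sum_(q' <- cop q.2)
   (t p.1 q.1 * s p'.1 q'.1) *: F p'.2 q'.2).
  apply: eq_bigr => p _; apply: eq_bigr => q _; rewrite scaler_sumr.
  by apply: eq_bigr => p' _; rewrite scaler_sumr; apply: eq_bigr => q' _; rewrite scalerA.
rewrite -(@sweedler_assoc2 _ (fun u v w x y z => (t u x * s v y) *: F w z)).
- transitivity (\sum_(p <- cop a) \sum_(q <- cop b) (eps p.1 * eps q.1) *: F p.2 q.2).
    apply: eq_bigr => p _; apply: eq_bigr => q _; rewrite -ts scaler_suml.
    by apply: eq_bigr => p' _; rewrite scaler_suml.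
  rewrite -[RHS](@sweedler_epsl _ _ BA _ (fun u => F u b)); last exact: bil1.
  apply: eq_bigr => p _; rewrite -[in RHS](@sweedler_epsl _ _ BA _ (F p.2)); last exact: bil2.
  by rewrite scaler_sumr; apply: eq_bigr => q _; rewrite scalerA.
- by move=> u v w; split=> x y; lin_with ltac:(first [exact: bil2 | exact: bil1]).
- by move=> u v w; split=> x y; lin_with ltac:(first [exact: bil2 | exact: bil1]).
Qed.

Lemma convr_convr :
  (forall a b, \sum_(p <- cop a) \sum_(q <- cop b) s p.1 q.1 * t p.2 q.2 = eps a * eps b) ->
  forall a b, convr t (convr s F) a b = F a b.
Proof.
move=> st a b; rewrite /convr.
transitivity (\sum_(p <- cop a) \sum_(q <- cop b) \sum_(p' <- cop p.1) \sum_(q' <- cop q.1)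
   (s p'.2 q'.2 * t p.2 q.2) *: F p'.1 q'.1).
  apply: eq_bigr => p _; apply: eq_bigr => q _; rewrite scaler_sumr.
  by apply: eq_bigr => p' _; rewrite scaler_sumr; apply: eq_bigr => q' _; rewrite scalerA mulrC.
rewrite (@sweedler_assoc2 _ (fun u v w x y z => (s v y * t w z) *: F u x)).
- transitivity (\sum_(p <- cop a) \sum_(q <- cop b) (eps p.2 * eps q.2) *: F p.1 q.1).
    apply: eq_bigr => p _; apply: eq_bigr => q _; rewrite -st scaler_suml.
    by apply: eq_bigr => p' _; rewrite scaler_suml.
  rewrite -[RHS](@sweedler_epsr _ _ BA _ (fun u => F u b)); last exact: bil1.
  apply: eq_bigr => p _; rewrite -[in RHS](@sweedler_epsr _ _ BA _ (F p.1)); last exact: bil2.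
  by rewrite scaler_sumr; apply: eq_bigr => q _; rewrite scalerA.
- by move=> u v w; split=> x y; lin_with ltac:(first [exact: bil2 | exact: bil1]).
- by move=> u v w; split=> x y; lin_with ltac:(first [exact: bil2 | exact: bil1]).
Qed.

Lemma convlr a b : convl t (convr s F) a b = convr s (convl t F) a b.
Proof.
rewrite /convl /convr.
transitivity (\sum_(p <- cop a) \sum_(q <- cop b) \sum_(p' <- cop p.2) \sum_(q' <- cop q.2)
   (t p.1 q.1 * s p'.2 q'.2) *: F p'.1 q'.1).
  apply: eq_bigr => p _; apply: eq_bigr => q _; rewrite scaler_sumr.
  by apply: eq_bigr => p' _; rewrite scaler_sumr; apply: eq_bigr => q' _; rewrite scalerA.
rewrite -(@sweedler_assoc2 _ (fun u v w x y z => (t u x * s w z) *: F v y)).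
- apply: eq_bigr => p _; apply: eq_bigr => q _; rewrite scaler_sumr.
  by apply: eq_bigr => p' _; rewrite scaler_sumr; apply: eq_bigr => q' _; rewrite scalerA mulrC.
- by move=> u v w; split=> x y; lin_with ltac:(first [exact: bil2 | exact: bil1]).
- by move=> u v w; split=> x y; lin_with ltac:(first [exact: bil2 | exact: bil1]).
Qed.

End Ops.

Lemma convr_bilinear (Z : lmodType K) (s : A -> A -> K) (F : A -> A -> Z) :
  bilinear_map (s : A -> A -> K^o) -> bilinear_map F -> bilinear_map (convr s F).
Proof.
move=> sb Fb; split=> [w|v]; rewrite /convr.
  apply: (@sweedler_lin _ _ BA _ (fun x y => \sum_(q <- cop w) s y q.2 *: F x q.1)).
  by split=> x; lin_with ltac:(first [exact: bil1 | exact: bil2]).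
have h p : islin (fun w => \sum_(q <- cop w) s p.2 q.2 *: F p.1 q.1).
  apply: (@sweedler_lin _ _ BA _ (fun x y => s p.2 y *: F p.1 x)).
  by split=> x; lin_with ltac:(first [exact: bil1 | exact: bil2]).
exact: islin_sum.
Qed.

Lemma convl_bilinear (Z : lmodType K) (s : A -> A -> K) (F : A -> A -> Z) :
  bilinear_map (s : A -> A -> K^o) -> bilinear_map F -> bilinear_map (convl s F).
Proof.
move=> sb Fb; split=> [w|v]; rewrite /convl.
  apply: (@sweedler_lin _ _ BA _ (fun y x => \sum_(q <- cop w) s y q.1 *: F x q.2)).
  by split=> x; lin_with ltac:(first [exact: bil1 | exact: bil2]).
have h p : islin (fun w => \sum_(q <- cop w) s p.1 q.1 *: F p.2 q.2).
  apply: (@sweedler_lin _ _ BA _ (fun y x => s p.1 y *: F p.2 x)).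
  by split=> x; lin_with ltac:(first [exact: bil1 | exact: bil2]).
exact: islin_sum.
Qed.

(** Apply both actions of [t] to the equation, to cancel the actions of [s]. *)
Lemma convolution_inverse_braided (Z : lmodType K) (s t : A -> A -> K) (F G : A -> A -> Z) :
  bilinear_map (s : A -> A -> K^o) -> bilinear_map (t : A -> A -> K^o) ->
  bilinear_map F -> bilinear_map G -> convolution_inverse BA s t ->
  (forall a b, convl s F a b = convr s G a b) ->
  forall a b, convl t G a b = convr t F a b.
Proof.
move=> sb tb Fb Gb st FG a b.
have GE : G = convr t (convr s G).
  apply/funext => x; apply/funext => y; rewrite convr_convr // => u v.
  by have [] := st u v.
have FE : convl t (convl s F) = F.
  apply/funext => x; apply/funext => y; rewrite convl_convl // => u v.
  by have [] := st u v.
have {}FG : convl s F = convr s G by apply/funext => x; apply/funext => y.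
rewrite [in LHS]GE convlr //; last exact: convr_bilinear.
by rewrite -FG FE.
Qed.

End BraidedInverse.

Section RForm.
Variables (K : fieldType) (B : algType K) (HB : hopf_algebra B).
Variables (r : B -> B -> K) (hr : universal_rform HB r).
Local Notation cop := (cop HB).
Local Notation eps := (counit HB).
Local Notation S := (antipode HB).

Lemma rform_bil : bilinear_map (r : B -> B -> K^o).
Proof. exact: (rform_bilinear hr). Qed.

(** The function [r 1] is idempotent and invertible for convolution. *)
Lemma rform1l c : r 1 c = eps c.
Proof.
have [r' r'b inv] := rform_invertible hr.
have {}r'b : bilinear_map (r' : B -> B -> K^o) := r'b.
have rb := rform_bil.
have idem d : \sum_(q <- cop d) r 1 q.1 * r' 1 q.2 = eps d.
  have [+ _] := inv 1 d; rewrite counit1 mul1r => <-.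
  rewrite (@sweedler_one _ _ HB (K^o) (fun u v => \sum_(q <- cop d) r u q.1 * r' v q.2)) //.
  by split=> x; lin_with ltac:(first [exact: bil1 | exact: bil2]).
rewrite -idem -[LHS](@sweedler_epsr _ _ HB (K^o) (r 1)); last exact: bil2.
transitivity (\sum_(p <- cop c) \sum_(q <- cop p.2) r 1 p.1 * (r 1 q.1 * r' 1 q.2)).
  by apply: eq_bigr => p _; rewrite -idem -mulr_sumr mulrC.
rewrite -(@sweedler_assoc _ _ HB (K^o) (fun u v w => r 1 u * (r 1 v * r' 1 w))); last first.
  by split=> x y; lin_with ltac:(first [exact: bil1 | exact: bil2]).
apply: eq_bigr => p _.
have -> : r 1 p.1 = r (1 * 1) p.1 by rewrite mul1r.
by rewrite (rformMl hr) mulr_suml; apply: eq_bigr => q _; rewrite mulrA.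
Qed.

Lemma rbar_inverse (a b : B) :
  \sum_(p <- cop a) \sum_(q <- cop b) r p.1 q.1 * rbar HB r p.2 q.2 = eps a * eps b /\
  \sum_(p <- cop a) \sum_(q <- cop b) rbar HB r p.1 q.1 * r p.2 q.2 = eps a * eps b.
Proof.
have rb := rform_bil.
split.
  transitivity (r (\sum_(p <- cop a) p.1 * S p.2) b).
    rewrite (islin_suml _ _ (bil1 rb b)); apply: eq_bigr => p _.
    by rewrite (rformMl hr).
  by rewrite antipoder (islinZ _ _ (bil1 rb b)) rform1l.
transitivity (r (\sum_(p <- cop a) S p.1 * p.2) b).
  rewrite (islin_suml _ _ (bil1 rb b)); apply: eq_bigr => p _.
  by rewrite (rformMl hr).
by rewrite antipodel (islinZ _ _ (bil1 rb b)) rform1l.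
Qed.

Lemma rform11_neq0 : r 1 1 != 0.
Proof. by rewrite rform1l counit1 oner_neq0. Qed.

End RForm.

(** * Sums of vectors and independence of characters *)

Section SumOf.
Variables (K : fieldType) (V : lmodType K).

Definition sum_of (P : V -> Prop) (a : V) :=
  exists2 s : seq V, (forall x, x \in s -> P x) & a = \sum_(x <- s) x.

Lemma sum_of0 P : sum_of P 0.
Proof. by exists [::]; rewrite ?big_nil. Qed.

Lemma sum_of1 (P : V -> Prop) a : P a -> sum_of P a.
Proof. by move=> Pa; exists [:: a]; rewrite ?big_seq1 // => x; rewrite inE => /eqP->. Qed.

Lemma sum_ofD P a b : sum_of P a -> sum_of P b -> sum_of P (a + b).
Proof.
move=> [s sP ->] [t tP ->]; exists (s ++ t); last by rewrite big_cat.
by move=> x; rewrite mem_cat => /orP[/sP|/tP].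
Qed.

Lemma sum_of_sum P I (s : seq I) (F : I -> V) :
  (forall i, sum_of P (F i)) -> sum_of P (\sum_(i <- s) F i).
Proof.
move=> FP; elim: s => [|i s IH]; rewrite ?big_nil ?big_cons; first exact: sum_of0.
exact: sum_ofD.
Qed.

Lemma sum_ofS (P Q : V -> Prop) a : (forall x, P x -> Q x) -> sum_of P a -> sum_of Q a.
Proof. by move=> PQ [s sP ->]; exists s => // x /sP /PQ. Qed.

End SumOf.

Lemma sum_of_map (K : fieldType) (V W : lmodType K) (P : V -> Prop) (Q : W -> Prop)
    (f : V -> W) a :
  islin f -> (forall x, P x -> Q (f x)) -> sum_of P a -> sum_of Q (f a).
Proof.
move=> fl PQ [s sP ->]; exists (map f s); last by rewrite big_map islin_suml.
by move=> y /mapP[x /sP Px ->]; exact: PQ.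
Qed.

Section Dedekind.
Variables (R : realType) (D : cartan_datum R).
Local Notation K := (qfield R).
Local Notation hdual := (cdual (cartan D)).
Local Notation wtP := (@Defs.wtP R D).

(** Artin's argument: choose [n] where the character [w j] differs from that of
    [l0]; the relation at [m + n] minus [chi n (w j)] times the relation at [m]
    no longer involves [w j]. *)
Lemma dedekind (V : lmodType K) (I : eqType) (s : seq I) (w : I -> hdual)
    (F : I -> V) l0 v0 : wtP l0 ->
  (forall i, i \in s -> wtP (w i) /\ ~ Rad (w i - l0)) ->
  (forall m, wtP m -> chi m l0 *: v0 + \sum_(i <- s) chi m (w i) *: F i = 0) ->
  v0 = 0.
Proof.
move=> Pl0; elim: s v0 F => [|j s IH] v0 F ws e.
  by have := e 0 (@wtP0 R D); rewrite big_nil addr0 chiC chi0r scale1r.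
have [Pwj nR] := ws j (mem_head _ _).
have [n Pn ne] : exists2 n, wtP n & chi n (w j) <> chi n l0.
  apply: contrapT => nn; apply/nR/(Rad_chi Pwj Pl0) => n Pn.
  by apply: contrapT => h; apply: nn; exists n.
have ws' i : i \in s -> wtP (w i) /\ ~ Rad (w i - l0).
  by move=> si; apply: ws; rewrite inE si orbT.
suff /eqP : (chi n l0 - chi n (w j)) *: v0 = 0.
  by rewrite scaler_eq0 subr_eq0 => /orP[/eqP h|/eqP //]; case: ne.
apply: (IH _ (fun i => (chi n (w i) - chi n (w j)) *: F i) ws') => m Pm.
have := congr2 (fun x y => x - chi n (w j) *: y) (e _ (wtPD Pm Pn)) (e m Pm).
rewrite /= !big_cons scaler0 subr0 => e3; apply: etrans e3.
rewrite !chiDl // !scalerDr !scalerA !opprD addrACA; congr (_ + _).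
  by rewrite -scalerBl mulrBr [chi n (w j) * _]mulrC.
rewrite [RHS]addrACA [chi n (w j) * _]mulrC subrr add0r scaler_sumr -sumrB.
rewrite big_seq [RHS]big_seq; apply: eq_bigr => i si.
have [Pwi _] := ws' i si.
by rewrite chiDl // !scalerA -scalerBl mulrBr [chi n (w j) * _]mulrC.
Qed.

End Dedekind.

(** * The torus and the two halves of the quantised enveloping algebra *)

Section Quantum.
Variables (R : realType) (D : cartan_datum R).
Local Notation K := (qfield R).
Local Notation hdual := (cdual (cartan D)).
Local Notation wtP := (@Defs.wtP R D).
Local Notation alpha := (@Defs.alpha R D).
Local Notation rootN := (@Defs.rootN R D).
Local Notation U := (Uq D).
Local Notation N := {ffun 'I_(rank D) -> nat}.
Local Notation tau := (@Defs.tau R D).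

Lemma tau0 : tau 0 = 1.
Proof. exact/upiP/ueq_tau0. Qed.

Lemma tauD l m : wtP l -> wtP m -> tau l * tau m = tau (l + m).
Proof. by move=> Pl Pm; rewrite /Defs.tau -[LHS]upiM; apply/upiP/ueq_tauD. Qed.

Lemma tauVr l : wtP l -> tau l * tau (- l) = 1.
Proof. by move=> Pl; rewrite tauD ?subrr ?tau0 //; exact: wtPN. Qed.

Lemma tauVl l : wtP l -> tau (- l) * tau l = 1.
Proof. by move=> Pl; rewrite tauD ?addNr ?tau0 //; exact: wtPN. Qed.

(** The two halves are treated at once: [true] stands for [U^+], [false] for [U^-]. *)
Definition gen (sg : bool) i : U := if sg then x_ i else y_ i.
Definition halfU (sg : bool) : U -> Prop := if sg then @Uplus R D else @Uminus R D.
Definition signed (sg : bool) (l : hdual) := if sg then l else - l.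

Lemma signedD sg l m : signed sg (l + m) = signed sg l + signed sg m.
Proof. by case: sg => //=; rewrite opprD. Qed.

Lemma wtP_signed sg l : wtP l -> wtP (signed sg l).
Proof. by case: sg => //= /wtPN. Qed.

Lemma Rad_signed sg l : Rad (signed sg l) -> Rad l.
Proof. by case: sg => //= /RadN; rewrite opprK. Qed.

Lemma halfUP sg : halfU sg = generated_subalgebra (fun u => exists i, u = gen sg i).
Proof. by case: sg. Qed.

(** [ad_weight], with the torus element moved to the other side. *)
Definition homog (l : hdual) (u : U) :=
  forall m, wtP m -> tau m * u = chi m l *: (u * tau m).

Lemma ad_weight_homog l u : ad_weight l u -> homog l u.
Proof.
move=> h m Pm; rewrite scalerAl.
by have := h m Pm; rewrite -/(chi m l) => <-; rewrite -!mulrA tauVl // mulr1.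
Qed.

Lemma homog_gen sg i : homog (signed sg (alpha i)) (gen sg i).
Proof.
move=> m Pm; rewrite /gen /signed /chi; case: sg; last rewrite (wformNr m (alpha i)).
- have : upi (Umul (utau m) (Ux i)) = upi (uscale (qpow D (Defs.form m (alpha i))) (Umul (Ux i) (utau m))).
    exact/upiP/ueq_taux.
  by rewrite upiM upiZ upiM.
- have : upi (Umul (utau m) (Uy i)) = upi (uscale (qpow D (- Defs.form m (alpha i))) (Umul (Uy i) (utau m))).
    exact/upiP/ueq_tauy.
  by rewrite upiM upiZ upiM.
Qed.

Lemma homog1 : homog 0 1.
Proof. by move=> m _; rewrite chi0r scale1r mulr1 mul1r. Qed.

Lemma homogZ l c u : homog l u -> homog l (c *: u).
Proof. by move=> h m Pm; rewrite -scalerAr h // -scalerAl !scalerA mulrC. Qed.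

Lemma homogM l l' u u' : wtP l -> wtP l' -> homog l u -> homog l' u' -> homog (l + l') (u * u').
Proof.
move=> Pl Pl' h h' m Pm; rewrite mulrA h // -scalerAl -[u * tau m * u']mulrA h' // -scalerAr scalerA.
by rewrite chiDr // mulrA.
Qed.

Lemma homogR l u m : wtP l -> wtP m -> homog l u -> u * tau m = chi m (- l) *: (tau m * u).
Proof. by move=> Pl Pm h; rewrite h // scalerA chiNr // mulVf ?scale1r ?chi_neq0. Qed.

(** Expand in monomials in the generators; only the empty monomial has degree
    zero. *)
Lemma half_decomposition sg u : halfU sg u ->
  sum_of (fun v => exists2 m : N, homog (signed sg (rootN m)) v &
                   m = [ffun=> 0%N] -> exists c, v = c *: 1) u.
Proof.
have r0 : rootN [ffun=> 0%N] = 0 := rootN0 D.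
have s0 : signed sg 0 = 0 by case: (sg); rewrite /= ?oppr0.
have one : sum_of (fun v => exists2 m : N, homog (signed sg (rootN m)) v &
     m = [ffun=> 0%N] -> exists c, v = c *: 1) 1.
  apply: sum_of1; exists [ffun=> 0%N]; first by rewrite r0 s0; exact: homog1.
  by move=> _; exists 1; rewrite scale1r.
have Zcl c v : (exists2 m : N, homog (signed sg (rootN m)) v &
     m = [ffun=> 0%N] -> exists c, v = c *: 1) ->
   exists2 m : N, homog (signed sg (rootN m)) (c *: v) &
     m = [ffun=> 0%N] -> exists c', c *: v = c' *: 1.
  move=> [m hm m0]; exists m; first exact: homogZ.
  by move=> /m0[d ->]; exists (c * d); rewrite scalerA.
rewrite halfUP; elim=> {u} [u [i ->]||c u _|u v _ IHu _ IHv|u v _ IHu _ IHv].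
- apply: sum_of1; exists (rootN1 i); first by rewrite rootN1E; exact: homog_gen.
  by move=> /ffunP/(_ i); rewrite !ffunE eqxx.
- exact: one.
- apply: (sum_of_map (f := fun v => c *: v)); last exact: Zcl.
  by apply: islin_scaler; exact: islin_id.
- exact: sum_ofD.
- case: IHu => s sP ->; rewrite mulr_suml big_seq; apply: big_ind.
  + exact: sum_of0.
  + by move=> *; exact: sum_ofD.
  + move=> w /sP [m hm m0]; apply: (sum_of_map (f := fun v => w * v)) IHv.
      by apply: islin_mulr; exact: islin_id.
    move=> x [n hn n0]; exists [ffun i => (m i + n i)%N].
      by rewrite rootND signedD; apply: homogM => //; apply/wtP_signed/wtP_rootN.
    move=> /ffunP mn0.
    have [c ->] : exists c, w = c *: 1.
      by apply/m0/ffunP => i; have /eqP := mn0 i; rewrite !ffunE addn_eq0 => /andP[/eqP].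
    have [d ->] : exists d, x = d *: 1.
      by apply/n0/ffunP => i; have /eqP := mn0 i; rewrite !ffunE addn_eq0 => /andP[_ /eqP].
    by exists (c * d); rewrite -scalerAl mul1r scalerA.
Qed.

Section Hopf.
Variables (H : hopf_algebra U) (hH : Uq_hopf H).
Local Notation eps := (counit H).

Lemma eps_tau l : wtP l -> eps (tau l) = 1.
Proof.
move=> Pl; have := cop_counitl H (tau l).
rewrite (cop_tau hH Pl (f := fun u v => eps u *: v)); last first.
  by split=> [w|v]; [apply: islin_scalel; exact: eps_lin|apply: islin_scaler].
rewrite big_seq1 /= => e; have /eqP : (eps (tau l) - 1) *: (tau l * tau (- l)) = 0.
  by rewrite scalerAl scalerBl e scale1r subrr mul0r.
by rewrite tauVr // scaler_eq0 oner_eq0 orbF subr_eq0 => /eqP.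
Qed.

Lemma eps_gen sg i : eps (gen sg i) = 0.
Proof.
have Pa := wtP_alpha i; have PNa := wtPN Pa.
have cl : bilinear_map (fun u v : U => eps u *: v).
  by split=> [w|v]; [apply: islin_scalel; exact: eps_lin|apply: islin_scaler].
rewrite /gen; case: sg.
- have := cop_counitl H (x_ i); rewrite (cop_x hH i cl) !big_cons big_nil /=.
  rewrite eps_tau // scale1r addr0 => /(canRL (addrK _)); rewrite subrr => /eqP.
  by rewrite scaler_eq0 oner_eq0 orbF => /eqP.
- have := cop_counitl H (y_ i); rewrite (cop_y hH i cl) !big_cons big_nil /=.
  rewrite counit1 scale1r addr0 => /(canRL (addrK _)); rewrite subrr => e.
  have /eqP : eps (y_ i) *: (tau (- alpha i) * tau (alpha i)) = 0.
    by rewrite scalerAl e mul0r.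
  by rewrite tauVl // scaler_eq0 oner_eq0 orbF => /eqP.
Qed.

(** The counit is invariant under the adjoint action of the torus. *)
Lemma eps_homog l u : wtP l -> homog l u -> ~ Rad l -> eps u = 0.
Proof.
move=> Pl h nR; apply: contrapT => u0; apply: nR.
have Pl0 := @wtP0 R D.
rewrite -[l]subr0; apply/Rad_chi => // m Pm; rewrite chi0r.
have := congr1 eps (h m Pm); rewrite counitM eps_tau // mul1r epsZ.
rewrite counitM eps_tau // mulr1 -{1}[eps u]mul1r.
by move/eqP: u0 => u0 /(mulIf u0).
Qed.

Hypothesis noRad : forall m : N, Rad (rootN m) -> m = [ffun=> 0%N].

(** By independence of characters only the terms of degree zero survive in an
    expansion of [u] in monomials. *)
Lemma half_const sg u : halfU sg u -> homog 0 u -> u = eps u *: 1.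
Proof.
move=> /half_decomposition [s sP uE] h0.
suff [c ->] : exists c, u = c *: 1.
  by rewrite epsZ counit1 mulr1.
have [v /sP[m hm m0]|mm mmP] := @choice_in U N [ffun=> 0%N] s (fun v m =>
    homog (signed sg (rootN m)) v /\ (m = [ffun=> 0%N] -> exists c, v = c *: 1)).
  by exists m.
pose z : N := [ffun=> 0%N].
have uz : u - \sum_(v <- s | mm v == z) v = 0.
  apply: (@dedekind _ D _ _ [seq v <- s | mm v != z] (fun v => signed sg (rootN (mm v)))
    (fun v => - v) 0); first exact: wtP0.
    move=> v; rewrite mem_filter => /andP[nz vs]; split; first exact/wtP_signed/wtP_rootN.
    by rewrite subr0 => /Rad_signed/noRad/eqP; exact/negP.
  move=> m Pm; rewrite chi0r scale1r big_filter.
  have uE' : u = \sum_(v <- s) chi m (signed sg (rootN (mm v))) *: v.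
    have : tau m * u * tau (- m) = u by rewrite h0 // chi0r scale1r -mulrA tauVr ?mulr1.
    move=> <-; rewrite {1}uE mulr_sumr mulr_suml big_seq [RHS]big_seq; apply: eq_bigr => v vs.
    by rewrite (mmP v vs).1 // -scalerAl -mulrA tauVr ?mulr1.
  have : \sum_(v <- s | mm v == z) v = \sum_(v <- s | mm v == z) chi m (signed sg (rootN (mm v))) *: v.
    apply: eq_bigr => v /eqP ->; rewrite rootN0.
    by case: (sg); rewrite /= ?oppr0 chi0r scale1r.
  move=> ->; rewrite [u in u - _]uE' (bigID (fun v => mm v == z)) /= [X in X + _]addrAC subrr add0r.
  by rewrite -big_split /= big1 // => v _; rewrite scalerN subrr.
move/eqP: uz; rewrite subr_eq0 => /eqP ->.
rewrite big_seq_cond; apply: (big_ind (fun x : U => exists c, x = c *: 1)).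
- by exists 0; rewrite scale0r.
- by move=> _ _ [c ->] [d ->]; exists (c + d); rewrite scalerDl.
- by move=> v /andP[vs /eqP mv]; exact: (mmP v vs).2.
Qed.

End Hopf.
End Quantum.

(** * Leading terms for a total order on weights *)

Section Leading.
Variables (R : realType) (D : cartan_datum R).
Local Notation K := (qfield R).
Local Notation hdual := (cdual (cartan D)).
Local Notation wtP := (@Defs.wtP R D).
Variables (V : lmodType K) (T : hdual -> V -> V).
Hypothesis Tlin : forall m, islin (T m).
Variable M : hdual -> Prop.
Hypotheses (MD : add_closed M) (Mpr : forall l, M l -> M (- l) -> Rad l).
Hypotheses (MR : forall l, Rad l -> M l) (Mtot : forall l, M l \/ M (- l)).

Definition wt l (x : V) := wtP l /\ forall m, wtP m -> T m x = chi m l *: x.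
Definition wle l l' := M (l' - l).
Definition wlt l l' := M (l' - l) /\ ~ Rad (l' - l).
Definition above l := sum_of (fun x => exists2 l', wt l' x & wlt l l').

Lemma wle_lt_trans l l' l'' : wle l l' -> wlt l' l'' -> wlt l l''.
Proof.
move=> h [h' nR]; have e : l'' - l = (l'' - l') + (l' - l) by rewrite addrA subrK.
split; first by rewrite e; exact: MD.
move=> Rl; apply: nR; apply: Mpr => //.
have -> : - (l'' - l') = (l' - l) + - (l'' - l).
  by rewrite !opprB addrA subrK.
by apply: MD => //; apply/MR/RadN.
Qed.

Lemma wlt_le_trans l l' l'' : wlt l l' -> wle l' l'' -> wlt l l''.
Proof.
move=> [h nR] h'; have e : l'' - l = (l'' - l') + (l' - l) by rewrite addrA subrK.
split; first by rewrite e; exact: MD.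
move=> Rl; apply: nR; apply: Mpr => //.
have -> : - (l' - l) = (l'' - l') + - (l'' - l).
  by rewrite !opprB [RHS]addrC addrA subrK.
by apply: MD => //; apply/MR/RadN.
Qed.

Lemma wlt_addl l l' m : wlt l l' -> wlt (l + m) (l' + m).
Proof. by rewrite /wlt opprD addrACA subrr addr0. Qed.

Lemma wt_Rad l l' x : wtP l' -> Rad (l - l') -> wt l x -> wt l' x.
Proof.
by move=> Pl' Rll' [Pl h]; split=> // m Pm; rewrite h // ((Rad_chi Pl Pl').1 Rll').
Qed.

Lemma wtD l x y : wt l x -> wt l y -> wt l (x + y).
Proof.
by move=> [Pl h] [_ h']; split=> // m Pm; rewrite (islinD _ _ (Tlin m)) h // h' // scalerDr.
Qed.

Lemma aboveS l l' x : wle l' l -> above l x -> above l' x.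
Proof.
move=> le; apply: sum_ofS => y [m hy lm]; exists m => //; exact: wle_lt_trans lm.
Qed.

(** Insert the terms of a decomposition one by one. When the leading term is
    cancelled, start again with the rest, which is a shorter sum. *)
Lemma leading_term (x : V) : sum_of (fun y => exists l, wt l y) x -> x != 0 ->
  exists l x0, [/\ wt l x0, x0 != 0 & above l (x - x0)].
Proof.
move=> [s sP ->] sn0.
suff [l [z [t [hz z0 tP e _]]]] : exists l z t, [/\ wt l z, z != 0,
    forall y, y \in t -> exists2 l', wt l' y & wlt l l',
    \sum_(y <- s) y = z + \sum_(y <- t) y & (size t < size s)%N].
  by exists l, z; split=> //; exists t; rewrite // e addrC addKr.
have [n] := ubnP (size s); elim: n s sP sn0 => // n IH [|y s] sP + /ltnSE sn.
  by rewrite big_nil eqxx.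
have sP' z : z \in s -> exists l, wt l z by move=> zs; apply: sP; rewrite inE zs orbT.
have [m hy] := sP y (mem_head _ _); rewrite big_cons.
have [Pm _] := hy.
have [s0|s0 yn0] := eqVneq (\sum_(z <- s) z) 0.
  rewrite s0 addr0 => y0; exists m, y, [::]; split=> //; by rewrite big_nil addr0.
have [l [z [t [hz z0 tP e st]]]] := IH s sP' s0 sn.
have [y0|y0] := eqVneq y 0.
  by exists l, z, t; split=> //; [rewrite y0 add0r | exact: leqW].
have [Pl _] := hz.
have [Rml|nR] := pselect (Rad (m - l)).
  have hy' := wt_Rad Pl Rml hy.
  have [e'|ne] := eqVneq (y + z) 0; last first.
    exists l, (y + z), t; split=> //; [exact: wtD|by rewrite e addrA|exact: leqW].
  (* [y] cancels the leading term: start again with the shorter sum [t] *)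
  rewrite e addrA e' add0r in yn0 *.
  have tP' w : w \in t -> exists l, wt l w by move=> /tP[l']; exists l'.
  have [l1 [z1 [t1 [h1 h2 h3 h4 h5]]]] := IH t tP' yn0 (leq_trans st (ltnW sn)).
  exists l1, z1, t1; split=> //; exact: leqW (ltn_trans h5 st).
have nR' : ~ Rad (l - m) by move=> /RadN; rewrite opprB.
have [h|h] := Mtot (m - l).
  exists l, z, (y :: t); split=> //; last by rewrite big_cons e addrCA.
  by move=> w; rewrite inE => /predU1P[->|/tP //]; exists m.
rewrite opprB in h; exists m, y, (z :: t); split=> //; last by rewrite big_cons e.
move=> w; rewrite inE => /predU1P[->|/tP[l' hw ll']]; first by exists l.
by exists l' => //; exact: wle_lt_trans ll'.
Qed.

Lemma leading_cancel l (x y : V) : wt l x -> above l y -> x + y = 0 -> x = 0.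
Proof.
move=> [Pl hx] [s sP ->] e.
have [z zs|w wP] := @choice_in V hdual 0 s (fun z l' => wt l' z /\ wlt l l').
  by have [l' h1 h2] := sP z zs; exists l'.
apply: (@dedekind R D V _ s w (fun z => z) l x) => // [z zs|m Pm].
  by have [[Pw _] [_ nR]] := wP z zs.
have := congr1 (T m) e; rewrite (islin0 (Tlin m)) => e'; apply: etrans e'.
rewrite (islinD _ _ (Tlin m)) hx //; congr (_ + _).
rewrite (islin_suml _ _ (Tlin m)) big_seq [RHS]big_seq; apply: eq_bigr => z zs.
by have [[_ h] _] := wP z zs; rewrite h.
Qed.

End Leading.

Section LeadingProduct.
Variables (R : realType) (D : cartan_datum R).
Local Notation K := (qfield R).
Local Notation hdual := (cdual (cartan D)).
Variables (V : lmodType K) (T : hdual -> V -> V).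
Hypothesis Tlin : forall m, islin (T m).
Variable M : hdual -> Prop.
Hypotheses (MD : add_closed M) (Mpr : forall l, M l -> M (- l) -> Rad l).
Hypotheses (MR : forall l, Rad l -> M l) (Mtot : forall l, M l \/ M (- l)).
Hypothesis decomposition : forall x, sum_of (fun y => exists l, wt T l y) x.

(** The product [g] of the leading terms of [x] and [y] is the leading term of
    [f x y]. *)
Lemma leading_zero_divisor (f : V -> V -> V) (g : hdual -> V -> V -> V) :
  bilinear_map f ->
  (forall l l' x y, wt T l x -> wt T l' y ->
     wt T (l + l') (g l x y) /\ above T M (l + l') (f x y - g l x y)) ->
  forall x y, f x y = 0 -> x != 0 -> y != 0 ->
  exists l l' x0 y0, [/\ wt T l x0, wt T l' y0, x0 != 0, y0 != 0 & g l x0 y0 = 0].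
Proof.
move=> fb fg x y fxy x_n0 y_n0.
have [l [x0 [hx x0n ax]]] := leading_term Tlin MD Mpr MR Mtot (decomposition x) x_n0.
have [l' [y0 [hy y0n ay]]] := leading_term Tlin MD Mpr MR Mtot (decomposition y) y_n0.
exists l, l', x0, y0; split=> //; have [hg agb] := fg _ _ _ _ hx hy.
have up m m' u v : wt T m u -> wt T m' v -> wlt M (l + l') (m + m') -> above T M (l + l') (f u v).
  move=> hu hv lt; have [h1 h2] := fg _ _ _ _ hu hv.
  rewrite -[f u v](subrK (g m u v)); apply: sum_ofD; last by apply: sum_of1; exists (m + m').
  by apply: aboveS h2 => //; case: lt.
have suml (I : eqType) (s : seq I) (F : I -> V) : (forall i, i \in s -> above T M (l + l') (F i)) ->
    above T M (l + l') (\sum_(i <- s) F i).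
  by move=> h; rewrite big_seq; apply: big_ind => [|u v|]; [exact: sum_of0|exact: sum_ofD|exact: h].
have up1 : above T M (l + l') (f x0 (y - y0)).
  case: ay => s sP ->; rewrite (islin_suml _ _ (bil2 fb _)); apply: (suml) => z /sP[m hz lm].
  apply: up hx hz _; rewrite ![l + _]addrC; exact: wlt_addl.
have up2 : above T M (l + l') (f (x - x0) y).
  case: ax => s sP ->; rewrite (islin_suml _ _ (bil1 fb _)); apply: (suml) => z /sP[m hz lm].
  rewrite -(subrK y0 y) (islinD _ _ (bil2 fb z)); apply: sum_ofD; last first.
    by apply: up hz hy _; exact: wlt_addl.
  case: ay => s' sP' ->; rewrite (islin_suml _ _ (bil2 fb _)); apply: suml => w /sP'[m' hw lm'].
  apply: up hz hw _; apply: (wlt_le_trans MD Mpr MR (wlt_addl l' lm)).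
  by rewrite ![m + _]addrC; have [h _] := wlt_addl m lm'.
apply: (leading_cancel Tlin hg (y := (f x0 y0 - g l x0 y0) + (f x0 (y - y0) + f (x - x0) y))).
  exact: (sum_ofD agb (sum_ofD up1 up2)).
rewrite (addrA (g l x0 y0)) (addrC (g l x0 y0)) subrK addrA -(islinD _ _ (bil2 fb x0)).
by rewrite [y0 + _]addrC subrK -(islinD _ _ (bil1 fb y)) addrC subrK.
Qed.

End LeadingProduct.

(** * Decomposition into weight vectors *)

Section CharDecomposition.
Variables (R : realType) (D : cartan_datum R).
Local Notation K := (qfield R).
Local Notation hdual := (cdual (cartan D)).
Local Notation wtP := (@Defs.wtP R D).

(** Subtracting from a translate of [a] its expected multiple removes a character;
    [a] is a combination of two such differences. *)
Lemma char_decomposition (V : lmodType K) (T : hdual -> V -> V) :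
  (forall m, islin (T m)) ->
  (forall m n a, wtP m -> wtP n -> T m (T n a) = T (m + n) a) -> (forall a, T 0 a = a) ->
  forall (s : seq (hdual * V)) a, (forall p, p \in s -> wtP p.1) ->
  (forall m, wtP m -> T m a = \sum_(p <- s) chi m p.1 *: p.2) ->
  sum_of (fun x => exists l, wtP l /\ forall m, wtP m -> T m x = chi m l *: x) a.
Proof.
move=> Tl TD T0 s; have [n] := ubnP (size s).
elim: n s => // n IH s /ltnSE sn a sw aE.
case: s sn sw aE => [|p0 s'] sn sw aE.
  have := aE 0 (@wtP0 R D); rewrite big_nil T0 => ->; exact: sum_of0.
set s := p0 :: s' in sn sw aE; have p0s : p0 \in s by rewrite mem_head.
have s_gt0 : (0 < size s)%N by []; clearbody s.
have [allR|] := pselect (forall p, p \in s -> Rad (p.1 - p0.1)).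
  apply: sum_of1; exists p0.1; split=> [|m Pm]; first exact: sw.
  have aE' : a = \sum_(p <- s) p.2.
    rewrite -[LHS]T0 aE; last exact: wtP0.
    by apply: eq_bigr => p _; rewrite chiC chi0r scale1r.
  rewrite aE // aE' scaler_sumr big_seq [RHS]big_seq; apply: eq_bigr => p ps.
  by rewrite ((Rad_chi (sw p ps) (sw p0 p0s)).1 (allR p ps)).
move=> nall; have [p [ps nR]] : exists p, p \in s /\ ~ Rad (p.1 - p0.1).
  apply: contrapT => h; apply: nall => p ps; apply: contrapT => nR.
  by apply: h; exists p.
have [m Pm chim] : exists2 m, wtP m & chi m p.1 <> chi m p0.1.
  apply: contrapT => h; apply: nR; apply/(Rad_chi (sw p ps) (sw p0 p0s)) => m Pm.
  by apply: contrapT => h'; apply: h; exists m.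
have kill q : q \in s -> sum_of (fun x => exists l, wtP l /\
    forall m, wtP m -> T m x = chi m l *: x) (T m a - chi m q.1 *: a).
  move=> qs; apply: (IH [seq (i.1, (chi m i.1 - chi m q.1) *: i.2) | i <- rem q s]).
  - by rewrite size_map size_rem // prednK.
  - by move=> _ /mapP[i /mem_rem si ->]; exact: (sw i si).
  - move=> k Pk; rewrite (islinD _ _ (Tl k)) (islinN _ (Tl k)) (islinZ _ _ (Tl k)).
    rewrite TD // !aE //; last exact: wtPD.
    rewrite !(big_rem _ qs) big_map scalerDr opprD addrACA.
    rewrite (chiDl Pk Pm (sw q qs)) scalerA [chi m q.1 * _]mulrC.
    rewrite subrr add0r scaler_sumr -sumrB big_seq [RHS]big_seq.
    apply: eq_bigr => i /mem_rem si /=; rewrite (chiDl Pk Pm (sw i si)) !scalerA -scalerBl.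
    by rewrite mulrBr [chi m q.1 * _]mulrC.
have -> : a = (chi m p.1 - chi m p0.1)^-1 *: ((T m a - chi m p0.1 *: a) +
    (-1) *: (T m a - chi m p.1 *: a)).
  rewrite scaleN1r opprB [X in _ *: X]addrC addrA subrK -scalerBl scalerA mulVf ?scale1r //.
  by rewrite subr_eq0; apply/eqP.
have Zc c x : sum_of (fun x => exists l, wtP l /\ forall m, wtP m -> T m x = chi m l *: x) x ->
    sum_of (fun x => exists l, wtP l /\ forall m, wtP m -> T m x = chi m l *: x) (c *: x).
  apply: (sum_of_map (f := fun x => c *: x)).
    by apply: islin_scaler; exact: islin_id.
  move=> y [l [Pl h]]; exists l; split=> // k Pk.
  by rewrite (islinZ _ _ (Tl k)) h // !scalerA mulrC.
by apply/Zc/sum_ofD; [exact: kill | apply/Zc/kill].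
Qed.

End CharDecomposition.

(** * Quantised functions *)

Section Eventually.
Variable N : eqType.

(** The braiding form is a sum over all degrees whose support is finite, but depends
    on the arguments. Identities between such sums are stated for all large enough
    finite sets of degrees. *)
Definition eventually (Q : seq N -> Prop) :=
  exists s : seq N, forall s' : seq N, uniq s' -> {subset s <= s'} -> Q s'.

Lemma eventuallyS (P Q : seq N -> Prop) :
  (forall s, P s -> Q s) -> eventually P -> eventually Q.
Proof. by move=> PQ [s sP]; exists s => s' us ss; exact/PQ/sP. Qed.

Lemma eventuallyI (P Q : seq N -> Prop) :
  eventually P -> eventually Q -> eventually (fun s => P s /\ Q s).
Proof.
move=> [s sP] [t tQ]; exists (s ++ t) => s' us ss; split; [apply: sP|apply: tQ] => // x xs;
  by apply: ss; rewrite mem_cat xs ?orbT.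
Qed.

Lemma eventually_all (I : eqType) (l : seq I) (P : I -> seq N -> Prop) :
  (forall i, i \in l -> eventually (P i)) ->
  eventually (fun s => forall i, i \in l -> P i s).
Proof.
elim: l => [|i l IH] lP; first by exists [::] => s _ _ i; rewrite in_nil.
have h : eventually (fun s => forall i, i \in l -> P i s).
  by apply: IH => j jl; apply: lP; rewrite inE jl orbT.
apply: eventuallyS (eventuallyI (lP i (mem_head _ _)) h) => s [h1 h2] j.
by rewrite inE => /predU1P[->|/h2].
Qed.

Lemma eventually_ex (n0 : N) (P : seq N -> Prop) :
  eventually P -> exists s, [/\ uniq s, n0 \in s & P s].
Proof.
move=> [s sP]; exists (undup (n0 :: s)); split; first exact: undup_uniq.
- by rewrite mem_undup mem_head.
- by apply: sP; [exact: undup_uniq|move=> x xs; rewrite mem_undup inE xs orbT].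
Qed.

End Eventually.

Section QuantisedFunctions.
Variables (R : realType) (D : cartan_datum R).
Local Notation K := (qfield R).
Local Notation hdual := (cdual (cartan D)).
Local Notation wtP := (@Defs.wtP R D).
Local Notation alpha := (@Defs.alpha R D).
Local Notation rootN := (@Defs.rootN R D).
Local Notation form := (@Defs.form R D).
Local Notation U := (Uq D).
Local Notation N := {ffun 'I_(rank D) -> nat}.
Local Notation tau := (@Defs.tau R D).

(** ** Weights of modules *)

Section Modules.
Variable V : Uq_module D.

Lemma act_lin1 (v : V) : islin (fun u => act u v).
Proof. exact: (bil1 (act_bilinear V)). Qed.

Lemma act_lin2 u : islin (fun v : V => act u v).
Proof. exact: (bil2 (act_bilinear V)). Qed.

Lemma matrix_coef_lin (f : mod_dual V) (v : V) : islin (matrix_coef f v : U -> K^o).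
Proof.
apply: (islin_comp (f := (f : V -> K^o))) (act_lin1 v).
by move=> c x y; rewrite linearP.
Qed.

Lemma act_homog l l' u (v : V) : wtP l -> homog l u -> has_weight v l' ->
  forall m, wtP m -> act (tau m) (act u v) = chi m (l + l') *: act u v.
Proof.
move=> Pl hu [Pl' hv] m Pm; rewrite -actM hu //.
rewrite (islinZ _ _ (act_lin1 v)) actM hv // (islinZ _ _ (act_lin2 u)) scalerA.
by rewrite chiDr.
Qed.

Lemma type_one_basis : type_one V -> exists (n : nat) (b : n.-tuple V) (w : 'I_n -> hdual),
  basis_of fullv b /\ forall i : 'I_n, has_weight b`_i (w i).
Proof.
move=> [b bb bw]; exists (size b), (in_tuple b).
have [w wP] := @choice 'I_(size b) hdual (fun i l => has_weight b`_i l)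
  (fun i => bw _ (mem_nth 0 (ltn_ord i))).
by exists w.
Qed.

Lemma type_one_decomposition (v : V) : type_one V ->
  sum_of (fun x => exists l, has_weight x l) v.
Proof.
move=> /type_one_basis[n [b [w [bb bw]]]].
rewrite (coord_basis bb (memvf v)); apply: sum_of_sum => i.
apply: sum_of1; exists (w i); have [Pw h] := bw i; split=> // m Pm.
by rewrite (islinZ _ _ (act_lin2 _)) h // !scalerA mulrC.
Qed.

Lemma type_one_weights : type_one V -> exists L : seq hdual, forall (x : V) l,
  wtP l -> x <> 0 -> (forall m, wtP m -> act (tau m) x = chi m l *: x) ->
  exists2 l', l' \in L & Rad (l - l').
Proof.
move=> /type_one_basis[n [b [w [bb bw]]]]; exists [seq w i | i <- enum 'I_n].
move=> x l Pl x0 hx; apply: contrapT => nl; apply: x0.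
apply: (@dedekind _ D _ _ (enum 'I_n) w (fun i => - (coord b i x *: b`_i)) l) => // [i _|m Pm].
  split; first by have [] := bw i.
  move=> /RadN; rewrite opprB => h; apply: nl; exists (w i) => //.
  by apply: map_f; rewrite mem_enum.
rewrite -hx // big_enum /= [in act _ x](coord_basis bb (memvf x)).
rewrite (islin_suml _ _ (act_lin2 _)) -big_split big1 //= => i _.
have [_ h] := bw i; rewrite (islinZ _ _ (act_lin2 _)) h // scalerN !scalerA mulrC.
by rewrite subrr.
Qed.

End Modules.

Variables (H : hopf_algebra U) (hH : Uq_hopf H).
Local Notation eps := (counit H).
Local Notation S := (antipode H).
Variables (pr : U -> U -> K) (hpr : borel_pairing H pr).
Variables (Theta : N -> seq (U * U)) (hTheta : quasi_R_matrix pr Theta).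

(** ** The canonical elements *)

Lemma Theta_mem m t : t \in Theta m ->
  Uplus_ (rootN m) t.1 /\ Uminus_ (- rootN m) t.2.
Proof.
have [[b1 _] [b2 _] _] := hTheta m.
move=> /(nthP (0, 0))[i ilt <-].
have i1 : (i < size (unzip1 (Theta m)))%N by rewrite size_map.
have i2 : (i < size (unzip2 (Theta m)))%N by rewrite size_map.
have := b1 (Ordinal i1); have := b2 (Ordinal i2).
by rewrite /= !(nth_map (0, 0)).
Qed.

Lemma Theta_half m t : t \in Theta m -> halfU true t.1 /\ halfU false t.2.
Proof. by move=> /Theta_mem[[h1 _] [h2 _]]. Qed.

Lemma Theta_homog m t : t \in Theta m -> homog (rootN m) t.1 /\ homog (- rootN m) t.2.
Proof. by move=> /Theta_mem[[_ h1] [_ h2]]; split; exact: ad_weight_homog. Qed.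

Lemma pairing_bil : bilinear_map (pr : U -> U -> K^o).
Proof. exact: (pr_bilinear hpr). Qed.

Lemma pairing_one y : Uminus y -> pr y 1 = eps y.
Proof.
have b1 : bplus (1 : U) := gen_one _.
have bm (v : U) : Uminus v -> bminus v by move=> ?; apply: gen_in; left.
have lin1 : islin ((fun v => pr v 1) : U -> K^o) := bil1 pairing_bil 1.
elim=> {y} [y [i ->]||c y _ IH|y y' _ IH _ IH'|y y' hy IH hy' IH'].
- by rewrite -(tau0 D) (pr_ytau hpr i (@wtP0 R D)) -[y_ i]/(gen false i) (eps_gen hH).
- rewrite -[in LHS](tau0 D) (pr_tau hpr (@wtP0 R D) (@wtP0 R D)) wform0r oppr0 qpow0.
  by rewrite counit1.
- by rewrite (islinZ _ _ lin1) epsZ IH.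
- by rewrite (islinD _ _ lin1) (islinD _ _ (eps_lin H)) IH IH'.
- rewrite (pr_Ml hpr (bm _ hy) (bm _ hy') b1) counitM -IH -IH'.
  rewrite (@sweedler_one _ _ H K^o (fun u v => pr y u * pr y' v)) //.
  by split=> x; lin_with ltac:(exact: (bil2 pairing_bil)).
Qed.

(** The element [1] has this degree, and its coefficients in the basis of [U^+] are
    its pairings with the dual basis, that is, values of the counit. *)
Lemma Theta_eps m : Rad (rootN m) -> \sum_(t <- Theta m) eps t.1 * eps t.2 = 1.
Proof.
move=> Rm; have [[_ b1] [b2 _] dual] := hTheta m.
have [] := b1 1.
  split; first exact: gen_one.
  by move=> l Pl; rewrite mulr1 tauVr // Rm // qpow0 scale1r.
move=> c [oneE _].
set s := unzip1 (Theta m) in c oneE.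
have sz : size s = size (Theta m) by rewrite size_map.
have sE (i : 'I_(size s)) : s`_i = (nth (0, 0) (Theta m) i).1.
  by rewrite (nth_map (0, 0)) // -sz.
have cE (i : 'I_(size s)) : c i = eps (nth (0, 0) (Theta m) i).2.
  have it : (i < size (Theta m))%N by rewrite -sz.
  have [_ [hm _]] := Theta_mem (mem_nth (0, 0) it).
  rewrite -pairing_one // [in RHS]oneE (islin_suml _ _ (bil2 pairing_bil _)).
  rewrite (bigD1 i) //= (islinZ _ _ (bil2 pairing_bil _)) sE.
  rewrite (dual (Ordinal it) (Ordinal it)) eqxx big1 => [|j ji].
    by rewrite addr0 [RHS]mulr1.
  have jt : (j < size (Theta m))%N by rewrite -sz.
  rewrite (islinZ _ _ (bil2 pairing_bil _)) sE (dual (Ordinal it) (Ordinal jt)).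
  have -> : (Ordinal it == Ordinal jt) = false.
    by apply/negP => /eqP/(congr1 val) /= e; case/eqP: ji; exact/val_inj.
  exact: mulr0.
have := congr1 eps oneE; rewrite counit1 => ->.
rewrite (islin_suml _ _ (eps_lin H)) (big_nth (0, 0)) big_mkord -sz.
by apply: eq_bigr => i _; rewrite epsZ cE sE mulrC.
Qed.

Variables (B : algType K) (HB : hopf_algebra B).
Local Notation SB := (antipode HB).
Variables (ev : B -> U -> K) (hB : is_kqG H HB ev).
Variables (r : B -> B -> K) (hr : universal_rform HB r).
Hypothesis (hrTheta : is_braiding_form Theta ev r).

(** ** Nondegeneracy on the root lattice *)

Definition triv_act (u : U) (v : K^o) : K^o := eps u * v.

Lemma triv_act_bil : bilinear_map triv_act.
Proof.
split=> [w|v]; first by apply: islin_kmull; exact: eps_lin.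
by apply: islin_kmulr; exact: islin_id.
Qed.

Lemma triv_act1 v : triv_act 1 v = v.
Proof. by rewrite /triv_act counit1 mul1r. Qed.

Lemma triv_actM u u' v : triv_act (u * u') v = triv_act u (triv_act u' v).
Proof. by rewrite /triv_act counitM mulrA. Qed.

Definition triv : Uq_module D := @UqModule R D K^o triv_act triv_act_bil triv_act1 triv_actM.

Lemma triv_weight (v : triv) : has_weight v 0.
Proof.
split; first exact: wtP0.
move=> m Pm; rewrite /= /triv_act (eps_tau hH) // mul1r.
by rewrite wform0r qpow0 scale1r.
Qed.

Lemma triv_type_one : type_one triv.
Proof.
exists (vbasis (fullv : {vspace triv})); first exact: vbasisP.
by move=> v _; exists 0; exact: triv_weight.
Qed.

(** If a nonzero sum of simple roots were orthogonal to all weights, then so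
    would be its multiples, and the sum that defines the braiding form on the
    trivial module would have infinitely many terms equal to [1]. *)
Lemma rootN_Rad (m : N) : Rad (rootN m) -> m = [ffun=> 0%N].
Proof.
move=> Rm; apply: contrapT => m0.
have /eqP := rform11_neq0 hr; apply.
pose f : mod_dual triv := \1%VF.
have ev1f : ev 1 = matrix_coef f (1 : K).
  apply/funext => u; rewrite (ev1 hB) /matrix_coef lfunE /= /triv_act mulr1 //.
rewrite (hrTheta triv_type_one triv_type_one (triv_weight 1) (triv_weight 1) ev1f ev1f).
rewrite /braiding_coef fsbig_dflt ?mulr0 // => fin.
have Ek k : Rad (rootN [ffun i => (m i * k)%N]).
  by rewrite rootNMn => n Pn; rewrite wformMn Rm // mul0rn.
have [i mi] : exists i, m i != 0%N.
  apply: contrapT => h; apply: m0; apply/ffunP => i; rewrite ffunE.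
  by apply/eqP; apply: contrapT => mi; apply: h; exists i; exact/negP.
apply: infinite_nat.
apply: sub_finite_set (finite_preimage (f := fun k => [ffun i => (m i * k)%N] : N) _ fin); last first.
  move=> k l _ _ /ffunP/(_ i); rewrite !ffunE => /eqP.
  by rewrite eqn_pmul2l ?lt0n // => /eqP.
move=> k _; split=> //=; have := Theta_eps (Ek k).
rewrite /f; under eq_bigr do rewrite mulrC.
under [X in _ -> X <> _]eq_bigr do rewrite !lfunE /= /triv_act !mulr1.
by move=> -> /eqP; rewrite oner_eq0.
Qed.

(** By Dickson's lemma two of infinitely many degrees in a class would differ by a
    nonzero degree orthogonal to all weights. *)
Lemma finite_class (l : hdual) : finite_set [set m : N | Rad (rootN m - l)]%classic.
Proof.
apply: contrapT => /dickson[m [n [/= Rm Rn mn le]]]; apply: mn.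
pose d : N := [ffun i => (n i - m i)%N].
have nE : n = [ffun i => (m i + d i)%N] :> N.
  by apply/ffunP => i; rewrite !ffunE subnKC.
suff /rootN_Rad d0 : Rad (rootN d).
  by rewrite nE; apply/ffunP => i; rewrite d0 !ffunE addn0.
have -> : rootN d = (rootN n - l) - (rootN m - l).
  by rewrite nE rootND opprB addrA subrK addrC addKr.
by apply: RadD => //; exact: RadN.
Qed.

(** ** A total order on weights for which positive sums of roots are positive *)

(** Extend the cone of degrees modulo [Rad], in which only [Rad] has opposite
    elements by [rootN_Rad]. *)
Lemma weight_order : exists M : hdual -> Prop,
  [/\ add_closed M, forall l, M l -> M (- l) -> Rad l, forall l, Rad l -> M l,
      forall l, M l \/ M (- l) & forall m, M (rootN m)].
Proof.
pose C l := exists m, Rad (l - rootN m).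
have [| | | | |M [CM MD Mpr Mtot]] := @total_cone _ (@Rad R D) C.
- exact: Rad_iso.
- exact: Rad0.
- by move=> l Rl; exists [ffun=> 0%N]; rewrite rootN0 subr0.
- move=> l m [i hi] [j hj]; exists [ffun k => (i k + j k)%N].
  by rewrite rootND opprD addrACA; exact: RadD.
- move=> l [i hi] [j hj].
  have /rootN_Rad/ffunP ij : Rad (rootN [ffun k => (i k + j k)%N]).
    rewrite rootND; have := RadN (RadD hi hj).
    by rewrite addrACA subrr add0r -opprD opprK.
  have i0 : i = [ffun=> 0%N].
    apply/ffunP => k; have /eqP := ij k.
    by rewrite !ffunE addn_eq0 => /andP[/eqP].
  by move: hi; rewrite i0 rootN0 subr0.
exists M; split=> // [l Rl|m]; apply: CM.
- by exists [ffun=> 0%N]; rewrite rootN0 subr0.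
- by exists m; rewrite subrr; exact: Rad0.
Qed.

(** ** The braiding form on weight coefficients *)

(** The canonical elements and the form have their two legs exchanged for [false],
    so that the first leg always lies in the half [halfU sg]; this covers [r] and
    [rbar21] at once. *)
Definition theta (sg : bool) (n : N) : seq (U * U) :=
  if sg then Theta n else [seq (t.2, t.1) | t <- Theta n].
Definition rr (sg : bool) (c d : B) : K := if sg then r c d else r d c.
Definition theta_sum (sg : bool) (s : seq N) (Z : nmodType) (F : U -> U -> Z) : Z :=
  \sum_(n <- s) \sum_(t <- theta sg n) F t.1 t.2.

Lemma theta_sumN sg s (Z : nmodType) (F : U -> U -> Z) :
  theta_sum (~~ sg) s F = theta_sum sg s (fun u u' => F u' u).
Proof. by apply: eq_bigr => n _; case: sg; rewrite /= big_map. Qed.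

Lemma rr_bil sg : bilinear_map (rr sg : B -> B -> K^o).
Proof.
by have rb := rform_bil hr; case: sg => //; split=> x; [exact: (bil2 rb)|exact: (bil1 rb)].
Qed.

Lemma theta_half sg n t : t \in theta sg n -> halfU sg t.1 /\ halfU (~~ sg) t.2.
Proof.
case: sg => [|/mapP[{}t + ->]]; move=> /(Theta_half) [h1 h2] //.
Qed.

Lemma theta_homog sg n t : t \in theta sg n ->
  homog (signed sg (rootN n)) t.1 /\ homog (- signed sg (rootN n)) t.2.
Proof.
case: sg => [|/mapP[{}t + ->]]; move=> /(Theta_homog) [h1 h2] //.
by rewrite /= opprK.
Qed.

(** A degree that contributes takes the weight of [v] to one of the finitely many
    weights of [V]. *)
Lemma braiding_support (V W : Uq_module D) (f : mod_dual V) (g : mod_dual W) (v : V) (w : W)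
    (l m : hdual) : type_one V -> has_weight v l -> 
  eventually (fun s => braiding_coef Theta f g v w l m =
    qpow D (- form l m) * theta_sum true s (fun u u' => f (act u v) * g (act u' w))).
Proof.
move=> V1 hv; have [L LP] := type_one_weights V1; have [Pl _] := hv.
pose F n := \sum_(p <- Theta n) g (act p.2 w) * f (act p.1 v).
have fin : finite_set [set n | F n <> 0]%classic.
  have : finite_set (\bigcup_(l' in [set` L]) [set n : N | Rad (rootN n - (l' - l))])%classic.
    by apply: bigcup_finite => // l' _; exact: finite_class.
  apply: sub_finite_set => n /= Fn.
  have [t tn tv] : exists2 t, t \in Theta n & act t.1 v <> 0.
    apply: contrapT => h; apply: Fn; rewrite /F big_seq big1 // => t tn.
    have -> : act t.1 v = 0 by apply: contrapT => h'; apply: h; exists t.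
    by rewrite linear0 mulr0.
  have [ht _] := Theta_homog tn.
  have [l' l'L hl'] := LP _ _ (wtPD (wtP_rootN n) Pl) tv (act_homog (wtP_rootN n) ht hv).
  by exists l' => //=; rewrite opprB addrA.
have /finite_seqP[s sE] := fin.
exists s => s' us ss; rewrite /braiding_coef; congr (_ * _).
rewrite (fsbigE s') //=; last first.
  move=> n _ ns; apply: contrapT => Fn; case/negP: ns; apply: ss.
  by have : [set` s]%classic n by rewrite -sE.
rewrite /theta_sum; apply: eq_big => [n|n _]; first by rewrite in_setT.
by apply: eq_bigr => p _; rewrite mulrC.
Qed.

Definition weight_coef (l : hdual) (c : B) := wtP l /\
  exists (V : Uq_module D) (f : mod_dual V) (v : V),
    [/\ type_one V, has_weight v l & ev c = matrix_coef f v].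

Lemma weight_coef_tau l c u m : weight_coef l c -> wtP m ->
  ev c (u * tau m) = chi m l * ev c u.
Proof.
move=> [Pl [V [f [v [V1 hv ->]]]]] Pm; rewrite /matrix_coef actM.
by have [_ h] := hv; rewrite h // (islinZ _ _ (act_lin2 _)) linearZ.
Qed.

Lemma ev_lin1 u : islin ((fun b => ev b u) : B -> K^o).
Proof. exact: (ev_scalar hB u). Qed.

Lemma weight_coef_decomposition (c : B) : sum_of (fun x => exists l, weight_coef l x) c.
Proof.
have [n [z [d [dP evc]]]] := (ev_image hB (ev c)).1 (ex_intro _ c erefl).
have mc (V : Uq_module D) (f : mod_dual V) (v : V) : type_one V -> exists b, ev b = matrix_coef f v.
  move=> V1; apply/(ev_image hB); exists 1%N, (fun=> 1), (fun=> matrix_coef f v); split.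
    by move=> _; exists V; split=> //; exists f, v.
  by move=> u; rewrite big_ord1 mul1r.
have dc i : exists2 b, sum_of (fun x => exists l, weight_coef l x) b & ev b = d i.
  have [V [V1 [f [v ->]]]] := dP i.
  have [s sP vE] := type_one_decomposition v V1.
  have [bb bbP] := @choice V B (fun x b => ev b = matrix_coef f x) (fun x => mc V f x V1).
  exists (\sum_(x <- s) bb x).
    rewrite big_seq; apply: big_ind => [|x y|x xs]; [exact: sum_of0|exact: sum_ofD|].
    apply: sum_of1; have [l hl] := sP x xs; exists l; split; first by have [] := hl.
    by exists V, f, x.
  apply/funext => u; rewrite (islin_suml _ _ (ev_lin1 u)) /matrix_coef vE.
  rewrite (islin_suml _ _ (act_lin2 _)) linear_sum; apply: eq_bigr => x _.
  by rewrite bbP.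
have [db dbP] := @choice 'I_n B (fun i b => sum_of (fun x => exists l, weight_coef l x) b /\ ev b = d i)
  (fun i => let: ex_intro2 b h1 h2 := dc i in ex_intro _ b (conj h1 h2)).
have -> : c = \sum_i z i *: db i.
  apply: (ev_inj hB); apply/funext => u; rewrite evc (islin_suml _ _ (ev_lin1 u)).
  apply: eq_bigr => i _; rewrite (islinZ _ _ (ev_lin1 u)); have [_ ->] := dbP i.
  by [].
apply: sum_of_sum => i; have [h _] := dbP i.
apply: (sum_of_map (f := fun x => z i *: x)) h; first by apply: islin_scaler; exact: islin_id.
move=> x [l [Pl [V [f [v [V1 [_ hv] xE]]]]]]; exists l; split=> //.
exists V, f, (z i *: v); split=> //.
  by split=> // m Pm; rewrite (islinZ _ _ (act_lin2 _)) hv // !scalerA mulrC.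
apply/funext => u; rewrite (islinZ _ _ (ev_lin1 u)) xE /matrix_coef.
by rewrite (islinZ _ _ (act_lin2 _)) linearZ.
Qed.

Lemma ev_lin2 b : islin (ev b : U -> K^o).
Proof.
have [s sP ->] := weight_coef_decomposition b => c u v.
rewrite !(islin_suml _ _ (ev_lin1 _)) scaler_sumr -big_split /= big_seq [RHS]big_seq.
apply: eq_bigr => x /sP[l [_ [V [f [w [_ _ ->]]]]]]; exact: matrix_coef_lin.
Qed.

Lemma rr_weight_coef sg l m c d : weight_coef l c -> weight_coef m d ->
  eventually (fun s => rr sg c d =
    qpow D (- form l m) * theta_sum sg s (fun u u' => ev c u * ev d u')).
Proof.
have key l' m' c' d' : weight_coef l' c' -> weight_coef m' d' ->
    eventually (fun s => r c' d' =
      qpow D (- form l' m') * theta_sum true s (fun u u' => ev c' u * ev d' u')).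
  move=> [Pl [V [f [v [V1 hv cE]]]]] [Pm [W [g [w [W1 hw dE]]]]].
  by rewrite (hrTheta V1 W1 hv hw cE dE) cE dE; exact: braiding_support.
move=> hc hd; case: sg; first exact: key.
apply: eventuallyS (key _ _ _ _ hd hc) => s /= ->.
rewrite wformC -[true]/(~~ false) theta_sumN; congr (_ * _).
by apply: eq_bigr => n _; apply: eq_bigr => t _; rewrite mulrC.
Qed.

Lemma theta_sum_add sg s (Z : nmodType) I (l : seq I) (F : I -> U -> U -> Z) :
  \sum_(i <- l) theta_sum sg s (F i) = theta_sum sg s (fun u u' => \sum_(i <- l) F i u u').
Proof.
rewrite /theta_sum exchange_big; apply: eq_bigr => n _.
by rewrite exchange_big.
Qed.

Lemma theta_sum_lin sg s (Z Z' : lmodType K) (f : Z -> Z') (F : U -> U -> Z) : islin f ->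
  f (theta_sum sg s F) = theta_sum sg s (fun u u' => f (F u u')).
Proof.
move=> fl; rewrite (islin_suml _ _ fl); apply: eq_bigr => n _.
by rewrite (islin_suml _ _ fl).
Qed.

Lemma theta_sum_mull sg s (c : K) (F : U -> U -> K) :
  c * theta_sum sg s F = theta_sum sg s (fun u u' => c * F u u').
Proof. by rewrite mulr_sumr; apply: eq_bigr => n _; rewrite mulr_sumr. Qed.

Lemma eq_theta_sum sg s (Z : nmodType) (F G : U -> U -> Z) :
  (forall u u', F u u' = G u u') -> theta_sum sg s F = theta_sum sg s G.
Proof. by move=> FG; apply: eq_bigr => n _; apply: eq_bigr => t _. Qed.

(** In degree zero both halves consist of constants, and the canonical element
    pairs to [1] with the counit, so that it acts as the identity. *)
Lemma theta_sum_split sg s (Z : lmodType K) (F : U -> U -> Z) :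
  uniq s -> [ffun=> 0%N] \in s -> bilinear_map F ->
  theta_sum sg s F = F 1 1 +
    \sum_(n <- s | n != [ffun=> 0%N]) \sum_(t <- theta sg n) F t.1 t.2.
Proof.
move=> us s0 Fb; rewrite /theta_sum (bigD1_seq _ s0 us) /=; congr (_ + _).
have R0 : Rad (rootN [ffun=> 0%N]) by rewrite rootN0; exact: Rad0.
have h0 : signed sg (rootN [ffun=> 0%N]) = 0.
  by rewrite rootN0; case: (sg); rewrite /= ?oppr0.
have noRad := rootN_Rad.
transitivity (\sum_(t <- theta sg [ffun=> 0%N]) (counit H t.1 * counit H t.2) *: F 1 1).
  rewrite big_seq [RHS]big_seq; apply: eq_bigr => t tt.
  have [t1 t2] := theta_half tt; have := theta_homog tt; rewrite h0 oppr0 => -[g1 g2].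
  rewrite {1}(half_const H noRad t1 g1) {1}(half_const H noRad t2 g2).
  by rewrite (islinZ _ _ (bil1 Fb _)) (islinZ _ _ (bil2 Fb _)) scalerA.
rewrite -scaler_suml (_ : \sum_(_ <- _) _ = 1) ?scale1r //.
rewrite -(Theta_eps R0) /theta; case: (sg) => //.
by rewrite big_map; apply: eq_bigr => t _; rewrite mulrC.
Qed.

Lemma theta_eps sg n t : n != [ffun=> 0%N] -> t \in theta sg n -> counit H t.2 = 0.
Proof.
move=> n0 /theta_homog[_ h]; apply: (eps_homog hH _ h).
  exact/wtPN/wtP_signed/wtP_rootN.
move=> /RadN; rewrite opprK => /Rad_signed /(rootN_Rad) e.
by rewrite e eqxx in n0.
Qed.

(** ** The form with one argument at a fixed weight *)

(** Decompose [d] into weight coefficients: the torus factor of the form becomes an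
    element of the torus in the argument of [d], which makes sense for all [d]. *)
Lemma rr_weight_left sg l c d : weight_coef l c ->
  eventually (fun s => rr sg c d = theta_sum sg s (fun u u' => ev c u * ev d (u' * tau (- l)))).
Proof.
move=> hc; have [Pl _] := hc; have [t tP ->] := weight_coef_decomposition d.
have h := @eventually_all N _ t
  (fun x s => rr sg c x = theta_sum sg s (fun u u' => ev c u * ev x (u' * tau (- l)))).
apply: eventuallyS (h _) => [s {}h|x xt].
  rewrite (islin_suml _ _ (bil2 (rr_bil sg) c)) big_seq.
  under eq_bigr do rewrite h //.
  rewrite -big_seq theta_sum_add; apply: eq_theta_sum => u u'.
  by rewrite -mulr_sumr (islin_suml _ _ (ev_lin1 _)).
have [m hx] := tP x xt; have [Pm _] := hx.
apply: eventuallyS (rr_weight_coef sg hc hx) => s ->; rewrite theta_sum_mull.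
apply: eq_theta_sum => u u'; rewrite (weight_coef_tau _ hx); last exact: wtPN.
by rewrite mulrCA /chi [form (- l) m]wformC wformNr wformC.
Qed.

Lemma rr_weight_right sg m c d : weight_coef m d ->
  eventually (fun s => rr sg c d = theta_sum sg s (fun u u' => ev c (u * tau (- m)) * ev d u')).
Proof.
move=> hd; have -> : rr sg c d = rr (~~ sg) d c by case: (sg).
apply: eventuallyS (rr_weight_left (~~ sg) c hd) => s ->.
by rewrite theta_sumN; apply: eq_theta_sum => u u'; rewrite mulrC.
Qed.

(** * The two actions on a comodule algebra *)

Section Comodule.
Variables (A : algType K) (BA : bialgebra A).
Variables (Psi : A -> B) (hPsi : bialgebra_hom BA HB Psi).

Local Notation cop := (cop BA).

Lemma Psi_lin : islin Psi. Proof. by case: hPsi. Qed.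

Lemma Psi_sweedler (Z : lmodType K) (f : B -> B -> Z) a : bilinear_map f ->
  \sum_(p <- Defs.cop HB (Psi a)) f p.1 p.2 = \sum_(p <- cop a) f (Psi p.1) (Psi p.2).
Proof. by case: hPsi => _ _ h _ fb; rewrite (h a _ f fb) big_map. Qed.

Definition E (a : A) (u : U) : K := ev (Psi a) u.

Lemma E_lin1 u : islin ((fun a => E a u) : A -> K^o).
Proof. exact: (islin_comp (ev_lin1 u) Psi_lin). Qed.

Lemma E_lin2 a : islin (E a : U -> K^o).
Proof. exact: ev_lin2. Qed.

Lemma E_comul a u u' : E a (u * u') = \sum_(p <- cop a) E p.1 u * E p.2 u'.
Proof.
rewrite /E (ev_cop hB) (@Psi_sweedler K^o (fun x y => ev x u * ev y u')) //.
by split=> x; [apply: islin_kmull|apply: islin_kmulr]; exact: ev_lin1.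
Qed.

Lemma E_mul a b u : E (a * b) u = \sum_(p <- Defs.cop H u) E a p.1 * E b p.2.
Proof. by case: hPsi => _ [_ h] _ _; rewrite /E h (evM hB). Qed.

Lemma E_eps a : E a 1 = counit BA a.
Proof. by case: hPsi => _ _ _ h; rewrite -h (ev_counit hB). Qed.

(** The right and the left action of [U] dual to the coactions of [A] through
    [Psi]. *)
Definition ra (u : U) (a : A) : A := \sum_(p <- cop a) E p.1 u *: p.2.
Definition la (u : U) (a : A) : A := \sum_(p <- cop a) E p.2 u *: p.1.

Lemma ra_lin u : islin (ra u).
Proof.
apply: (@sweedler_lin _ _ BA _ (fun x y => E x u *: y)).
by split=> x; lin_with ltac:(exact: E_lin1).
Qed.

Lemma la_lin u : islin (la u).
Proof.
apply: (@sweedler_lin _ _ BA _ (fun x y => E y u *: x)).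
by split=> x; lin_with ltac:(exact: E_lin1).
Qed.

Lemma ra_linu a : islin (fun u => ra u a).
Proof. by apply: islin_sum => p; apply: islin_scalel; exact: E_lin2. Qed.

Lemma la_linu a : islin (fun u => la u a).
Proof. by apply: islin_sum => p; apply: islin_scalel; exact: E_lin2. Qed.

Lemma ra1 a : ra 1 a = a.
Proof. by rewrite -[RHS](cop_counitl BA a); apply: eq_bigr => p _; rewrite E_eps. Qed.

Lemma la1 a : la 1 a = a.
Proof. by rewrite -[RHS](cop_counitr BA a); apply: eq_bigr => p _; rewrite E_eps. Qed.

Lemma sweedler_ra (Z : lmodType K) (f : A -> A -> Z) u a : bilinear_map f ->
  \sum_(p <- cop (ra u a)) f p.1 p.2 = \sum_(p <- cop a) f (ra u p.1) p.2.
Proof.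
move=> fb; rewrite (islin_suml _ _ (sweedler_lin BA fb)).
transitivity (\sum_(p <- cop a) \sum_(q <- cop p.2) E p.1 u *: f q.1 q.2).
  by apply: eq_bigr => p _; rewrite (islinZ _ _ (sweedler_lin BA fb)) scaler_sumr.
rewrite -(@sweedler_assoc _ _ BA _ (fun x y z => E x u *: f y z)); last first.
  by split=> x y; lin_with ltac:(first [exact: E_lin1|exact: bil1|exact: bil2]).
apply: eq_bigr => p _; rewrite (islin_suml _ _ (bil1 fb _)).
by apply: eq_bigr => q _; rewrite (islinZ _ _ (bil1 fb _)).
Qed.

Lemma sweedler_la (Z : lmodType K) (f : A -> A -> Z) u a : bilinear_map f ->
  \sum_(p <- cop (la u a)) f p.1 p.2 = \sum_(p <- cop a) f p.1 (la u p.2).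
Proof.
move=> fb; rewrite (islin_suml _ _ (sweedler_lin BA fb)).
transitivity (\sum_(p <- cop a) \sum_(q <- cop p.1) E p.2 u *: f q.1 q.2).
  by apply: eq_bigr => p _; rewrite (islinZ _ _ (sweedler_lin BA fb)) scaler_sumr.
rewrite (@sweedler_assoc _ _ BA _ (fun x y z => E z u *: f x y)); last first.
  by split=> x y; lin_with ltac:(first [exact: E_lin1|exact: bil1|exact: bil2]).
apply: eq_bigr => p _; rewrite (islin_suml _ _ (bil2 fb _)).
by apply: eq_bigr => q _; rewrite (islinZ _ _ (bil2 fb _)).
Qed.

Lemma E_ra u u' a : E (ra u a) u' = E a (u * u').
Proof.
rewrite E_comul (islin_suml _ _ (E_lin1 u')); apply: eq_bigr => p _.
exact: (islinZ _ _ (E_lin1 u')).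
Qed.

Lemma E_la u u' a : E (la u a) u' = E a (u' * u).
Proof.
rewrite E_comul (islin_suml _ _ (E_lin1 u')); apply: eq_bigr => p _.
by rewrite mulrC; exact: (islinZ _ _ (E_lin1 u')).
Qed.

Lemma raM u u' a : ra u' (ra u a) = ra (u * u') a.
Proof.
rewrite [LHS](@sweedler_ra _ (fun x y => E x u' *: y)); last first.
  by split=> x; lin_with ltac:(exact: E_lin1).
by apply: eq_bigr => p _; rewrite E_ra.
Qed.

Lemma laM u u' a : la u (la u' a) = la (u * u') a.
Proof.
rewrite [LHS](@sweedler_la _ (fun x y => E y u *: x)); last first.
  by split=> x; lin_with ltac:(exact: E_lin1).
by apply: eq_bigr => p _; rewrite E_la.
Qed.

Lemma la_ra u u' a : la u (ra u' a) = ra u' (la u a).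
Proof.
rewrite [LHS](@sweedler_ra _ (fun x y => E y u *: x)); last first.
  by split=> x; lin_with ltac:(exact: E_lin1).
rewrite [RHS](@sweedler_la _ (fun x y => E x u' *: y)); last first.
  by split=> x; lin_with ltac:(exact: E_lin1).
transitivity (\sum_(p <- cop a) \sum_(q <- cop p.1) (E p.2 u * E q.1 u') *: q.2).
  by apply: eq_bigr => p _; rewrite scaler_sumr; apply: eq_bigr => q _; rewrite scalerA.
rewrite (@sweedler_assoc _ _ BA _ (fun x y z => (E z u * E x u') *: y)); last first.
  by split=> x y; lin_with ltac:(exact: E_lin1).
apply: eq_bigr => p _; rewrite scaler_sumr; apply: eq_bigr => q _.
by rewrite scalerA mulrC.
Qed.

Lemma ra_mul u a b : ra u (a * b) = \sum_(p <- Defs.cop H u) ra p.1 a * ra p.2 b.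
Proof.
rewrite [LHS](@sweedler_mul _ _ BA _ (fun x y => E x u *: y)); last first.
  by split=> x; lin_with ltac:(exact: E_lin1).
transitivity (\sum_(p <- cop a) \sum_(q <- cop b) \sum_(t <- Defs.cop H u)
    (E p.1 t.1 *: p.2) * (E q.1 t.2 *: q.2)).
  apply: eq_bigr => p _; apply: eq_bigr => q _; rewrite E_mul scaler_suml.
  by apply: eq_bigr => t _; rewrite -scalerAl -scalerAr scalerA.
under eq_bigr do rewrite exchange_big.
rewrite exchange_big; apply: eq_bigr => t _ /=.
by rewrite mulr_suml; apply: eq_bigr => p _; rewrite mulr_sumr.
Qed.

(** ** Weight decompositions *)

Definition rwt (l : hdual) (a : A) := wtP l /\ forall m, wtP m -> ra (tau m) a = chi m l *: a.
Definition lwt (l : hdual) (a : A) := wtP l /\ forall m, wtP m -> la (tau m) a = chi m l *: a.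

Lemma rwt_ra l l' u a : wtP l' -> homog l' u -> rwt l a -> rwt (l - l') (ra u a).
Proof.
move=> Pl' hu [Pl ha]; split=> [|m Pm]; first by apply: wtPD => //; exact: wtPN.
rewrite raM (homogR Pl' Pm hu) (islinZ _ _ (ra_linu a)) -raM ha //.
by rewrite (islinZ _ _ (ra_lin u)) scalerA chiDr // 1?mulrC //; exact: wtPN.
Qed.

Lemma lwt_la l l' u a : wtP l' -> homog l' u -> lwt l a -> lwt (l + l') (la u a).
Proof.
move=> Pl' hu [Pl ha]; split=> [|m Pm]; first exact: wtPD.
rewrite laM hu // (islinZ _ _ (la_linu a)) -laM ha //.
by rewrite (islinZ _ _ (la_lin u)) scalerA chiDr // 1?mulrC.
Qed.

Lemma lwt_ra l u a : lwt l a -> lwt l (ra u a).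
Proof.
move=> [Pl ha]; split=> // m Pm.
by rewrite la_ra ha // (islinZ _ _ (ra_lin u)).
Qed.

(** The same finitely many characters serve for all [u]; so the weights that occur in
    the orbit of a vector under the right action form a finite set. *)
Lemma E_expansion (s : seq (A * A)) : exists2 t : seq (hdual * (B * A)),
  forall i, i \in t -> wtP i.1 &
  forall u m, wtP m -> \sum_(p <- s) E p.1 (u * tau m) *: p.2 =
    \sum_(i <- t) chi m i.1 *: (ev i.2.1 u *: i.2.2).
Proof.
elim: s => [|[x y] s [t tP IH]]; first by exists [::] => // u m _; rewrite !big_nil.
have [s' sP xE] := weight_coef_decomposition (Psi x).
have [w wP] := choice_in 0 sP.
exists ([seq (w c, (c, y)) | c <- s'] ++ t).
  move=> i; rewrite mem_cat => /orP[/mapP[c cs ->]|/tP //].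
  by have [] := wP c cs.
move=> u m Pm; rewrite big_cons big_cat IH // big_map /=; congr (_ + _).
rewrite /E xE (islin_suml _ _ (ev_lin1 _)) scaler_suml big_seq [RHS]big_seq.
by apply: eq_bigr => c cs; rewrite (weight_coef_tau _ (wP c cs)) // scalerA.
Qed.

Lemma rwt_decomposition a : sum_of (fun x => exists l, rwt l x) a.
Proof.
have [t tP aE] := E_expansion (cop a).
apply: (@char_decomposition R D A (fun m => ra (tau m)) _ _ _
  [seq (i.1, ev i.2.1 1 *: i.2.2) | i <- t]).
- by move=> m; exact: ra_lin.
- by move=> m n x Pm Pn; rewrite raM tauD // addrC.
- by move=> x; rewrite tau0 ra1.
- by move=> _ /mapP[i it ->]; exact: tP.
- by move=> m Pm; rewrite big_map -aE //; apply: eq_bigr => p _; rewrite mul1r.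
Qed.

Lemma lwt_decomposition a : sum_of (fun x => exists l, lwt l x) a.
Proof.
have [t tP aE] := E_expansion [seq (p.2, p.1) | p <- cop a].
apply: (@char_decomposition R D A (fun m => la (tau m)) _ _ _
  [seq (i.1, ev i.2.1 1 *: i.2.2) | i <- t]).
- by move=> m; exact: la_lin.
- by move=> m n x Pm Pn; rewrite laM tauD.
- by move=> x; rewrite tau0 la1.
- by move=> _ /mapP[i it ->]; exact: tP.
- move=> m Pm; rewrite big_map -aE // big_map; apply: eq_bigr => p _.
  by rewrite mul1r.
Qed.

(** ** Local nilpotency *)

Definition word sg (w : seq 'I_(rank D)) : U := \prod_(i <- w) gen sg i.
Definition content (w : seq 'I_(rank D)) : N := [ffun i => count_mem i w].

Lemma homog_word sg w : homog (signed sg (rootN (content w))) (word sg w).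
Proof.
elim: w => [|i w IH]; rewrite /word ?big_nil ?big_cons.
  have -> : content [::] = [ffun=> 0%N] by apply/ffunP => i; rewrite !ffunE.
  have -> : signed sg (rootN [ffun=> 0%N]) = 0 by rewrite rootN0; case: (sg); rewrite /= ?oppr0.
  exact: homog1.
have -> : content (i :: w) = [ffun j => (rootN1 i j + content w j)%N].
  by apply/ffunP => j; rewrite !ffunE /= eq_sym.
rewrite rootND rootN1E signedD; apply: homogM (homog_gen sg i) IH.
  exact/wtP_signed/wtP_alpha.
exact/wtP_signed/wtP_rootN.
Qed.

Lemma size_content w : size w = (\sum_i content w i)%N.
Proof.
elim: w => [|i w IH]; first by rewrite big1 // => i _; rewrite ffunE.
rewrite /= IH (bigD1 i) //= [in RHS](bigD1 i) //= !ffunE /= eqxx -addnS add1n addSn addnS.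
congr (_.+1); congr addn; apply: eq_bigr => j ji.
by rewrite !ffunE /= eq_sym (negPf ji).
Qed.

(** Finitely many weights occur in the orbit of [a], and each of them is reached from
    the weight of [a] in finitely many degrees only. *)
Lemma ra_nilpotent sg l a : rwt l a ->
  exists h, forall w, (h <= size w)%N -> ra (word sg w) a = 0.
Proof.
move=> ha; have [Pl _] := ha; have [t tP aE] := E_expansion (cop a).
have fin : finite_set (\bigcup_(i in [set` t]) [set m : N | Rad (rootN m - signed sg (l - i.1))])%classic.
  by apply: bigcup_finite => // i _; exact: (finite_class).
have [s sE] := (finite_seqP _).1 fin.
exists (\max_(m <- s) \sum_i m i).+1%N => w hw.
pose l' := signed sg (rootN (content w)).
have Pl' : wtP l' by exact/wtP_signed/wtP_rootN.
have [Plw hra] : rwt (l - l') (ra (word sg w) a) by apply: (rwt_ra) (homog_word sg w) ha.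
have nin : content w \notin s.
  apply/negP => ws; have := @leq_bigmax_seq _ s xpredT (fun m : N => \sum_i m i)%N _ ws isT.
  by rewrite -size_content => /leq_ltn_trans /(_ hw); rewrite ltnn.
apply: (@dedekind R D A _ t (fun i => i.1)
  (fun i => - (ev i.2.1 (word sg w) *: i.2.2)) (l - l')) => // [i it|m Pm].
  split; first exact: tP.
  have -> : i.1 - (l - l') = signed sg (rootN (content w) - signed sg (l - i.1)).
    rewrite /l'; case: (sg) => /=; first by rewrite !opprB addrCA.
    by rewrite !opprK opprD [RHS]opprD opprB addrA addrC.
  move=> /Rad_signed Ri; case/negP: nin.
  by have : [set` s]%classic (content w) by rewrite -sE; exists i.
rewrite -hra // raM [ra _ _]aE //.
by rewrite -big_split big1 //= => i _; rewrite scalerN subrr.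
Qed.

(** ** Extremal vectors and the braiding form *)

Lemma ev_iter k d u : ev (iter k SB d) u = ev d (iter k S u).
Proof.
elim: k u => //= k IH u; rewrite (ev_antipode hB) IH.
by rewrite -iterSr.
Qed.

Lemma iterSM k u v :
  iter k S (u * v) = if odd k then iter k S v * iter k S u else iter k S u * iter k S v.
Proof.
elim: k => //= k ->; case: (odd k) => /=; exact: antipodeM.
Qed.

Lemma iterS_lin k : islin (iter k S).
Proof.
elim: k => [|k IH]; first exact: islin_id.
exact: (islin_comp (antipode_lin H) IH).
Qed.

Lemma iterS1 k : iter k S 1 = 1.
Proof. by elim: k => //= k ->; exact: antipode1. Qed.

Lemma iterS_tau k l : wtP l -> iter k S (tau l) = tau (if odd k then - l else l).
Proof.
move=> Pl; elim: k => //= k ->; rewrite (antipode_tau hH).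
  by case: (odd k) => //=; rewrite opprK.
by case: (odd k) => //; exact: wtPN.
Qed.

Lemma iterS_gen k sg i : exists c l l', [/\ wtP l, wtP l' &
  iter k S (gen sg i) = c *: (tau l * gen sg i * tau l')].
Proof.
have Pa := wtP_alpha i; have PNa := wtPN Pa; have P0 := @wtP0 R D.
elim: k => [|k [c [l [l' [Pl Pl' IH]]]]].
  by exists 1, 0, 0; split=> //; rewrite tau0 mul1r mulr1 scale1r.
have [m [m' [Pm Pm' gE]]] : exists m m', [/\ wtP m, wtP m' &
    S (gen sg i) = - (tau m * gen sg i * tau m')].
  rewrite /gen; case: (sg).
    exists (- alpha i), 0; split=> //; rewrite (antipode_x hH) tau0 mulr1 //.
  exists 0, (alpha i); split=> //; rewrite (antipode_y hH) tau0 mul1r //.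
exists (- c), (- l' + m), (m' - l); split.
- by apply: wtPD => //; exact: wtPN.
- by apply: wtPD => //; exact: wtPN.
rewrite iterS IH (islinZ _ _ (antipode_lin H)) !antipodeM gE !(antipode_tau hH) //.
rewrite -!tauD //; try exact: wtPN.
by rewrite mulNr mulrN scalerN scaleNr !mulrA.
Qed.

(** The elements of which [b] is an eigenvector form an algebra, which contains the
    torus and the images of the generators under powers of the antipode. *)
Lemma extremal_iter sg kap b k u l : rwt kap b -> (forall i, ra (gen sg i) b = 0) ->
  halfU sg u -> wtP l ->
  ra (iter k S (u * tau l)) b = (eps u * chi l (if odd k then - kap else kap)) *: b.
Proof.
move=> [Pk hb] ext hu Pl.
have eigM v v' e e' : ra v b = e *: b -> ra v' b = e' *: b -> ra (v * v') b = (e * e') *: b.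
  by move=> h h'; rewrite -raM h (islinZ _ _ (ra_lin v')) h' scalerA.
have eigS v e : ra (iter k S v) b = e *: b ->
    ra (iter k S (v * tau l)) b = (e * chi l (if odd k then - kap else kap)) *: b.
  move=> h; have t : ra (iter k S (tau l)) b = chi l (if odd k then - kap else kap) *: b.
    rewrite iterS_tau // hb; last by case: (odd k) => //; exact: wtPN.
    by case: (odd k); rewrite // chiNl // chiNr.
  by rewrite iterSM; case: ifP => odk; rewrite odk in t; [rewrite mulrC|]; exact: eigM.
apply: eigS; rewrite halfUP in hu.
elim: hu => {u} [u [i ->]||c u _ IH|u v _ IHu _ IHv|u v _ IHu _ IHv].
- rewrite (eps_gen hH) scale0r; have [c [m [m' [Pm Pm' ->]]]] := iterS_gen k sg i.
  rewrite (islinZ _ _ (ra_linu b)) -!raM hb // (islinZ _ _ (ra_lin _)) ext scaler0.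
  by rewrite (islin0 (ra_lin _)) scaler0.
- by rewrite iterS1 counit1 scale1r ra1.
- by rewrite (islinZ _ _ (iterS_lin k)) (islinZ _ _ (ra_linu b)) IH epsZ scalerA.
- rewrite (islinD _ _ (iterS_lin k)) (islinD _ _ (ra_linu b)) IHu IHv.
  by rewrite (islinD _ _ (eps_lin H)) scalerDl.
- by rewrite iterSM counitM; case: ifP => _; [rewrite mulrC|]; exact: eigM.
Qed.

(** The canonical element of a nonzero degree has its second leg in the kernel of the
    counit, and therefore kills [b]; what is left is the torus factor. *)
Lemma form_extremal sg kap b k c : rwt kap b -> (forall i, ra (gen (~~ sg) i) b = 0) ->
  \sum_(q <- cop b) rr sg c (iter k SB (Psi q.1)) *: q.2 =
  ev c (tau (if odd k then kap else - kap)) *: b.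
Proof.
move=> hb ext; have [Pk _] := hb; have [t tP cE] := weight_coef_decomposition c.
have [w wP] := choice_in 0 tP.
have ev_s : eventually (fun s : seq N => forall x, x \in t -> forall q, q \in cop b ->
    rr sg x (iter k SB (Psi q.1)) = theta_sum sg s
      (fun u u' => ev x u * ev (iter k SB (Psi q.1)) (u' * tau (- w x)))).
  apply: eventually_all => x xt; apply: eventually_all => q _.
  exact: (rr_weight_left sg _ (wP x xt)).
have [s [us s0 sE]] := eventually_ex [ffun=> 0%N] ev_s.
have rb := rr_bil sg.
transitivity (\sum_(x <- t) \sum_(q <- cop b) rr sg x (iter k SB (Psi q.1)) *: q.2).
  rewrite exchange_big; apply: eq_bigr => q _ /=.
  by rewrite [in LHS]cE (islin_suml _ _ (bil1 rb _)) scaler_suml.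
rewrite [in RHS]cE (islin_suml _ _ (ev_lin1 _)) scaler_suml.
rewrite big_seq [RHS]big_seq; apply: eq_bigr => x xt.
have hx := wP x xt; have [Pw _] := hx; have PNw := wtPN Pw.
transitivity (theta_sum sg s (fun u u' => ev x u *: ra (iter k S (u' * tau (- w x))) b)).
  transitivity (\sum_(q <- cop b) theta_sum sg s (fun u u' =>
      (ev x u * ev (iter k SB (Psi q.1)) (u' * tau (- w x))) *: q.2)).
    rewrite big_seq [RHS]big_seq; apply: eq_bigr => q qb; rewrite sE //.
    exact: (@theta_sum_lin sg s (K^o) A (fun z => (z : K) *: q.2)
       _ (islin_scalel _ (@islin_id _ _))).
  rewrite theta_sum_add; apply: eq_theta_sum => u u'.
  rewrite /ra scaler_sumr; apply: eq_bigr => q _.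
  by rewrite scalerA ev_iter.
rewrite (theta_sum_split sg us s0); last first.
  split=> [v|v]; first by apply: islin_scalel; exact: ev_lin2.
  apply: islin_scaler; apply: (islin_comp (ra_linu b)).
  by apply: (islin_comp (iterS_lin k)); apply: islin_mull; exact: islin_id.
rewrite big1 ?addr0 => [|n n0].
  rewrite (extremal_iter k hb ext) //; last by rewrite halfUP; exact: gen_one.
  rewrite counit1 mul1r -[tau _]mul1r (weight_coef_tau _ hx); last first.
    by case: (odd k) => //; exact: wtPN.
  rewrite scalerA mulrC; congr (_ * _ *: _).
  by rewrite chiC; case: (odd k); rewrite ?chiNr ?chiNl ?invrK //; exact: wtPN.
rewrite big_seq big1 // => u un.
have [_ h2] := theta_half un.
rewrite (extremal_iter k hb ext) // (theta_eps n0 un).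
by rewrite mul0r scale0r scaler0.
Qed.

(** As [a] is a left weight vector, the torus factors that belong to the weight
    coefficients of [d] can be gathered into one element of the torus acting on
    [d]. *)
Lemma form_weight1 sg lam a d : lwt lam a ->
  eventually (fun s => \sum_(p <- cop a) rr sg (Psi p.2) d *: p.1 =
    theta_sum sg s (fun u u' => ev d (u' * tau (- lam)) *: la u a)).
Proof.
move=> [Pl ha]; have [t tP dE] := weight_coef_decomposition d.
have [w wP] := choice_in 0 tP; have rb := rr_bil sg.
have ev_s : eventually (fun s : seq N => forall x, x \in t -> forall p, p \in cop a ->
    rr sg (Psi p.2) x = theta_sum sg s (fun u u' => ev (Psi p.2) (u * tau (- w x)) * ev x u')).
  apply: eventually_all => x xt; apply: eventually_all => p _.
  exact: (rr_weight_right sg _ (wP x xt)).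
apply: eventuallyS ev_s => s sE.
transitivity (\sum_(x <- t) \sum_(p <- cop a) rr sg (Psi p.2) x *: p.1).
  rewrite exchange_big; apply: eq_bigr => q _ /=.
  by rewrite [in LHS]dE (islin_suml _ _ (bil2 rb _)) scaler_suml.
transitivity (theta_sum sg s (fun u u' => \sum_(x <- t) ev x (u' * tau (- lam)) *: la u a)); last first.
  apply: eq_theta_sum => u u'.
  by rewrite [in RHS]dE (islin_suml _ _ (ev_lin1 _)) scaler_suml.
rewrite -theta_sum_add big_seq [RHS]big_seq; apply: eq_bigr => x xt.
have hx := wP x xt; have [Pw _] := hx.
transitivity (\sum_(p <- cop a) theta_sum sg s (fun u u' =>
    (ev (Psi p.2) (u * tau (- w x)) * ev x u') *: p.1)).
  rewrite big_seq [RHS]big_seq; apply: eq_bigr => p pa; rewrite sE //.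
  exact: (@theta_sum_lin sg s (K^o) A (fun z => (z : K) *: p.1)
     _ (islin_scalel _ (@islin_id _ _))).
rewrite theta_sum_add; apply: eq_theta_sum => u u'.
rewrite (weight_coef_tau _ hx); last exact: wtPN.
transitivity (ev x u' *: la (u * tau (- w x)) a).
  by rewrite /la scaler_sumr; apply: eq_bigr => p _; rewrite scalerA mulrC.
rewrite -laM ha; last exact: wtPN.
rewrite (islinZ _ _ (la_lin u)) scalerA mulrC; congr (_ * _ *: _).
by rewrite !chiNl // chiC.
Qed.

Lemma form_weight sg lam a b k (G : A -> A -> A) : lwt lam a -> bilinear_map G ->
  eventually (fun s => \sum_(p <- cop a) \sum_(q <- cop b)
      rr sg (Psi p.2) (iter k SB (Psi q.1)) *: G p.1 q.2 =
    theta_sum sg s (fun u u' => G (la u a) (ra (iter k S (u' * tau (- lam))) b))).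
Proof.
move=> ha Gb.
have ev_s : eventually (fun s => forall q, q \in cop b ->
   \sum_(p <- cop a) rr sg (Psi p.2) (iter k SB (Psi q.1)) *: p.1 =
    theta_sum sg s (fun u u' => ev (iter k SB (Psi q.1)) (u' * tau (- lam)) *: la u a)).
  by apply: eventually_all => q _; exact: form_weight1.
apply: eventuallyS ev_s => s sE.
rewrite exchange_big.
transitivity (\sum_(q <- cop b) theta_sum sg s (fun u u' =>
    ev (iter k SB (Psi q.1)) (u' * tau (- lam)) *: G (la u a) q.2)).
  rewrite big_seq [RHS]big_seq; apply: eq_bigr => q qb.
  transitivity (G (\sum_(p <- cop a) rr sg (Psi p.2) (iter k SB (Psi q.1)) *: p.1) q.2).
    rewrite (islin_suml _ _ (bil1 Gb _)); apply: eq_bigr => p _.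
    by rewrite (islinZ _ _ (bil1 Gb _)).
  rewrite sE // (theta_sum_lin _ _ _ (bil1 Gb q.2)); apply: eq_theta_sum => u u'.
  by rewrite (islinZ _ _ (bil1 Gb _)).
rewrite theta_sum_add; apply: eq_theta_sum => u u'.
rewrite /ra (islin_suml _ _ (bil2 Gb _)); apply: eq_bigr => q _.
by rewrite (islinZ _ _ (bil2 Gb _)) ev_iter.
Qed.

(** * Lowering a pair of zero divisors *)

Section Lowering.
Variables (sg : bool) (F : A -> A -> A).
Hypothesis Fb : bilinear_map F.
Local Notation z := (gen sg).
Hypothesis Fskew : forall i l l' a b, rwt l a -> rwt l' b ->
  exists y y', [/\ exponent D y, exponent D y' &
    ra (z i) (F a b) = qpow D y *: F (ra (z i) a) b + qpow D y' *: F a (ra (z i) b)].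

Let raX i n a : ra (z i ^+ n.+1) a = ra (z i) (ra (z i ^+ n) a).
Proof. by rewrite raM exprSr. Qed.

Lemma rwt_pow i n l a : rwt l a -> exists l', rwt l' (ra (z i ^+ n) a).
Proof.
move=> ha; elim: n => [|n [l' IH]]; first by exists l; rewrite expr0 ra1.
exists (l' - signed sg (alpha i)); rewrite raX; apply: (rwt_ra) IH.
  exact/wtP_signed/wtP_alpha.
exact: homog_gen.
Qed.

(** The coefficients are q-binomial; they do not vanish because the recursion that
    defines them keeps their values at [1] positive. *)
Lemma skew_leibniz i n l l' a b : rwt l a -> rwt l' b ->
  exists2 C : nat -> K, forall k, (k <= n)%N -> lpos (C k) &
    ra (z i ^+ n) (F a b) =
    \sum_(k < n.+1) C k *: F (ra (z i ^+ k) a) (ra (z i ^+ (n - k)) b).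
Proof.
move=> ha hb; elim: n => [|n [C Cpos IH]].
  exists (fun=> 1); first by move=> *; exact: lpos1.
  by rewrite big_ord1 subnn !expr0 !ra1 scale1r.
have step k : exists yy : R[i] * R[i], [/\ exponent D yy.1, exponent D yy.2 &
    ra (z i) (F (ra (z i ^+ k) a) (ra (z i ^+ (n - k)) b)) =
    qpow D yy.1 *: F (ra (z i ^+ k.+1) a) (ra (z i ^+ (n - k)) b) +
    qpow D yy.2 *: F (ra (z i ^+ k) a) (ra (z i ^+ (n - k).+1) b)].
  have [m hm] := rwt_pow i k ha; have [m' hm'] := rwt_pow i (n - k) hb.
  have [y [y' [ey ey' e]]] := Fskew i hm hm'.
  by exists (y, y'); split=> //; rewrite e !raX.
have [yy yyP] := choice step.
pose C1 k := if k is k'.+1 then qpow D (yy k').1 * C k' else 0.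
pose C2 k := if (k <= n)%N then qpow D (yy k).2 * C k else 0.
exists (fun k => C1 k + C2 k).
  move=> [|k] kn; rewrite /C1 /C2 /=.
    by have [_ e2 _] := yyP 0%N; rewrite add0r; apply: lpos_qpow => //; exact: Cpos.
  have [e1 _ _] := yyP k; case: ifP => kn'; last by rewrite addr0; apply: lpos_qpow => //; exact: Cpos.
  have [_ e2 _] := yyP k.+1.
  by apply: lposD; apply: lpos_qpow => //; exact: Cpos.
rewrite raX IH (islin_suml _ _ (ra_lin _)).
under eq_bigr => k _.
  have [_ _ e] := yyP k; rewrite (islinZ _ _ (ra_lin _)) e scalerDr !scalerA; over.
rewrite big_split /=; under [RHS]eq_bigr do rewrite scalerDl.
rewrite [RHS]big_split /=; congr (_ + _).
  rewrite [RHS]big_ord_recl scale0r add0r; apply: eq_bigr => k _.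
  by rewrite /= mulrC subSS.
rewrite [RHS]big_ord_recr /= {2}/C2 ltnn scale0r addr0; apply: eq_bigr => k _.
have kn : (k <= n)%N by rewrite -ltnS.
by rewrite /C2 kn mulrC subSn.
Qed.

Lemma last_power i a : a != 0 -> (exists h, ra (z i ^+ h) a = 0) ->
  exists n, [/\ ra (z i ^+ n) a != 0, ra (z i) (ra (z i ^+ n) a) = 0 &
    forall k, (n < k)%N -> ra (z i ^+ k) a = 0].
Proof.
move=> a0 [h ha].
have ex : exists h, ra (z i ^+ h) a == 0 by exists h; apply/eqP.
case: (ex_minnP ex) => -[|n] /eqP n0 nmin.
  by case/eqP: a0; rewrite -n0 expr0 ra1.
exists n; split; first by apply/negP => /nmin; rewrite ltnn.
  by rewrite -raX.
move=> k nk; rewrite -(subnK nk) addnC exprD -raM n0.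
exact: (islin0 (ra_lin _)).
Qed.

Let nil h a := forall w, (h <= size w)%N -> ra (word sg w) a = 0.

Lemma word_nseq (i : 'I_(rank D)) n : word sg (nseq n i) = z i ^+ n.
Proof. by rewrite /word big_nseq; elim: n => //= n ->; rewrite exprS. Qed.

Lemma word_cat (w w' : seq 'I_(rank D)) : word sg (w ++ w') = word sg w * word sg w'.
Proof. by rewrite /word big_cat. Qed.

(** A common power of a generator takes a pair of zero divisors to the pair of
    their last nonzero translates, since all the other terms of the Leibniz
    formula vanish; this can be repeated only finitely often. *)
Lemma extremal_zero_divisor l l' a b : rwt l a -> rwt l' b -> a != 0 -> b != 0 ->
  F a b = 0 ->
  exists m a' b', [/\ rwt m b', a' != 0, b' != 0, F a' b' = 0 &
    forall i, ra (z i) b' = 0].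
Proof.
move=> ha hb a0 b0 Fab.
have [h hna] := ra_nilpotent sg ha.
have [h' hnb] := ra_nilpotent sg hb.
have {}hna : nil h a by [].
have {}hnb : nil h' b by [].
have [n] := ubnP (h + h'); elim: n h h' l l' a b ha hb a0 b0 Fab hna hnb => // n IH.
move=> h h' l l' a b ha hb a0 b0 Fab hna hnb /ltnSE hn.
have [ext|] := pselect (forall i, ra (z i) b = 0); first by exists l', a, b.
move=> next; have [i zb] : exists i, ra (z i) b <> 0.
  by apply: contrapT => hh; apply: next => i; apply: contrapT => ?; apply: hh; exists i.
have nilz k x : nil k x -> exists k, ra (z i ^+ k) x = 0.
  by move=> kx; exists k; rewrite -word_nseq kx // size_nseq.
have [p [ap zap apk]] := last_power a0 (nilz _ _ hna).
have [q [bq zbq bqk]] := last_power b0 (nilz _ _ hnb).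
have q0 : (0 < q)%N.
  by case: q bq zbq bqk => // _ zb0 _; case: zb; move: zb0; rewrite expr0 ra1.
have nil_pow k x j : ra (z i ^+ j) x != 0 -> nil k x -> (j < k)%N /\ nil (k - j) (ra (z i ^+ j) x).
  move=> xj kx; have jk : (j < k)%N.
    rewrite ltnNge; apply/negP => kj; case/eqP: xj.
    by rewrite -word_nseq kx // size_nseq.
  split=> // w kw; rewrite raM -word_nseq -word_cat kx //.
  by rewrite size_cat size_nseq -leq_subLR.
have [ph nila] := nil_pow _ _ _ ap hna; have [qh nilb] := nil_pow _ _ _ bq hnb.
have [m hm] := rwt_pow i p ha; have [m' hm'] := rwt_pow i q hb.
apply: (IH (h - p)%N (h' - q)%N m m' _ _ hm hm' ap bq _ nila nilb); last by lia.
have [C Cpos e] := skew_leibniz i (p + q) ha hb.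
move: e; rewrite Fab (islin0 (ra_lin _)) => /esym.
have pq : (p < (p + q).+1)%N by lia.
rewrite (bigD1 (Ordinal pq)) //= big1 ?addr0 => [|k kp].
  rewrite addKn => /eqP; rewrite scaler_eq0 => /orP[|/eqP //].
  by rewrite (negPf (lpos_neq0 (Cpos p (leq_addr _ _)))).
have {}kp : (k != p :> nat) by apply: contra kp => /eqP kp; apply/eqP/val_inj.
have [kp'|kp'] := ltnP p k.
  by rewrite apk // (islin0 (bil1 Fb _)) scaler0.
rewrite bqk ?(islin0 (bil2 Fb _)) ?scaler0 //.
by have := ltn_ord k; lia.
Qed.

End Lowering.

Variables (rA : A -> A -> K) (hrA : universal_rform BA rA).
Hypothesis rA_Psi : forall a b, rA a b = r (Psi a) (Psi b).

Lemma ra_tau_neq0 l a : wtP l -> a != 0 -> ra (tau l) a != 0.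
Proof.
move=> Pl; apply: contra => /eqP h.
by rewrite -[a]ra1 -(tauVr Pl) -raM h (islin0 (ra_lin _)).
Qed.

Lemma la_tau_neq0 l a : wtP l -> a != 0 -> la (tau l) a != 0.
Proof.
move=> Pl; apply: contra => /eqP h.
by rewrite -[a]la1 -(tauVl Pl) -laM h (islin0 (la_lin _)).
Qed.

(** ** Equivariant products *)

Section Equivariant.
Variable F : A -> A -> A.
Hypothesis Fb : bilinear_map F.

Lemma equivariant_skew :
  (forall u a b, ra u (F a b) = \sum_(t <- Defs.cop H u) F (ra t.1 a) (ra t.2 b)) ->
  forall sg i l l' a b, rwt l a -> rwt l' b ->
  exists y y', [/\ exponent D y, exponent D y' &
    ra (gen sg i) (F a b) =
    qpow D y *: F (ra (gen sg i) a) b + qpow D y' *: F a (ra (gen sg i) b)].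
Proof.
move=> Feq sg i l l' a b [Pl ha] [Pl' hb]; have Pa := wtP_alpha i; have PNa := wtPN Pa.
have Gb : bilinear_map (fun u v => F (ra u a) (ra v b)).
  split=> [v|u]; first exact: (islin_comp (bil1 Fb _) (ra_linu a)).
  exact: (islin_comp (bil2 Fb _) (ra_linu b)).
have e0 : exponent D 0 by exists 0; rewrite mul0r.
rewrite Feq /gen; case: sg.
  exists 0, (form (alpha i) l); split=> //; first exact: form_exponent.
  rewrite (cop_x hH i Gb) !big_cons big_nil /= addr0 ra1 ha //.
  by rewrite (islinZ _ _ (bil1 Fb _)) qpow0 scale1r.
exists (form (- alpha i) l'), 0; split=> //; first exact: form_exponent.
rewrite (cop_y hH i Gb) !big_cons big_nil /= addr0 ra1 hb //.
by rewrite (islinZ _ _ (bil2 Fb _)) qpow0 scale1r.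
Qed.

Variable sg : bool.
Hypothesis Fskew : forall i l l' a b, rwt l a -> rwt l' b ->
  exists y y', [/\ exponent D y, exponent D y' &
    ra (gen sg i) (F a b) =
    qpow D y *: F (ra (gen sg i) a) b + qpow D y' *: F a (ra (gen sg i) b)].
Hypothesis Ftau : forall m a b, wtP m -> ra (tau m) (F a b) = F (ra (tau m) a) (ra (tau m) b).

(** Leading components for the right weights provide weight vectors, to which the
    lowering argument applies. *)
Lemma zero_divisor_extremal a b : a != 0 -> b != 0 -> F a b = 0 ->
  exists m a' b', [/\ rwt m b', a' != 0, b' != 0, F a' b' = 0 &
    forall i, ra (gen sg i) b' = 0].
Proof.
move=> a0 b0 Fab.
have [M [MD Mpr MR Mtot _]] := weight_order.
have Tlin m : islin (fun x => ra (tau m) x) := ra_lin (tau m).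
have [|l [l' [x [y [hx hy x0 y0 Fxy]]]]] := leading_zero_divisor
    Tlin MD Mpr MR Mtot rwt_decomposition (g := fun=> F) Fb _ Fab a0 b0.
- move=> l l' x y [Pl hx] [Pl' hy]; split; last by rewrite subrr; exact: sum_of0.
  split; first exact: wtPD.
  move=> m Pm; rewrite Ftau // hx // hy // (islinZ _ _ (bil1 Fb _)) (islinZ _ _ (bil2 Fb _)).
  by rewrite scalerA chiDr.
- exact: (extremal_zero_divisor Fb Fskew hx hy).
Qed.

End Equivariant.

(** ** The covariantized product *)

Section Covariantized.
Variable sg : bool.
Local Notation k := (~~ sg : nat).

(** This is [r] for [true], and [rbar21 HB r] for [false]. *)
Definition rprime (c d : B) : K := rr sg c (iter k SB d).

Lemma SB_lin n : islin (iter n SB).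
Proof.
elim: n => [|n IH]; first exact: islin_id.
exact: (islin_comp (antipode_lin HB) IH).
Qed.

Definition rA' (a b : A) : K := rprime (Psi a) (Psi b).

Lemma rA'_bil : bilinear_map (rA' : A -> A -> K^o).
Proof.
have rb := rr_bil sg; have Pl := Psi_lin.
split=> [b|a]; first exact: (bil1c rb Pl).
apply: (bil2c rb); apply: (islin_comp (SB_lin _)); exact: Pl.
Qed.

Definition twisted_mul : A -> A -> A := convl BA rA' (fun a b => a * b).
Local Notation P := twisted_mul.

Lemma mul_bil : bilinear_map (fun a b : A => a * b).
Proof. by split=> x; [apply: islin_mull|apply: islin_mulr]; exact: islin_id. Qed.

Lemma mulop_bil : bilinear_map (fun a b : A => b * a).
Proof. by split=> x; [apply: islin_mulr|apply: islin_mull]; exact: islin_id. Qed.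

Lemma twisted_mul_bil : bilinear_map P.
Proof. exact: convl_bilinear rA'_bil mul_bil. Qed.

(** For [r] this is the braiding axiom in [A]; [rbar21] is the convolution inverse of
    [r] with its arguments exchanged. *)
Lemma twisted_mulC a b : P a b = convr BA rA' (fun a b => b * a) a b.
Proof.
have braided := rform_braided hrA.
have rAE : rA = fun a b => r (Psi a) (Psi b) by apply/funext => x; apply/funext => y.
rewrite rAE in braided; rewrite /twisted_mul /rA' /rprime; case: sg => /=; first exact: braided.
pose s x y := r (Psi y) (Psi x); pose t x y := r (SB (Psi y)) (Psi x).
have rb := rform_bil hr; have Pl := Psi_lin.
have sb : bilinear_map (s : A -> A -> K^o).
  by split=> x; [apply: (bil2c rb) Pl _|apply: (bil1c rb) Pl _].
have SPl : islin (fun x => SB (Psi x)) := islin_comp (antipode_lin HB) Pl.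
have tb : bilinear_map (t : A -> A -> K^o).
  by split=> x; [apply: (bil2c rb) Pl _|apply: (bil1c rb) SPl _].
apply: (convolution_inverse_braided sb tb mulop_bil mul_bil) => x y.
  have := rbar_inverse hr (Psi y) (Psi x).
  have lin2 (f g : B -> B -> K) : bilinear_map (f : B -> B -> K^o) -> bilinear_map (g : B -> B -> K^o) ->
     \sum_(p <- Defs.cop HB (Psi y)) \sum_(q <- Defs.cop HB (Psi x)) f p.1 q.1 * g p.2 q.2 =
     \sum_(q <- cop x) \sum_(p <- cop y) f (Psi p.1) (Psi q.1) * g (Psi p.2) (Psi q.2).
    move=> fb gb.
    rewrite (@Psi_sweedler K^o (fun u v => \sum_(q <- Defs.cop HB (Psi x)) f u q.1 * g v q.2)); last first.
      by split=> u; lin_with ltac:(first [exact: bil1|exact: bil2]).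
    rewrite [RHS]exchange_big; apply: eq_bigr => p _.
    rewrite (@Psi_sweedler K^o (fun u v => f (Psi p.1) u * g (Psi p.2) v)) //.
    by split=> u; lin_with ltac:(first [exact: bil1|exact: bil2]).
  have rbb : bilinear_map (rbar HB r : B -> B -> K^o).
    by split=> u; [apply: (bil1c rb) (antipode_lin HB) _|exact: (bil2 rb)].
  rewrite !lin2 //; case: hPsi => _ _ _ eE; rewrite !eE mulrC.
  by [].
rewrite /convl /convr exchange_big [RHS]exchange_big; exact: braided.
Qed.

Lemma ra_twisted_mul u a b :
  ra u (P a b) = \sum_(t <- Defs.cop H u) P (ra t.2 a) (ra t.1 b).
Proof.
have ib := rA'_bil.
rewrite twisted_mulC (islin_suml _ _ (ra_lin u)).
transitivity (\sum_(t <- Defs.cop H u) \sum_(p <- cop a) \sum_(q <- cop b)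
    rA' p.2 q.2 *: (ra t.1 q.1 * ra t.2 p.1)).
  rewrite [RHS]exchange_big; apply: eq_bigr => p _ /=.
  rewrite (islin_suml _ _ (ra_lin u)) [RHS]exchange_big; apply: eq_bigr => q _ /=.
  rewrite (islinZ _ _ (ra_lin u)) ra_mul scaler_sumr.
  by [].
apply: eq_bigr => t _; rewrite twisted_mulC /convr.
rewrite (sweedler_ra (f := fun x y => \sum_(q <- cop (ra t.1 b)) rA' y q.2 *: (q.1 * x))); last first.
  by split=> y; lin_with ltac:(first [exact: (bil1 ib)|exact: (bil2 ib)]).
apply: eq_bigr => p _.
rewrite (sweedler_ra (f := fun x y => rA' p.2 y *: (x * ra t.2 p.1))) //.
by split=> y; lin_with ltac:(first [exact: (bil1 ib)|exact: (bil2 ib)]).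
Qed.

Lemma ra_tau_twisted_mul m a b : wtP m ->
  ra (tau m) (P a b) = P (ra (tau m) a) (ra (tau m) b).
Proof.
move=> Pm; rewrite ra_twisted_mul.
rewrite (cop_tau hH Pm (f := fun u v => P (ra v a) (ra u b))) ?big_seq1 //.
have Pb := twisted_mul_bil.
by split=> u; [exact: (bil2c Pb (ra_linu b))|exact: (bil1c Pb (ra_linu a))].
Qed.

Lemma ra_tau_mul m a b : wtP m -> ra (tau m) (a * b) = ra (tau m) a * ra (tau m) b.
Proof.
move=> Pm; rewrite ra_mul.
rewrite (cop_tau hH Pm (f := fun u v => ra u a * ra v b)) ?big_seq1 //.
by split=> u; [apply: islin_mull; exact: ra_linu|apply: islin_mulr; exact: ra_linu].
Qed.

Lemma la_tau_mul m a b : wtP m -> la (tau m) (a * b) = la (tau m) a * la (tau m) b.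
Proof.
move=> Pm.
rewrite [LHS](@sweedler_mul _ _ BA _ (fun x y => E y (tau m) *: x)); last first.
  by split=> x; lin_with ltac:(exact: E_lin1).
rewrite /la mulr_suml; apply: eq_bigr => p _; rewrite mulr_sumr; apply: eq_bigr => q _.
rewrite E_mul (cop_tau hH Pm (Z := K^o) (f := fun u v => E p.2 u * E q.2 v)).
  by rewrite big_seq1 -scalerAl -scalerAr scalerA.
by split=> u; [apply: islin_kmull|apply: islin_kmulr]; exact: (E_lin2).
Qed.

Lemma lwt_twisted_mul l l' a b : lwt l a -> lwt l' b -> lwt (l + l') (P a b).
Proof.
move=> [Pl ha] [Pl' hb]; split=> [|m Pm]; first exact: wtPD.
have ib := rA'_bil; have Pb := twisted_mul_bil.
transitivity (P (la (tau m) a) (la (tau m) b)); last first.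
  by rewrite ha // hb // (islinZ _ _ (bil1 Pb _)) (islinZ _ _ (bil2 Pb _)) scalerA chiDr.
rewrite /twisted_mul /convl (islin_suml _ _ (la_lin _)).
rewrite (sweedler_la (f := fun x y => \sum_(q <- cop (la (tau m) b)) rA' x q.1 *: (y * q.2))); last first.
  by split=> y; lin_with ltac:(first [exact: (bil1 ib)|exact: (bil2 ib)]).
apply: eq_bigr => p _; rewrite (islin_suml _ _ (la_lin _)).
rewrite (sweedler_la (f := fun x y => rA' p.1 x *: (la (tau m) p.2 * y))); last first.
  by split=> y; lin_with ltac:(first [exact: (bil1 ib)|exact: (bil2 ib)]).
by apply: eq_bigr => q _; rewrite (islinZ _ _ (la_lin _)) la_tau_mul.
Qed.

Local Notation cov := (cov_mul BA HB Psi rprime).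

Lemma rprimeS (a b : A) : rprime (Psi a) (SB (Psi b)) = rr sg (Psi a) (iter k.+1 SB (Psi b)).
Proof. by rewrite /rprime -iterSr. Qed.

Lemma rA'S_bil : bilinear_map ((fun a b => rprime (Psi a) (SB (Psi b))) : A -> A -> K^o).
Proof.
have rb := rr_bil sg; have Pl := Psi_lin.
split=> [b|a]; first exact: (bil1c rb Pl).
apply: (bil2c rb); apply: (islin_comp (SB_lin _)); apply: (islin_comp (antipode_lin HB)); exact: Pl.
Qed.

Lemma cov_mulE a b : cov a b =
  \sum_(p <- cop a) \sum_(q <- cop b) rprime (Psi p.2) (SB (Psi q.1)) *: P p.1 q.2.
Proof.
have ib := rA'_bil; have sb := rA'S_bil; have Pb := twisted_mul_bil.
rewrite /cov_mul /cop3 big_allpairs_seq; apply: eq_bigr => p _.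
transitivity (\sum_(q <- cop p.1) \sum_(p' <- cop b) \sum_(q' <- cop p'.2)
   (rA' q.1 q'.1 * rprime (Psi p.2) (SB (Psi p'.1))) *: (q.2 * q'.2)).
  apply: eq_bigr => q _; rewrite big_allpairs_seq /=.
  rewrite (@sweedler_assoc _ _ BA _ (fun u v w => (rA' q.1 v * rprime (Psi p.2) (SB (Psi u))) *: (q.2 * w))) //.
  by split=> u v; lin_with ltac:(first [exact: (bil2 ib)|exact: (bil2 sb)]).
rewrite exchange_big; apply: eq_bigr => p' _ /=.
rewrite /twisted_mul /convl scaler_sumr; apply: eq_bigr => q _.
by rewrite scaler_sumr; apply: eq_bigr => q' _; rewrite scalerA mulrC.
Qed.

Lemma cov_mul_bil : bilinear_map cov.
Proof.
have sb := rA'S_bil; have Pb := twisted_mul_bil.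
have -> : cov = fun a b => \sum_(p <- cop a) \sum_(q <- cop b)
    rprime (Psi p.2) (SB (Psi q.1)) *: P p.1 q.2.
  by apply/funext => a; apply/funext => b; exact: cov_mulE.
split=> [b|a].
  apply: (@sweedler_lin _ _ BA _ (fun x y => \sum_(q <- cop b) rprime (Psi y) (SB (Psi q.1)) *: P x q.2)).
  by split=> x; lin_with ltac:(first [exact: (bil1 Pb)|exact: (bil1 sb)]).
apply: islin_sum => p.
apply: (@sweedler_lin _ _ BA _ (fun x y => rprime (Psi p.2) (SB (Psi x)) *: P p.1 y)).
by split=> x; lin_with ltac:(first [exact: (bil2 Pb)|exact: (bil2 sb)]).
Qed.

(** ** Products with an extremal vector *)

Lemma extremal_rA' kap b a : rwt kap b -> (forall i, ra (gen (~~ sg) i) b = 0) ->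
  \sum_(q <- cop b) rA' a q.1 *: q.2 = E a (tau (if odd k then kap else - kap)) *: b.
Proof.
by move=> hb ext; exact: (form_extremal k (Psi a) hb ext).
Qed.

Lemma extremal_rA'S kap b a : rwt kap b -> (forall i, ra (gen (~~ sg) i) b = 0) ->
  \sum_(q <- cop b) rprime (Psi a) (SB (Psi q.1)) *: q.2 =
  E a (tau (if odd k.+1 then kap else - kap)) *: b.
Proof.
move=> hb ext; rewrite -(form_extremal k.+1 (Psi a) hb ext).
by apply: eq_bigr => q _; rewrite rprimeS.
Qed.

Lemma twisted_mul_extremal kap a b : rwt kap b -> (forall i, ra (gen (~~ sg) i) b = 0) ->
  P a b = ra (tau (if odd k then kap else - kap)) a * b.
Proof.
move=> hb ext; rewrite /twisted_mul /convl /ra mulr_suml; apply: eq_bigr => p _.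
rewrite -scalerAl scalerAr -(extremal_rA' _ hb ext) mulr_sumr.
by apply: eq_bigr => q _; rewrite scalerAr.
Qed.

Lemma cov_mul_extremal kap a b : rwt kap b -> (forall i, ra (gen (~~ sg) i) b = 0) ->
  cov a b = ra (tau (if odd k then kap else - kap))
              (la (tau (if odd k.+1 then kap else - kap)) a) * b.
Proof.
move=> hb ext; have Pb := twisted_mul_bil.
rewrite cov_mulE /la (islin_suml _ _ (ra_lin _)) mulr_suml; apply: eq_bigr => p _.
rewrite (islinZ _ _ (ra_lin _)) -scalerAl -(twisted_mul_extremal _ hb ext).
rewrite -(islinZ _ _ (bil2 Pb _)) -(extremal_rA'S _ hb ext) (islin_suml _ _ (bil2 Pb _)).
by apply: eq_bigr => q _; rewrite (islinZ _ _ (bil2 Pb _)).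
Qed.

(** ** The covariantized product of left weight vectors *)

(** The term of degree zero is [P a (b <| t)]; in degree [n] the canonical element adds
    [n], or [- n] for [rbar21], to the left weight of [a]. *)
Lemma cov_mul_leading (M : hdual -> Prop) l l' a b :
  (forall n : N, n != [ffun=> 0%N] -> wlt M 0 (signed sg (rootN n))) ->
  lwt l a -> lwt l' b ->
  above (fun m => la (tau m)) M (l + l') (cov a b - P a (ra (iter k.+1 S (tau (- l))) b)).
Proof.
move=> Mpos ha hb; have [Pl _] := ha; have Pb := twisted_mul_bil.
have ev_s := form_weight sg b k.+1 ha Pb.
have [s [us s0 e]] := eventually_ex [ffun=> 0%N] ev_s.
have -> : cov a b = theta_sum sg s (fun u u' => P (la u a) (ra (iter k.+1 S (u' * tau (- l))) b)).
  rewrite cov_mulE -e; apply: eq_bigr => p _; apply: eq_bigr => q _.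
  by rewrite rprimeS.
rewrite (theta_sum_split sg us s0); last first.
  split=> [u|u]; first exact: (bil1c Pb (la_linu a)).
  apply: (bil2c Pb); apply: (islin_comp (ra_linu b)); apply: (islin_comp (iterS_lin _)).
  by apply: islin_mull; exact: islin_id.
rewrite la1 mul1r [X in above _ _ _ X]addrC addKr big_mkcond; apply: sum_of_sum => n.
case: ifP => n0; last exact: sum_of0.
rewrite big_seq; apply: big_ind => [|x y|t tn]; [exact: sum_of0|exact: sum_ofD|].
apply: sum_of1; exists (l + signed sg (rootN n) + l').
  apply: lwt_twisted_mul; last exact: (lwt_ra).
  have [h1 _] := theta_homog tn; apply: (lwt_la) h1 ha.
  exact/wtP_signed/wtP_rootN.
by have := wlt_addl (l + l') (Mpos n n0); rewrite add0r addrCA addrA.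
Qed.

Lemma covariantized_domain :
  no_zero_divisors (fun a b : A => a * b) <-> no_zero_divisors cov.
Proof.
split=> dom a b ab0; apply: contrapT => /not_orP[/eqP a0 /eqP b0].
- (* the order is reversed for [rbar21], whose terms lower the left weight *)
  have [M [MD Mpr MR Mtot Mpos]] := weight_order.
  pose M' l := M (signed sg l).
  have [] : exists a' b', [/\ a' != 0, b' != 0 & P a' b' = 0].
    have Tlin m : islin (fun x => la (tau m) x) := la_lin (tau m).
    have M'D : add_closed M' by move=> l m h h'; rewrite /M' signedD; exact: MD.
    have sN l : signed sg (- l) = - signed sg l by case: (sg).
    have ss l : signed sg (signed sg l) = l by case: (sg); rewrite /= ?opprK.
    have M'pr l : M' l -> M' (- l) -> Rad l.
      by rewrite /M' sN => h h'; apply: (@Rad_signed _ _ sg); exact: Mpr.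
    have M'R l : Rad l -> M' l.
      move=> Rl; apply: MR; rewrite -[l]ss in Rl; exact: Rad_signed Rl.
    have M'tot l : M' l \/ M' (- l) by rewrite /M' sN; exact: Mtot.
    have M'pos (n : N) : n != [ffun=> 0%N] -> wlt M' 0 (signed sg (rootN n)).
      move=> n0; rewrite /wlt subr0 /M' ss; split; first exact: Mpos.
      move=> /Rad_signed /(rootN_Rad) e.
      by rewrite e eqxx in n0.
    have [|l [l' [x [y [hx hy x0 y0 Pxy]]]]] := leading_zero_divisor Tlin M'D M'pr M'R M'tot
      lwt_decomposition
      (g := fun l x y => P x (ra (iter k.+1 S (tau (- l))) y)) cov_mul_bil _ ab0 a0 b0.
      move=> l l' x y hx hy; split; last exact: cov_mul_leading.
      by apply: lwt_twisted_mul => //; exact: (lwt_ra).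
    exists x, (ra (iter k.+1 S (tau (- l))) y); split=> //.
    have [Pl _] := hx; rewrite (iterS_tau) //; last exact: wtPN.
    by apply: ra_tau_neq0 => //; case: (odd _); rewrite ?opprK //; exact: wtPN.
  move=> a' [b' [a'0 b'0 Pab]].
  have skew i l l' x y (hx : rwt l x) (hy : rwt l' y) : exists y1 y2, [/\ exponent D y1, exponent D y2 &
      ra (gen (~~ sg) i) (P x y) = qpow D y1 *: P (ra (gen (~~ sg) i) x) y +
      qpow D y2 *: P x (ra (gen (~~ sg) i) y)].
    have Pb := twisted_mul_bil; have Qb : bilinear_map (fun u v => P v u).
      by split=> u; [exact: (bil2 Pb)|exact: (bil1 Pb)].
    have Qeq u v w : ra u (P w v) = \sum_(t <- Defs.cop H u) P (ra t.2 w) (ra t.1 v).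
      exact: ra_twisted_mul.
    have [y1 [y2 [e1 e2 e]]] := equivariant_skew Qb Qeq (~~ sg) i hy hx.
    by exists y2, y1; split=> //; rewrite e addrC.
  have [m [x [y [hy x0 y0 Pxy ext]]]] :=
    zero_divisor_extremal twisted_mul_bil skew ra_tau_twisted_mul a'0 b'0 Pab.
  have [Pm _] := hy; rewrite (twisted_mul_extremal _ hy ext) in Pxy.
  case: (dom _ _ Pxy) => /eqP; last by rewrite (negPf y0).
  by apply/negP/ra_tau_neq0 => //; case: (odd _) => //; exact: wtPN.
- have [m [x [y [hy x0 y0 xy0 ext]]]] :=
    zero_divisor_extremal mul_bil (equivariant_skew mul_bil ra_mul (~~ sg))
    ra_tau_mul a0 b0 ab0.
  have [Pm _] := hy; have PNm := wtPN Pm.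
  pose e := if odd k then m else - m; have Pe : wtP e by rewrite /e; case: (odd k).
  have eN : (if odd k.+1 then m else - m) = - e by rewrite /e /=; case: (odd k); rewrite ?opprK.
  have := cov_mul_extremal (la (tau e) (ra (tau (- e)) x)) hy ext.
  rewrite eN laM (tauVl Pe) la1 raM (tauVl Pe) ra1 xy0.
  case/dom => /eqP; last by rewrite (negPf y0).
  by apply/negP/la_tau_neq0 => //; apply/ra_tau_neq0 => //; exact: wtPN.
Qed.

End Covariantized.

End Comodule.
End QuantisedFunctions.

Theorem proposition3p3 (R : realType) (D : cartan_datum R)
    (H : hopf_algebra (Uq D)) (hH : Uq_hopf H)
    (pr : Uq D -> Uq D -> qfield R) (hpr : borel_pairing H pr)
    (Theta : {ffun 'I_(rank D) -> nat} -> seq (Uq D * Uq D))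
    (hTheta : quasi_R_matrix pr Theta)
    (B : algType (qfield R)) (HB : hopf_algebra B)
    (ev : B -> Uq D -> qfield R) (hB : is_kqG H HB ev)
    (r : B -> B -> qfield R) (hr : universal_rform HB r)
    (hrTheta : is_braiding_form Theta ev r)
    (A : algType (qfield R)) (BA : bialgebra A)
    (rA : A -> A -> qfield R) (hrA : universal_rform BA rA)
    (Psi : A -> B) (hPsi : coquasitriangular_hom BA rA HB r Psi)
    (r' : B -> B -> qfield R) (hr' : r' = r \/ r' = rbar21 HB r) :
  no_zero_divisors (fun a b : A => a * b)
  <-> no_zero_divisors (cov_mul BA HB Psi r').
Proof.
have [hom rE] := hPsi.
have main sg := covariantized_domain hH hpr hTheta hB hr hrTheta hom hrA rE sg.
by case: hr' => ->; [exact: (main true) | exact: (main false)].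
Qed.
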